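(* Unit Morita equivalence of marked atlas groupoids is an equivalence relation. Further, if $\mathcal V$ is a (countable, in the second-countable version) representative of the orbifold structure $\mathcal U$ of the orbifold $(Q,\mathcal U)$, then the unit Morita equivalence class of $(\Gamma(\mathcal V),\alpha_{\mathcal V},Q)$ is $$\Gamma(Q,\mathcal U)=\{(\Gamma(\mathcal W),\alpha_{\mathcal W},Q)\mid \mathcal W\text{ is a (countable, in the second-countable version) representative of }\mathcal U\}.$$
   Context: All manifolds are real, smooth ($C^\infty$), Hausdorff and paracompact. Let $Q$ be a topological space, $n\in\mathbb N_0$. A (reduced) orbifold chart of dimension $n$ on $Q$ is a triple $(V,G,\varphi)$ where $V$ is a connected $n$-manifold without boundary, $G$ is a finite subgroup of $\mathrm{Diff}(V)$, and $\varphi\colon V\to Q$ is a map with open image inducing a homeomorphism $G\backslash V\to\varphi(V)$. Charts $(V,G,\varphi),(W,H,\psi)$ are compatible if for each $(x,y)\in V\times W$ with $\varphi(x)=\psi(y)$ there are open connected neighborhoods $\widetilde V\subseteq V$ of $x$, $\widetilde W\subseteq W$ of $y$ and a diffeomorphism $h\colon\widetilde V\to\widetilde W$ with $\psi\circ h=\varphi|_{\widetilde V}$. An orbifold atlas is a set of pairwise compatible orbifold charts of the same dimension on $Q$ whose images cover $Q$; two atlases are equivalent if their union is an atlas; an orbifold structure $\mathcal U$ on $Q$ is an equivalence class of atlases, its elements are called representatives of $\mathcal U$. An orbifold is a pair $(Q,\mathcal U)$ with $Q$ a Hausdorff space that is paracompact (resp. second-countable) and $\mathcal U$ an orbifold structure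 on $Q$; there are two parallel versions (paracompact, second-countable), the result holds in both, and in the second-countable version all representatives are taken countable. A transition on a manifold $M$ is a diffeomorphism between open subsets of $M$. For a representative $\mathcal V=\{(V_i,G_i,\pi_i)\mid i\in I\}$ of $\mathcal U$ put $V=\coprod_i V_i$, $\pi=\coprod_i\pi_i\colon V\to Q$, and let $\Psi(\mathcal V)$ be the set of transitions $f$ on $V$ with $\pi\circ f=\pi|_{\operatorname{dom}f}$. The atlas groupoid $\Gamma(\mathcal V)$ has objects $V$ and arrows $\operatorname{germ}_xf$ ($f\in\Psi(\mathcal V)$, $x\in\operatorname{dom}f$), with source $x$, target $f(x)$ and composition of germs; the smooth structure is such that for each $f$ the set $\{\operatorname{germ}_xf\mid x\in\operatorname{dom} f\}$ is open and $\operatorname{germ}_xf\mapsto x$ is a diffeomorphism of it onto $\operatorname{dom}f$. It is a proper effective étale Lie groupoid. $|G|$ denotes the orbit space of a groupoid $G$; $\alpha_{\mathcal V}\colon|\Gamma(\mathcal V)|\to Q$, $[x]\mapsto\pi(x)$, is a homeomorphism. A marked atlas groupoid is a triple $(\Gamma(\mathcal V),\alpha_{\mathcal V},Q)$ arising in this way from an orbifold $(Q,\mathcal U)$ and a representative $\mathcal V$ of $\mathcal U$. A homomorphism of Lie groupoids is a functor $\varphi=(\varphi_0,\varphi_1)$ with smooth components; $|\varphi|$ is the induced map of orbit spaces. $\varphi\colon G\to H$ is a weak equivalence if $t\circ\mathrm{pr}_1\colon H_1\times_{s,H_0,\varphi_0}G_0\to H_0$ is a surjective submersion and the square formed by $\varphi_1\colon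 G_1\to H_1$, $\varphi_0\times\varphi_0\colon G_0\times G_0\to H_0\times H_0$ and the maps $(s,t)$ is a fibered product. A homomorphism $\varphi\colon(G_1,\alpha_1,X_1)\to(G_2,\alpha_2,X_2)$ of marked atlas groupoids is a unit weak equivalence if $\varphi\colon G_1\to G_2$ is a weak equivalence and $\alpha_2\circ|\varphi|\circ\alpha_1^{-1}=\mathrm{id}_{X_1}$ (so $X_1=X_2$). Marked atlas groupoids $(G_1,\alpha_1,X)$, $(G_2,\alpha_2,X)$ are unit Morita equivalent if there are a marked atlas groupoid $(G,\alpha,X)$ and unit weak equivalences $\psi_j\colon(G,\alpha,X)\to(G_j,\alpha_j,X)$, $j=1,2$. *)

(* Defs.v *)
From HB Require Import structures.
From mathcomp Require Import all_boot all_order all_algebra.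
From mathcomp Require Import all_classical all_reals all_analysis.
Import numFieldNormedType.Exports.

Set Implicit Arguments.
Unset Strict Implicit.
Unset Printing Implicit Defensive.

Local Open Scope classical_set_scope.
Local Open Scope ring_scope.

(** * Topology *)

(* Hausdorffness is not part of this definition. *)
Definition paracompact (T : topologicalType) : Prop :=
  forall C : set (set T), C `<=` open -> \bigcup_(A in C) A = setT ->
  exists D : set (set T),
    [/\ D `<=` open,
        \bigcup_(B in D) B = setT,
        forall B, D B -> exists2 A, C A & B `<=` A
      & forall x : T, exists2 N, nbhs x N &
          finite_set [set B | D B /\ B `&` N !=set0]].

(** * Smooth manifolds *)

Section Manifolds.
Variable R : realType.

(* [f] is of class C^k on the open set [U], in the sense of Frechet: the value
   of [f] outside of [U] is irrelevant, because [U] is open. *)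
Fixpoint class_C (n m k : nat) (U : set 'rV[R]_n) (f : 'rV[R]_n -> 'rV[R]_m) :
    Prop :=
  if k is k'.+1 then
    (forall x, U x -> differentiable f x) /\
    (forall v : 'rV[R]_n, class_C k' U (fun x => 'd f x v : 'rV[R]_m))
  else forall x, U x -> {for x, continuous f}.

Definition smooth_near n m (a : 'rV[R]_n) (f : 'rV[R]_n -> 'rV[R]_m) : Prop :=
  exists U : set 'rV[R]_n, [/\ open U, U a & forall k, class_C k U f].

(* A chart is a total map that is meaningful on its domain only. *)
Record chart (T : topologicalType) := Chart {
  cdim : nat;
  cdom : set T;
  cmap :> T -> 'rV[R]_cdim }.

(* The data of a smooth structure; the axioms are in [manifold] below.
   Different components may have different dimensions. *)
Record smooth_space := Space {
  carrier :> topologicalType;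
  atlas : set (chart carrier) }.

(* The map [g] is, near [c x], the coordinate representation of [f] with
   respect to the charts [c] around [x] and [d] around [f x]. *)
Definition represents (M N : smooth_space) (f : M -> N) (x : M)
    (c : chart M) (d : chart N)
    (g : 'rV[R]_(cdim c) -> 'rV[R]_(cdim d)) : Prop :=
  [/\ cdom c x, cdom d (f x), smooth_near (c x) g &
      \forall z \near x, d (f z) = g (c z)].

Definition smooth_at (M N : smooth_space) (f : M -> N) (x : M) : Prop :=
  {for x, continuous f} /\
  exists (c : chart M) (d : chart N) (g : 'rV[R]_(cdim c) -> 'rV[R]_(cdim d)),
    [/\ atlas c, atlas d & represents f x g].

Definition smooth (M N : smooth_space) (f : M -> N) : Prop :=
  forall x, smooth_at f x.

Definition submersion (M N : smooth_space) (f : M -> N) : Prop :=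
  forall x, {for x, continuous f} /\
  exists (c : chart M) (d : chart N) (g : 'rV[R]_(cdim c) -> 'rV[R]_(cdim d)),
    [/\ atlas c, atlas d, represents f x g &
        forall w : 'rV[R]_(cdim d), exists v, 'd g (c x) v = w].

(* [c] is a homeomorphism of the open set [cdom c] onto an open set. *)
Definition homeomorphic_chart (T : topologicalType) (c : chart T) : Prop :=
  [/\ open (cdom c), set_inj (cdom c) c &
      forall O, O `<=` cdom c -> (open O <-> open (c @` O))].

Definition manifold (M : smooth_space) : Prop :=
  [/\ forall c : chart M, atlas c -> homeomorphic_chart c,
      forall x : M, exists2 c : chart M, atlas c & cdom c x,
      forall (c d : chart M) (x : M),
        atlas c -> atlas d -> cdom c x -> cdom d x ->
        exists g : 'rV[R]_(cdim c) -> 'rV[R]_(cdim d), represents id x g,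
      hausdorff_space M
    & paracompact M].

Definition has_dim (n : nat) (M : smooth_space) : Prop :=
  forall (c : chart M) (x : M), atlas c -> cdom c x -> cdim c = n.

(* [f] restricts to a diffeomorphism between the open sets [D] and [E]. *)
Definition diffeo_on (M N : smooth_space) (D : set M) (E : set N)
    (f : M -> N) : Prop :=
  [/\ open D, open E, set_bij D E f, forall x, D x -> smooth_at f x &
      exists g : N -> M, (forall x, D x -> g (f x) = x) /\
                         (forall y, E y -> smooth_at g y)].

(** ** Products, disjoint unions, submanifolds *)

Definition prod_chart (S T : topologicalType) (c : chart S) (d : chart T) :
    chart (S * T)%type :=
  @Chart (S * T)%type (cdim c + cdim d) (cdom c `*` cdom d)
    (fun p => row_mx (c p.1) (d p.2)).

Definition prod_space (M N : smooth_space) : smooth_space :=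
  @Space (M * N)%type
    [set e | exists (c : chart M) (d : chart N),
       [/\ atlas c, atlas d & e = prod_chart c d]].

Definition coprod_chart (I : choiceType) (T : I -> topologicalType) (i : I)
    (c : chart (T i)) : chart {i & T i} :=
  @Chart {i & T i} (cdim c) (existT T i @` cdom c) (untag 0 c).

Definition coprod_space (I : choiceType) (M : I -> smooth_space) : smooth_space :=
  @Space {i & carrier (M i)}
    [set e | exists (i : I) (c : chart (M i)),
       atlas c /\ e = @coprod_chart I (fun i => carrier (M i)) i c].

(* The structure of an embedded submanifold on a subset [S] of [M]: in the
   coordinates of [M], the inverse [h] of a chart [e] of [S] is smooth and has
   a smooth left inverse [g]. *)
Definition sub_chart (M : smooth_space) (S : set M) (e : chart S) : Prop :=
  homeomorphic_chart e /\
  forall p : S, cdom e p ->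
  exists (c : chart M) (h : 'rV[R]_(cdim e) -> 'rV[R]_(cdim c))
         (g : 'rV[R]_(cdim c) -> 'rV[R]_(cdim e)),
    [/\ atlas c, cdom c (\val p), smooth_near (e p) h,
        smooth_near (c (\val p)) g &
        \forall q \near p, c (\val q) = h (e q) /\ e q = g (c (\val q))].

Definition sub_space (M : smooth_space) (S : set M) : smooth_space :=
  @Space S (@sub_chart M S).

(* The square with sides [p : P -> A], [q : P -> B], [f : A -> C] and
   [g : B -> C] is a fibered product in the category of manifolds. *)
Definition fibered_product (P A B C : smooth_space)
    (p : P -> A) (q : P -> B) (f : A -> C) (g : B -> C) : Prop :=
  [/\ smooth p, smooth q, f \o p = g \o q &
      forall (Z : smooth_space) (a : Z -> A) (b : Z -> B), manifold Z ->
        smooth a -> smooth b -> f \o a = g \o b ->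
        exists! c : Z -> P, [/\ smooth c, p \o c = a & q \o c = b]].

(** * Lie groupoids *)

(* The data of a Lie groupoid. [gcomp b a] is [b] after [a]; it is meaningful
   only if [src b = tgt a]. *)
Record groupoid := Groupoid {
  obj : smooth_space;
  arr : smooth_space;
  src : arr -> obj;
  tgt : arr -> obj;
  gcomp : arr -> arr -> arr }.

Definition is_identity (G : groupoid) (e : arr G) : Prop :=
  [/\ src e = tgt e,
      forall a, tgt a = src e -> gcomp e a = a
    & forall a, src a = tgt e -> gcomp a e = a].

Record groupoid_map (G H : groupoid) := GroupoidMap {
  map0 : obj G -> obj H;
  map1 : arr G -> arr H }.

Definition homomorphism (G H : groupoid) (phi : groupoid_map G H) : Prop :=
  [/\ smooth (map0 phi) /\ smooth (map1 phi),
      forall a, src (map1 phi a) = map0 phi (src a),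
      forall a, tgt (map1 phi a) = map0 phi (tgt a),
      forall a b, src b = tgt a ->
        map1 phi (gcomp b a) = gcomp (map1 phi b) (map1 phi a)
    & forall e, is_identity e -> is_identity (map1 phi e)].

Definition essential_domain (G H : groupoid) (phi : groupoid_map G H) :
    smooth_space :=
  @sub_space (prod_space (arr H) (obj G))
    [set p | src p.1 = map0 phi p.2].

Definition essential_map (G H : groupoid) (phi : groupoid_map G H) :
    essential_domain phi -> obj H :=
  fun p => tgt (\val p).1.

Definition weak_equivalence (G H : groupoid) (phi : groupoid_map G H) : Prop :=
  [/\ homomorphism phi,
      submersion (@essential_map G H phi),
      (forall y, exists p, @essential_map G H phi p = y)
    & @fibered_product (arr G) (arr H) (prod_space (obj G) (obj G))
        (prod_space (obj H) (obj H))
        (map1 phi) (fun a => (src a, tgt a))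
        (fun b => (src b, tgt b))
        (fun p => (map0 phi p.1, map0 phi p.2))].

Definition orbit (G : groupoid) (x : obj G) : set (obj G) :=
  [set y | exists a : arr G, src a = x /\ tgt a = y].

Definition orbit_space (G : groupoid) : Type :=
  {O : set (obj G) | exists x, O = orbit x}.

Definition orbit_class (G : groupoid) (x : obj G) : orbit_space G :=
  exist _ (orbit x) (ex_intro _ x erefl).

Definition orbit_repr (G : groupoid) (O : orbit_space G) : obj G :=
  projT1 (cid (proj2_sig O)).

Definition orbit_map (G H : groupoid) (phi : groupoid_map G H) :
    orbit_space G -> orbit_space H :=
  fun O => orbit_class (map0 phi (orbit_repr O)).

(** ** The groupoid of germs of transitions over a map [pi : M -> Q] *)

Section Germs.
Variables (M : smooth_space) (Q : Type) (pi : M -> Q).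

(* The transition [f] with domain [D] belongs to Psi; [f] is extended
   arbitrarily to a total map. *)
Definition Psi (D : set M) (f : M -> M) : Prop :=
  diffeo_on D (f @` D) f /\ (forall x, D x -> pi (f x) = pi x).

(* A germ is recorded with its source and its target; its last component is
   the set of all maps that agree with it near the source. *)
Definition pregerm : Type := (M * M * set (M -> M))%type.

Definition germ (x : M) (f : M -> M) : pregerm :=
  (x, f x, [set k | \forall z \near x, k z = f z]).

Definition is_germ (a : pregerm) : Prop :=
  exists (D : set M) (f : M -> M) (x : M),
    [/\ Psi D f, D x & a = germ x f].

Definition germ_arrow : Type := {a : pregerm | is_germ a}.

HB.instance Definition _ := gen_eqMixin germ_arrow.
HB.instance Definition _ := gen_choiceMixin germ_arrow.

Definition germ_src (a : germ_arrow) : M := (sval a).1.1.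
Definition germ_tgt (a : germ_arrow) : M := (sval a).1.2.

Definition pregerm_comp (b a : pregerm) : pregerm :=
  (a.1.1, b.1.2,
   [set k | exists k1 k2, [/\ a.2 k1, b.2 k2 &
                              \forall z \near a.1.1, k z = k2 (k1 z)]]).

(* The second case does not occur if the source of [b] is the target of [a]. *)
Definition germ_comp (b a : germ_arrow) : germ_arrow :=
  if pselect (is_germ (pregerm_comp (sval b) (sval a))) is left h
  then exist _ _ h else a.

Definition germs_of (D : set M) (f : M -> M) : set germ_arrow :=
  [set a | exists2 x, D x & sval a = germ x f].

(* These sets are a base of the topology, since Psi is stable under
   restriction. *)
Definition germ_opens : set (set germ_arrow) :=
  [set O | exists D f, Psi D f /\ O = germs_of D f].

HB.instance Definition _ :=
  @isSubBaseTopological.Build germ_arrow (set germ_arrow) germ_opens id.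

Definition germ_chart (D : set M) (f : M -> M) (c : chart M) :
    chart germ_arrow :=
  @Chart germ_arrow (cdim c) (germs_of (D `&` cdom c) f)
    (fun a => c (germ_src a)).

Definition germ_space : smooth_space :=
  @Space germ_arrow
    [set e | exists D f (c : chart M),
       [/\ Psi D f, atlas c & e = germ_chart D f c]].

Definition germ_groupoid : groupoid :=
  @Groupoid M germ_space germ_src germ_tgt germ_comp.

End Germs.

(** * Orbifolds *)

Section Orbifolds.
Variable Q : topologicalType.

Record triple := Triple {
  och_space : smooth_space;
  och_group : set (och_space -> och_space);
  och_map : och_space -> Q }.

Definition finite_diffeo_group (V : smooth_space) (G : set (V -> V)) : Prop :=
  [/\ finite_set G,
      forall g, G g -> diffeo_on setT setT g,
      G id,
      forall g h, G g -> G h -> G (g \o h)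
    & forall g, G g -> exists2 h, G h & cancel g h /\ cancel h g].

(* The last three clauses say that [phi] induces a homeomorphism of the
   quotient of [V] by [G] onto [range phi]: the induced map is well defined and
   injective, and the final topology on the quotient corresponds to the
   topology on the open set [range phi]. *)
Definition orbifold_chart (n : nat) (c : triple) : Prop :=
  let: Triple V G phi := c in
  [/\ [/\ manifold V, has_dim n V & connected [set: V]],
      finite_diffeo_group G,
      open (range phi),
      forall x y, phi x = phi y <-> exists2 g, G g & g x = y
    & forall B, B `<=` range phi -> (open B <-> open (phi @^-1` B))].

Definition compatible (c d : triple) : Prop :=
  let: Triple V G phi := c in
  let: Triple W H psi := d in
  forall x y, phi x = psi y ->
  exists (V' : set V) (W' : set W) (h : V -> W),
    [/\ open V' /\ open W', connected V' /\ connected W', V' x /\ W' y,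
        diffeo_on V' W' h & forall z, V' z -> psi (h z) = phi z].

(* Collections of charts are plain predicates: [triple] is too large a type for
   the library's [set]. *)
Definition collection : Type := triple -> Prop.

Definition orbifold_atlas (S : collection) : Prop :=
  [/\ exists n, forall c, S c -> orbifold_chart n c,
      forall c d, S c -> S d -> compatible c d
    & forall q, exists2 c, S c & range (@och_map c) q].

Definition equivalent_atlas (S S' : collection) : Prop :=
  [/\ orbifold_atlas S, orbifold_atlas S' &
      orbifold_atlas (fun c => S c \/ S' c)].

Definition orbifold_structure (U : collection -> Prop) : Prop :=
  exists2 S, orbifold_atlas S & forall S', U S' <-> equivalent_atlas S S'.

(* A set of charts, enumerated without repetition by an index type. *)
Record indexed_charts := IndexedCharts {
  chart_index : choiceType;
  member :> chart_index -> triple;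
  member_inj : injective member }.

End Orbifolds.

Variant version := Paracompact | SecondCountable.

Definition orbifold (v : version) (Q : topologicalType)
    (U : collection Q -> Prop) : Prop :=
  [/\ hausdorff_space Q,
      match v with
      | Paracompact => paracompact Q
      | SecondCountable => @second_countable Q
      end
    & orbifold_structure U].

Definition representative (v : version) (Q : topologicalType)
    (U : collection Q -> Prop) (V : indexed_charts Q) : Prop :=
  U (fun c => exists i, V i = c) /\
  match v with
  | Paracompact => True
  | SecondCountable => countable [set: chart_index V]
  end.

(** ** Atlas groupoids *)

Definition charts_space Q (V : indexed_charts Q) : smooth_space :=
  coprod_space (fun i => och_space (V i)).

Definition charts_map Q (V : indexed_charts Q) : charts_space V -> Q :=
  fun p => @och_map Q (V (tag p)) (tagged p).

Definition Gamma Q (V : indexed_charts Q) : groupoid := germ_groupoid (@charts_map Q V).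

Definition alpha Q (V : indexed_charts Q) : orbit_space (Gamma V) -> Q :=
  fun O => @charts_map Q V (orbit_repr O).

Record marked_groupoid (X : Type) := MarkedGroupoid {
  mgroupoid : groupoid;
  marking : orbit_space mgroupoid -> X }.

Definition is_marked_atlas_groupoid (v : version) (X : topologicalType)
    (G : marked_groupoid X) : Prop :=
  exists (U : collection X -> Prop) (V : indexed_charts X),
    [/\ orbifold v U, representative v U V
      & G = @MarkedGroupoid X (Gamma V) (@alpha X V)].

Definition marked_atlas_groupoid (v : version) (X : topologicalType) : Type :=
  {G : marked_groupoid X | is_marked_atlas_groupoid v G}.

Definition atlas_groupoid (v : version) (Q : topologicalType)
    (U : collection Q -> Prop) (hU : orbifold v U)
    (V : indexed_charts Q) (hV : representative v U V) : marked_atlas_groupoid v Q :=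
  exist _ (@MarkedGroupoid Q (Gamma V) (@alpha Q V))
    (ex_intro _ U (ex_intro _ V (And3 hU hV erefl))).

(* The last clause is alpha_2 o |phi| o alpha_1^-1 = id, where the marking
   alpha_1 of an atlas groupoid is a bijection. *)
Definition unit_weak_equivalence (X : Type) (G H : marked_groupoid X)
    (phi : groupoid_map (mgroupoid G) (mgroupoid H)) : Prop :=
  weak_equivalence phi /\
  (forall (O : orbit_space (mgroupoid G)) (x : X),
     marking O = x -> marking (orbit_map phi O) = x).

Definition unit_morita (v : version) (X : topologicalType)
    (G1 G2 : marked_atlas_groupoid v X) : Prop :=
  exists (G : marked_atlas_groupoid v X)
         (psi1 : groupoid_map (mgroupoid (sval G)) (mgroupoid (sval G1)))
         (psi2 : groupoid_map (mgroupoid (sval G)) (mgroupoid (sval G2))),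
    unit_weak_equivalence psi1 /\ unit_weak_equivalence psi2.

Definition unit_morita_class (v : version) (X : topologicalType)
    (G : marked_atlas_groupoid v X) : marked_atlas_groupoid v X -> Prop :=
  fun H => unit_morita G H.

Definition orbifold_groupoids (v : version) (Q : topologicalType)
    (U : collection Q -> Prop) (hU : orbifold v U) :
    marked_atlas_groupoid v Q -> Prop :=
  fun G => exists (W : indexed_charts Q) (hW : representative v U W),
    G = atlas_groupoid hU hW.

End Manifolds.

(* Main.v *)
(* Two marked atlas groupoids over Q are unit Morita equivalent if and only if
   they come from the same orbifold structure; both claims follow at once.

   If V and W represent the same structure, every point has a small orbifold chart
   on a connected neighbourhood, stable under its isotropy group, that embeds into
   V and is carried into W by a transition.  These charts form a representative Z
   with etale maps to V and W over Q, and such an etale map conjugates germs of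
   transitions, which gives a unit weak equivalence.

   Conversely, let phi be a unit weak equivalence from Gamma(Z) to Gamma(V).  Since
   Gamma(V) is etale, phi_0 is locally the essential map, hence a submersion, and
   has local smooth sections s by the inverse function theorem.  The identity
   arrows at phi_0(x) lift to arrows from x to s(phi_0(x)); these lifts depend
   continuously on x, and one of them is an identity, so they are all identities
   near it and s inverts phi_0.  Thus phi_0 is etale over Q, and Z and V
   are compatible. *)

(* Coordinate arguments rest on the chart axioms collected in [premanifold], which pass to disjoint
   unions and open subsets. Genuine manifolds occur in two places: the charts of Z must be orbifold
   charts, and the fibered product in a weak equivalence can be tested on manifolds only. Both are
   served by open sets inside a single chart domain, since the coordinates embed them in a Euclidean
   space, from which they inherit Hausdorffness and paracompactness.

   The lift over the base point is found to be an identity by the uniqueness half of the universal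
   property, applied to constant families: the constant lift and the constant identity arrow lie
   over the same data. Nearby lifts are then identities because the germs of the identity map form
   an open set of arrows.

   Transitivity is not obtained by composing spans. A span determines the orbifold structure, and
   any two representatives of one structure are joined by a new span. *)
From HB Require Import structures.
Require Import Defs.
From Stdlib Require Import RelationClasses.
From mathcomp Require Import all_boot all_order all_algebra.
From mathcomp Require Import all_classical all_reals all_analysis.
From mathcomp Require Import lra ring.
Import Order.TTheory GRing.Theory Num.Theory numFieldNormedType.Exports.

Set Implicit Arguments.
Unset Strict Implicit.
Unset Printing Implicit Defensive.

Local Open Scope classical_set_scope.
Local Open Scope ring_scope.

(** * Functions of class C^k *)

(* [filterS] and [filterI] do not apply at a matrix, where unification unfolds
   the filter of neighbourhoods. *)
Lemma nbhsS (T : topologicalType) (x : T) (P Q : set T) :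
  (forall y, P y -> Q y) -> nbhs x P -> nbhs x Q.
Proof. exact: filterS. Qed.

Lemma nbhsI (T : topologicalType) (x : T) (P Q : set T) :
  nbhs x P -> nbhs x Q -> nbhs x (fun y => P y /\ Q y).
Proof. exact: filterI. Qed.

Lemma near_eq_continuous (S T : topologicalType) (f g : S -> T) x :
  (\forall z \near x, f z = g z) -> {for x, continuous f} ->
  {for x, continuous g}.
Proof.
move=> fg; rewrite /prop_for /continuous_at -(nbhs_singleton fg).
by apply: cvg_trans; apply: near_eq_cvg.
Qed.

Section Calculus.
Variable R : realType.

(** [class_C] with values in an arbitrary normed module, so that scalar functions and matrix entries
    fall under the same calculus. *)
Fixpoint Ck n (W : normedModType R) k (U : set 'rV[R]_n) (f : 'rV[R]_n -> W) :
    Prop :=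
  if k is k'.+1 then
    (forall x, U x -> differentiable f x) /\
    (forall v : 'rV[R]_n, Ck k' U (fun x => 'd f x v : W))
  else forall x, U x -> {for x, continuous f}.

Lemma class_CE n m k (U : set 'rV[R]_n) (f : 'rV[R]_n -> 'rV[R]_m) :
  class_C k U f = Ck k U f.
Proof.
elim: k f => //= k IH f.
by congr and; apply: eq_forall => v; rewrite IH.
Qed.

Lemma near_eq_differentiable (V W : normedModType R) (f g : V -> W) x :
  (\forall z \near x, f z = g z) -> differentiable f x ->
  differentiable g x /\ 'd g x = 'd f x :> (V -> W).
Proof.
move=> fg df.
have E : g \o shift x = cst (g x) + 'd f x +o_ 0 id.
  rewrite -(nbhs_singleton fg).
  have /eqaddoP df0 := diff_locally df.
  apply/eqaddoP => e /df0 H.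
  have : \forall z \near 0, f (z + x) = g (z + x).
    move: fg; rewrite (near_shift 0); apply: filterS => z /=.
    by rewrite subr0.
  move: H; apply: filterS2 => z /=; rewrite /= => + E.
  by rewrite !fctE /= E (nbhs_singleton fg).
have E2 := diff_unique (diff_continuous df) E.
split => //; apply/diff_locallyP; rewrite E2; split => //.
exact: diff_continuous.
Qed.

Lemma Ck_ext n (W : normedModType R) k (U : set 'rV[R]_n) (f g : 'rV[R]_n -> W) :
  open U -> (forall x, U x -> f x = g x) -> Ck k U f -> Ck k U g.
Proof.
move=> oU; elim: k f g => /= [|k IH] f g fg.
  move=> cf x Ux; apply: near_eq_continuous (cf x Ux).
  have : nbhs x U by apply: open_nbhs_nbhs.
  by apply: filterS => z /= Uz; rewrite fg.
have fgn x : U x -> \forall z \near x, f z = g z.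
  move=> Ux; have : nbhs x U by apply: open_nbhs_nbhs.
  by apply: filterS => z /= Uz; rewrite fg.
move=> [df Cdf]; split=> [x Ux|v].
  by have [] := near_eq_differentiable (fgn _ Ux) (df _ Ux).
apply: IH (Cdf v) => x Ux.
by have [_ ->] := near_eq_differentiable (fgn _ Ux) (df _ Ux).
Qed.

Lemma Ck_sub n (W : normedModType R) k (U V : set 'rV[R]_n) (f : 'rV[R]_n -> W) :
  U `<=` V -> Ck k V f -> Ck k U f.
Proof.
move=> UV; elim: k f => /= [|k IH] f; first by move=> H x /UV; apply: H.
by move=> [H1 H2]; split => [x /UV|v]; [apply: H1|apply: IH].
Qed.

Lemma Ck_pred n (W : normedModType R) k (U : set 'rV[R]_n) (f : 'rV[R]_n -> W) :
  Ck k.+1 U f -> Ck k U f.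
Proof.
elim: k f => /= [|k IH] f [df Cdf].
  by move=> x Ux; apply: differentiable_continuous; apply: df.
by split=> // v; apply: IH.
Qed.

Lemma Ck_cst n (W : normedModType R) k (U : set 'rV[R]_n) (w : W) :
  Ck k U (fun=> w).
Proof.
elim: k w => /= [|k IH] w; first by move=> x _; apply: cst_continuous.
split=> [x _|v]; first exact: differentiable_cst.
rewrite (_ : (fun x => _) = fun=> 0) //; apply/funext => x.
by rewrite diff_cst.
Qed.

Lemma Ck_comp_lin n (W W' : normedModType R) k (U : set 'rV[R]_n)
    (f : 'rV[R]_n -> W) (L : {linear W -> W'}) :
  open U -> continuous L -> Ck k U f -> Ck k U (L \o f).
Proof.
move=> oU cL; elim: k f => /= [|k IH] f.
  by move=> cf x Ux; apply: continuous_comp; [apply: cf|apply: cL].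
have dL y := linear_differentiable y cL.
move=> [df Cdf]; split=> [x Ux|v].
  by apply: differentiable_comp; [apply: df|].
apply: Ck_ext (IH _ (Cdf v)) => // x Ux /=.
by rewrite (diff_comp (df _ Ux) (dL _)) /= (diff_lin _ cL).
Qed.

Lemma Ck_add n (W : normedModType R) k (U : set 'rV[R]_n) (f g : 'rV[R]_n -> W) :
  open U -> Ck k U f -> Ck k U g -> Ck k U (fun x => f x + g x).
Proof.
move=> oU; elim: k f g => /= [|k IH] f g.
  move=> cf cg x Ux; exact: (continuousD (cf x Ux) (cg x Ux)).
move=> [df Cdf] [dg Cdg]; split=> [x Ux|v].
  exact: (differentiableD (df _ Ux) (dg _ Ux)).
apply: Ck_ext (IH _ _ (Cdf v) (Cdg v)) => // x Ux.
by rewrite (diffD (df _ Ux) (dg _ Ux)).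
Qed.

Lemma Ck_sum n (W : normedModType R) k (U : set 'rV[R]_n) (I : Type) (s : seq I)
    (P : pred I) (f : I -> 'rV[R]_n -> W) :
  open U -> (forall i, P i -> Ck k U (f i)) ->
  Ck k U (fun x => \sum_(i <- s | P i) f i x).
Proof.
move=> oU Hf; elim: s => [|i s IH].
  by rewrite (_ : (fun x => _) = fun=> 0);
    [exact: Ck_cst|apply/funext => x; rewrite big_nil].
case Pi : (P i); last first.
  by apply: Ck_ext IH => // x _; rewrite big_cons Pi.
apply: (@Ck_ext _ _ _ _ (fun x => f i x + \sum_(i <- s | P i) f i x)) => //.
  by move=> x _; rewrite big_cons Pi.
by apply: Ck_add => //; apply: Hf.
Qed.

(** Scaling is a continuous bilinear map, so this is the chain rule applied to the pair of [a] and
    [f]. *)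
Lemma diff_scale (V W : normedModType R) (a : V -> R) (f : V -> W) x :
  differentiable a x -> differentiable f x ->
  differentiable (fun z => a z *: f z) x /\
  forall v, 'd (fun z => a z *: f z) x v = 'd a x v *: f x + a x *: 'd f x v.
Proof.
have bilin : bilinear_for (GRing.Scale.Law.clone _ _ *:%R _)
    (GRing.Scale.Law.clone _ _ *:%R _) (@GRing.scale R W).
  by split=> [u'|u] b y z /=; [rewrite scalerDl scalerA|
    rewrite scalerDr !scalerA mulrC].
pose scM := bilinear_isBilinear.Build R R W W _ _ (@GRing.scale R W) bilin.
pose sc : {bilinear R -> W -> W} := HB.pack (@GRing.scale R W) scM.
have csc : continuous (fun p : R * W => sc p.1 p.2).
  by move=> p; apply: scale_continuous.
move=> da df.
have dp := differentiable_pair da df.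
have := differentiable_comp dp (differentiable_bilin (f := sc) (a x, f x) csc).
have := diff_comp dp (differentiable_bilin (f := sc) (a x, f x) csc).
rewrite diff_bilin // diff_pair // => E D; split => // v.
by rewrite [LHS](congr1 (fun h => h v) E) /= addrC.
Qed.

Lemma Ck_scale n (W : normedModType R) k (U : set 'rV[R]_n)
    (a : 'rV[R]_n -> R) (f : 'rV[R]_n -> W) :
  open U -> Ck k U a -> Ck k U f -> Ck k U (fun x => a x *: f x).
Proof.
move=> oU; elim: k W a f => /= [|k IH] W a f.
  move=> cf cg x Ux; exact: (cvgZ (cf x Ux) (cg x Ux)).
move=> [da Cda] [df Cdf]; split=> [x Ux|v].
  by have [] := diff_scale (da _ Ux) (df _ Ux).
apply: (@Ck_ext _ _ _ _ (fun x => 'd a x v *: f x + a x *: 'd f x v)) => //.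
  by move=> x Ux; have [_ ->] := diff_scale (da _ Ux) (df _ Ux).
by apply: Ck_add => //; apply: IH => //; apply: Ck_pred.
Qed.

Lemma Ck_coord n m p k (U : set 'rV[R]_n) (f : 'rV[R]_n -> 'M[R]_(m, p)) i j :
  open U -> Ck k U f -> Ck k U (fun x => f x i j).
Proof.
move=> oU Cf.
have @L : {linear 'M[R]_(m, p) -> R}.
  by exists (fun N : 'M[R]_(_, _) => N i j); do 2![eexists]; do ?[constructor];
     rewrite ?mxE// => ? *; rewrite ?mxE//; move=> ?; rewrite !mxE.
by apply: (@Ck_comp_lin _ _ _ _ _ _ L) => //; apply: coord_continuous.
Qed.

Lemma Ck_coordP n m k (U : set 'rV[R]_n) (f : 'rV[R]_n -> 'rV[R]_m) :
  open U -> (forall j, Ck k U (fun x => f x 0 j)) -> Ck k U f.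
Proof.
move=> oU Cf; rewrite (_ : f = fun x => \sum_(j < m) f x 0 j *: delta_mx 0 j).
  by apply: Ck_sum => // j _; apply: Ck_scale => //; apply: Ck_cst.
by apply/funext => x; rewrite [LHS]row_sum_delta.
Qed.

(** The differential of a composite is not itself a composite. Expanding ['d f x v] in the standard
    basis turns it into a finite sum of coordinates of ['d f x v] times partial derivatives of [g]
    composed with [f], to which the induction hypothesis applies. *)
Lemma Ck_comp n m (W : normedModType R) k (U : set 'rV[R]_n) (V : set 'rV[R]_m)
    (f : 'rV[R]_n -> 'rV[R]_m) (g : 'rV[R]_m -> W) :
  open U -> open V -> (forall x, U x -> V (f x)) ->
  Ck k U f -> Ck k V g -> Ck k U (g \o f).
Proof.
move=> oU oV UV; elim: k f g UV => /= [|k IH] f g UV.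
  move=> cf cg x Ux; exact: (continuous_comp (cf x Ux) (cg _ (UV _ Ux))).
move=> [df Cdf] [dg Cdg]; split=> [x Ux|v].
  exact: (differentiable_comp (df _ Ux) (dg _ (UV _ Ux))).
apply: (@Ck_ext _ _ _ _ (fun x => \sum_(j < m) ('d f x v : 'rV_m) 0 j *:
                                  ('d g (f x) (delta_mx 0 j)))) => //.
  move=> x Ux; rewrite (diff_comp (df _ Ux) (dg _ (UV _ Ux))) /=.
  rewrite [X in _ = 'd g _ X]row_sum_delta linear_sum.
  by apply: eq_bigr => j _; rewrite linearZ.
apply: Ck_sum => // j _; apply: Ck_scale => //; first exact: Ck_coord.
apply: IH (Cdg _) => //; exact: (@Ck_pred _ _ k).
Qed.

End Calculus.

(** * The inverse function theorem *)

Section InverseFunction.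
Variable R : realType.

(** The structure in which Banach's fixed point theorem is applied. *)
Definition complete_rV n : completeNormedModType R :=
  HB.pack_for (completeNormedModType R) 'rV[R]_n (Complete.on 'rV[R]_n).

Lemma Ck_prod n k (U : set 'rV[R]_n) (I : Type) (s : seq I)
    (f : I -> 'rV[R]_n -> R) :
  open U -> (forall i, Ck k U (f i)) ->
  Ck k U (fun x => \prod_(i <- s) f i x).
Proof.
move=> oU Hf; elim: s => [|i s IH].
  by apply: (Ck_ext oU _ (Ck_cst k U (1 : R))) => x _; rewrite big_nil.
apply: (Ck_ext oU _ (Ck_scale oU (Hf i) IH)) => x _ /=.
by rewrite big_cons.
Qed.

Lemma Ck_det n p k (U : set 'rV[R]_n) (A : 'rV[R]_n -> 'M[R]_p) :
  open U -> (forall i j, Ck k U (fun x => A x i j)) ->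
  Ck k U (fun x => \det (A x)).
Proof.
move=> oU Hf.
have H (c : R) (t : 'I_p -> 'I_p) : Ck k U (fun x => c *: \prod_i A x i (t i)).
  by apply: Ck_scale => //; [exact: Ck_cst|exact: Ck_prod].
by apply: Ck_sum => // s _; apply: H.
Qed.

(** The derivative of the inverse is [- a^-2 'd a], which involves only [a^-1] and ['d a], both of
    class C^k by induction. *)
Lemma Ck_inv n k (U : set 'rV[R]_n) (a : 'rV[R]_n -> R) :
  open U -> (forall x, U x -> a x != 0) -> Ck k U a ->
  Ck k U (fun x => (a x)^-1).
Proof.
move=> oU a0; elim: k => /= [|k IH].
  by move=> ca x Ux; apply: continuousV; [apply: a0|apply: ca].
move=> [da Cda]; split=> [x Ux|v].
  exact: (differentiableV (da _ Ux) (a0 _ Ux)).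
have Ca : Ck k U a by apply: Ck_pred; split.
apply: (@Ck_ext _ _ _ _ _ (fun x => (-1) *: ((a x)^-1 *: ((a x)^-1 *: 'd a x v)))) => //.
  move=> x Ux; have -> : 'd (fun x => (a x)^-1) x v = - (a x) ^- 2 *: 'd a x v.
    exact: (congr1 (fun h => h v) (diffV (da _ Ux) (a0 _ Ux))).
  move: ('d a x v) (a x) => p q.
  by rewrite -exprVn expr2 /GRing.scale /= mulN1r mulrA mulNr.
apply: Ck_scale => //; first exact: Ck_cst.
by do 2![apply: Ck_scale => //; first exact: IH].
Qed.

(** Cramer's rule: an entry of the inverse is a cofactor divided by the determinant. *)
Lemma Ck_invmx n p k (U : set 'rV[R]_n) (A : 'rV[R]_n -> 'M[R]_p) i j :
  open U -> (forall x, U x -> A x \in unitmx) ->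
  (forall i j, Ck k U (fun x => A x i j)) ->
  Ck k U (fun x => invmx (A x) i j).
Proof.
move=> oU uA Hf.
have dA x : U x -> \det (A x) != 0 by move=> /uA; rewrite unitmxE unitfE.
apply: (@Ck_ext _ _ _ _ _ (fun x => (\det (A x))^-1 *: (((-1) ^+ (j + i) : R) *:
    \det (row' j (col' i (A x)))))) => //.
  by move=> x Ux; rewrite /invmx uA // !mxE.
apply: Ck_scale => //; first by apply: Ck_inv => //; apply: Ck_det.
apply: Ck_scale => //; first exact: Ck_cst.
apply: Ck_det => // i' j'; apply: Ck_ext (Hf (lift j i') (lift i j')) => // x _.
by rewrite !mxE.
Qed.

Lemma continuous_linear_rV n (W : normedModType R) (L : {linear 'rV[R]_n -> W}) :
  continuous L.
Proof.
have E : L = (fun x : 'rV[R]_n => \sum_(j < n) x 0 j *: L (delta_mx 0 j)) :> (_ -> _).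
  apply/funext => x; rewrite [X in L X = _]row_sum_delta linear_sum.
  by apply: eq_bigr => j _; rewrite linearZ.
rewrite E => x.
suff : Ck 0 setT (fun x : 'rV[R]_n => \sum_(j < n) x 0 j *: L (delta_mx 0 j)).
  by apply.
apply: Ck_sum; first exact: openT.
move=> j _; apply: Ck_scale; first exact: openT.
  by move=> y _; apply: coord_continuous.
exact: Ck_cst.
Qed.

Lemma rV_norm_le n (x : 'rV[R]_n) M :
  0 <= M -> (`|x| <= M) <-> (forall j, `|x 0 j| <= M).
Proof.
move=> M0; have -> : `|x| = mx_norm x by [].
rewrite mx_normrE; split.
  move=> H j; apply: le_trans H.
  exact: (le_bigmax _ (fun ij : 'I_1 * 'I_n => `|x ij.1 ij.2|) (0, j)).
by move=> H; apply: bigmax_le => // -[i j] _ /=; rewrite (ord1 i).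
Qed.

Lemma rV_norm_sum n (x : 'rV[R]_n) (W : normedModType R) (f : 'I_n -> W) c :
  0 <= c -> (forall j, `|f j| <= c) ->
  `|\sum_(j < n) x 0 j *: f j| <= n%:R * c * `|x|.
Proof.
move=> c0 fc; apply: le_trans (ler_norm_sum _ _ _) _.
have -> : n%:R * c * `|x| = \sum_(j < n) c * `|x|.
  by rewrite sumr_const card_ord -[RHS]mulr_natl mulrA.
apply: ler_sum => j _; rewrite normrZ mulrC.
apply: ler_pM => //; have /(rV_norm_le x (normr_ge0 x)) := lexx `|x|; exact.
Qed.

(** The scalar mean value theorem on the segment from [w] to [u], one coordinate at a time; the norm
    is the maximum of the coordinates, so the constant [c] survives unchanged. *)
Lemma mean_value n m (f : 'rV[R]_n -> 'rV[R]_m) (u w : 'rV[R]_n) (d c : R) :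
  0 <= c ->
  (forall x, `|x| <= d -> differentiable f x) ->
  (forall x v, `|x| <= d -> `|'d f x v| <= c * `|v|) ->
  `|u| <= d -> `|w| <= d -> `|f u - f w| <= c * `|u - w|.
Proof.
move=> c0 df bf ud wd; apply/rV_norm_le; first by rewrite mulr_ge0.
move=> j; rewrite !mxE.
pose l (t : R) := w + t *: (u - w).
have ld (t : R) : 0 <= t <= 1 -> `|l t| <= d.
  move=> /andP[t0 t1]; have -> : l t = (1 - t) *: w + t *: u.
    by rewrite /l scalerBr scalerBl scale1r -addrA [- _ + _]addrC.
  apply: le_trans (ler_normD _ _) _; rewrite !normrZ (ger0_norm t0).
  have t1' : 0 <= 1 - t by rewrite subr_ge0.
  rewrite (ger0_norm t1') (_ : d = (1 - t) * d + t * d); last first.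
    by rewrite -mulrDl subrK mul1r.
  by apply: lerD; apply: ler_wpM2l.
have lE : l = cst w + ( *:%R^~ (u - w)) by [].
have ds (t : R) : is_diff t l (0 + ( *:%R^~ (u - w))).
  exact: (@is_diffD _ _ _ _ _ _ _ t (is_diff_cst w t) (is_diff_scalel t (u - w))).
have diffl t : differentiable l t by case: (ds t).
have dl t : 'd l t 1 = u - w.
  have [_ /(congr1 (fun h => h 1)) ->] := ds t.
  by rewrite fctE scale1r add0r.
pose phi t := f (l t) 0 j.
have dphi (t : R) : 0 <= t <= 1 -> is_derive t (1 : R) phi ('d f (l t) (u - w) 0 j).
  move=> /ld /df dft.
  have @L : {linear 'M[R]_(1, m) -> R}.
    by exists (fun N : 'M[R]_(_, _) => N 0 j); do 2![eexists]; do ?[constructor];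
     rewrite ?mxE// => ? *; rewrite ?mxE//; move=> ?; rewrite !mxE.
  have cL : continuous L by apply: coord_continuous.
  have dfl := differentiable_comp (diffl t) dft.
  have dphi := differentiable_comp dfl (@linear_differentiable _ _ R L (f (l t)) cL).
  apply: DeriveDef; first exact: diff_derivable.
  rewrite (deriveE _ dphi).
  have dL := @linear_differentiable _ _ R L (f (l t)) cL.
  rewrite [LHS](congr1 (fun h => h 1) (diff_comp dfl dL)).
  rewrite [LHS](congr1 (fun h => h _) (diff_lin _ cL)).
  rewrite -[u - w](dl t).
  exact: (congr1 (fun h => L (h 1)) (diff_comp (diffl t) dft)).
have cphi : {within `[0, 1], continuous phi}.
  apply: continuous_in_subspaceT => t; rewrite inE /= in_itv /= => t01.
  have [D _] := dphi t t01.
  by apply/differentiable_continuous/derivable1_diffP.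
have [t t01] := @MVT_segment _ phi (fun t => 'd f (l t) (u - w) 0 j) 0 1 ler01
  (fun t t01 => dphi t (subset_itv_oo_cc t01)) cphi.
rewrite subr0 mulr1 /phi /l scale1r scale0r addr0 addrCA subrr addr0 => ->.
have tt : 0 <= t <= 1 by move: t01; rewrite in_itv.
have := bf (l t) (u - w) (ld _ tt).
by move=> /rV_norm_le; apply; rewrite mulr_ge0.
Qed.

Lemma differentiable_eps (W W' : normedModType R) (f : W -> W') x :
  differentiable f x -> forall e, 0 < e -> exists2 d, 0 < d &
  forall h, `|h| < d -> `|f (h + x) - (f x + 'd f x h)| <= e * `|h|.
Proof.
move=> df e e0; have /eqaddoP /(_ e e0) := diff_locally df.
move=> /nbhs_ballP [d /= d0 Hd]; exists d => // h hd; apply: (Hd h).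
by rewrite -ball_normE /= sub0r normrN.
Qed.

Lemma eps_differentiable (W W' : normedModType R) (f : W -> W') x
    (L : {linear W -> W'}) :
  continuous L -> (forall e, 0 < e -> exists2 d, 0 < d &
    forall h, `|h| < d -> `|f (h + x) - (f x + L h)| <= e * `|h|) ->
  differentiable f x /\ 'd f x = L :> (W -> W').
Proof.
move=> cL H; have E : f \o shift x = cst (f x) + L +o_ 0 id.
  apply/eqaddoP => e e0; have [d d0 Hd] := H e e0.
  apply/nbhs_ballP; exists d => // h; rewrite -ball_normE /= sub0r normrN => hd.
  exact: Hd.
have dL := diff_unique cL E; split => //.
by apply/diff_locallyP; rewrite dL; split.
Qed.

(* The inverse is the fixed point of [u |-> y - (S u - u)]; near [0] this map is
   a contraction with ratio 1/2. *)
Lemma local_inverse n (S : 'rV[R]_n -> 'rV[R]_n) (U : set 'rV[R]_n) :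
  open U -> U 0 -> (forall k, Ck k U S) -> S 0 = 0 ->
  (forall v, 'd S 0 v = v) ->
  exists (V : set 'rV[R]_n) (T : 'rV[R]_n -> 'rV[R]_n),
    [/\ open V, V 0, forall k, Ck k V T, T 0 = 0
      & forall y, V y -> U (T y) /\ S (T y) = y].
Proof.
move=> oU U0 CS S0 dS0.
(* If each of the [n] basis vectors is displaced by at most [c], the differential is within
   [n * c <= 1/2] of the identity; the successor keeps [c] meaningful for [n = 0]. *)
pose c : R := (2 * n.+1%:R)^-1.
have c_gt0 : 0 < c by rewrite invr_gt0 mulr_gt0.
have nc : n%:R * c <= 2^-1.
  by rewrite /c invfM mulrCA ler_piMr ?invr_ge0 // ler_pdivrMr // mul1r ler_nat leqnSn.
have dS u : U u -> differentiable S u by case: (CS 1) => + _; apply.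
have [DS DSE] : exists DS : 'rV[R]_n -> 'rV[R]_n -> 'rV[R]_n,
  (fun u v => 'd S u v) = DS by eexists.
have linDS u v : DS u v = \sum_(i < n) v 0 i *: DS u (delta_mx 0 i).
  rewrite -DSE {1}(row_sum_delta v) linear_sum.
  by apply: eq_bigr => i _; rewrite linearZ.
have DS0 v : DS 0 v = v by rewrite -DSE.
have CDS k v : Ck k U (fun u => DS u v).
  by rewrite -DSE; case: (CS k.+1) => _ /(_ v).
have near_id : \forall u \near (0 : 'rV[R]_n), U u /\
    forall i, `|DS u (delta_mx 0 i) - delta_mx 0 i| <= c.
  have Hi i : \forall u \near (0 : 'rV[R]_n),
      `|DS u (delta_mx 0 i) - delta_mx 0 i| <= c.
    have ci : {for (0 : 'rV[R]_n), continuous (fun u => DS u (delta_mx 0 i) : 'rV[R]_n)}.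
      exact: (CDS 0).
    have := (cvgrPdist_le _ _).1 ci _ c_gt0.
    move=> /(_ (nbhs_filter _)); apply: nbhsS => u /=.
    by rewrite distrC DS0.
  have nU : nbhs (0 : 'rV[R]_n) U by apply: open_nbhs_nbhs.
  apply: (nbhsI nU); exact: (@filter_forall _ _ _ _ (nbhs_filter (0 : 'rV[R]_n)) Hi).
have [e e0 He] : exists2 e : R, 0 < e & forall u : 'rV[R]_n, `|u| < e ->
    U u /\ forall i, `|DS u (delta_mx 0 i) - delta_mx 0 i| <= c.
  move: near_id => /nbhs_ballP [e /= e0 He]; exists e => // u ue; apply: He.
  by rewrite -ball_normE /= sub0r normrN.
pose d := e / 2.
have d0 : 0 < d by rewrite divr_gt0.
have de : d < e by rewrite ltr_pdivrMr // ltr_pMr // ltr1n.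
have Bd u : `|u| <= d -> U u /\ forall v, `|DS u v - v| <= 2^-1 * `|v|.
  move=> ud; have [Uu Hu] := He u (le_lt_trans ud de); split=> // v.
  have -> : DS u v - v = \sum_(i < n) v 0 i *:
      (DS u (delta_mx 0 i) - delta_mx 0 i).
    rewrite linDS [X in _ - X](row_sum_delta v) -sumrB.
    by apply: eq_bigr => i _; rewrite scalerBr.
  apply: le_trans (rV_norm_sum v (ltW c_gt0) Hu) _.
  exact: (ler_wpM2r (normr_ge0 v) nc).
have lip u w : `|u| <= d -> `|w| <= d ->
    `|(S u - u) - (S w - w)| <= 2^-1 * `|u - w|.
  have dg x : `|x| <= d -> differentiable (S - id) x.
    by move=> /Bd [Ux _]; apply: differentiableB => //; apply: dS.
  move=> ud wd; apply: (@mean_value _ _ (S - id) u w d) => //.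
  move=> x v /Bd [Ux] /(_ v).
  have -> : 'd (S - id) x v = DS x v - v; last by [].
  rewrite -DSE; have [_ /(congr1 (fun h => h v))] :=
    is_diffB (differentiableP (dS x Ux)) (is_diff_id x).
  by [].
(* Since [S - id] is 1/2-Lipschitz, [S] contracts distances at most by a factor 2; this gives the
   Lipschitz constant 2 of the inverse. *)
have expand u w : `|u| <= d -> `|w| <= d -> `|u - w| <= 2 * `|S u - S w|.
  move=> ud wd; have := lip u w ud wd.
  have : `|u - w| <= `|S u - S w| + `|(S u - u) - (S w - w)|.
    apply: le_trans (ler_normB _ _).
    rewrite (_ : S u - S w - (S u - u - (S w - w)) = u - w) //.
    move: (S u) (S w) => p q; rewrite !opprB -[q - w + _]addrA subrKA.
    by rewrite addrCA [p + _]addrC subrK addrC.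
  move=> H1 H2; have : `|u - w| <= `|S u - S w| + 2^-1 * `|u - w|.
    by apply: le_trans H1 _; rewrite lerD2l.
  rewrite -lerBlDr -[X in X - _]mul1r -mulrBl [X in X * _](_ : _ = 2^-1).
    by rewrite mulrC ler_pdivrMr // mulrC.
  by rewrite [X in X - _](splitr 1) div1r addrK.
(* The bound [d / 2] on [y] and the bound [d / 2] on [S u - u] keep the iteration inside the closed
   ball of radius [d]. *)
have surj y : `|y| <= d / 2 -> exists u, `|u| <= d /\ S u = y.
  move=> yd; pose B := [set u : 'rV[R]_n | `|u| <= d].
  pose h u := y - (S u - u).
  have hB : set_fun B B h.
    move=> u /= ud; apply: le_trans (ler_normB _ _) _.
    have := lip u 0 ud; rewrite normr0 S0 !subr0 => /(_ (ltW d0)) H.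
    rewrite [X in _ <= X](splitr d); apply: lerD => //.
    by apply: le_trans H _; rewrite mulrC ler_pM2r ?invr_gt0.
  pose H : {fun B >-> B} := HB.pack h (isFun.Build _ _ _ _ _ hB).
  have ctr : is_contraction H.
    exists (2^-1)%:nng; split; first by rewrite /= invf_lt1 // ltr1n.
    move=> [u w] /= [ud wd]; have := lip u w ud wd; rewrite /h.
    move: (S u - u) (S w - w) => a b; rewrite -[y - a]opprB -opprD normrN.
    by rewrite [a - y + _]subrKA.
  have clB : closed B.
    apply: (@closed_comp _ _ (fun u : 'rV[R]_n => `|u|) [set x | x <= d]).
      by move=> u _; apply: norm_continuous.
    exact: closed_le.
  have [||u ud uE] := @banach_fixed_point R (complete_rV n) B H ctr.
  - exact: clB.
  - by exists 0; rewrite /B /= normr0 ltW.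
  exists u; split => //.
  by have := congr1 (fun z => z + (S u - u)) uE; rewrite /= subrK addrC subrK.
have /choice [T HT] : forall y, exists u, `|y| <= d / 2 -> `|u| <= d /\ S u = y.
  move=> y; have [yd|_] := leP `|y| (d / 2); last by exists 0.
  by have [u Hu] := surj y yd; exists u.
pose V := [set y : 'rV[R]_n | `|y| < d / 2].
have Vd y : V y -> `|T y| <= d /\ S (T y) = y by move=> /ltW /HT.
have T0 : T 0 = 0.
  have V0 : V 0 by rewrite /V /= normr0 divr_gt0.
  have [Td ST] := Vd 0 V0; have := expand (T 0) 0 Td.
  rewrite ST S0 subrr normr0 mulr0 subr0 => /(_ (ltW d0)).
  by rewrite normr_le0 => /eqP.
have lipT y z : V y -> V z -> `|T y - T z| <= 2 * `|y - z|.
  move=> /Vd [yd Sy] /Vd [zd Sz].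
  by have := expand (T y) (T z) yd zd; rewrite Sy Sz.
have oV : open V.
  apply: (@open_comp _ _ (fun u : 'rV[R]_n => `|u|) [set x | x < d / 2]).
    by move=> u _; apply: norm_continuous.
  exact: open_lt.
exists V, T; split => //.
- by rewrite /V /= normr0 divr_gt0.
- have [J JE CJ] : exists2 J : 'rV[R]_n -> 'M[R]_n, forall u v, DS u v = v *m J u &
      forall k i j, Ck k U (fun u => J u i j).
    exists (fun u => \matrix_(i, j) DS u (delta_mx 0 i) 0 j) => [u v|k i j].
      rewrite linDS mulmx_sum_row; apply: eq_bigr => i _; congr (_ *: _).
      by apply/rowP => j; rewrite !mxE.
    by apply: (Ck_ext oU _ (Ck_coord 0 j oU (CDS k (delta_mx 0 i)))) => x _; rewrite mxE.
  (* A row vector [v] killed by the Jacobian satisfies [|v| <= |v| / 2], as the Jacobian is within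
     1/2 of the identity. *)
  have uJ y : V y -> J (T y) \in unitmx.
    move=> /Vd [] /Bd [_ HB] _; rewrite -row_free_unit; apply: inj_row_free => v.
    rewrite -JE => vJ; have := HB v; rewrite vJ sub0r normrN => Hv; apply/eqP.
    by rewrite -normr_le0; move: Hv; have := normr_ge0 v; move: `|v| => t; lra.
  have dT y : V y -> differentiable T y /\ 'd T y = mulmxr (invmx (J (T y))) :> (_ -> _).
    move=> Vy; apply: eps_differentiable; first exact: continuous_linear_rV.
    have [K K0 HK] :=
      linear_lipschitz (@continuous_linear_rV _ _ (mulmxr (invmx (J (T y))))).
    (* The remainder of [T] is minus the remainder of [S], along [w = T (h + y) - T y], times the
       inverse Jacobian: [K] bounds the latter, and 2 comes from [|w| <= 2 |h|], as does the radius
       [d1 / 2] below. *)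
    move=> e' e'0; pose e2 := e' / (2 * K).
    have e20 : 0 < e2 by rewrite divr_gt0 // mulr_gt0.
    have [Td Sy] := Vd y Vy; have [UTy _] := Bd _ Td.
    have [d1 d10 Hd1] : exists2 d1, 0 < d1 & forall h, `|h| < d1 ->
        `|S (h + T y) - (S (T y) + DS (T y) h)| <= e2 * `|h|.
      by rewrite -DSE; apply: differentiable_eps (dS _ UTy) _ e20.
    have [d2 d20 Hd2] : exists2 d2 : R, 0 < d2 &
        forall h : 'rV[R]_n, `|h| < d2 -> V (h + y).
      have : nbhs y V by apply: open_nbhs_nbhs.
      move=> /nbhs_ballP [d2 /= d20 Hd2]; exists d2 => // h hd; apply: Hd2.
      by rewrite -ball_normE /= opprD addrCA subrr addr0 normrN.
    exists (Num.min d2 (d1 / 2)); first by rewrite lt_min d20 divr_gt0.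
    move=> h; rewrite lt_min => /andP[/Hd2 Vhy hd1].
    have [Thd Shy] := Vd _ Vhy.
    have := lipT _ _ Vhy Vy; rewrite addrK; set w := T (h + y) - T y => wh.
    have wd1 : `|w| < d1.
      by apply: le_lt_trans wh _; rewrite mulrC -ltr_pdivlMr.
    have := Hd1 w wd1; rewrite /w subrK -/w Shy Sy.
    rewrite JE.
    set r := _ - _ => Hr; have rE : r = h - w *m J (T y).
      by rewrite /r opprD addrA addrK.
    have -> : T (h + y) - (T y + mulmxr (invmx (J (T y))) h) =
              - (mulmxr (invmx (J (T y))) r).
      by rewrite rE /= mulmxBl mulmxK ?uJ // opprB opprD addrA.
    rewrite normrN; apply: le_trans (HK r) _.
    apply: le_trans (ler_wpM2l (ltW K0) Hr) _.
    apply: le_trans (ler_wpM2l (ltW K0) (ler_wpM2l (ltW e20) wh)) _.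
    rewrite le_eqVlt; apply/orP; left; apply/eqP; rewrite /e2.
    by field; apply: lt0r_neq0.
  (* Bootstrap: the differential of [T] is the inverse of [J \o T], so it is of class C^k as soon as
     [T] is. *)
  have CT k : Ck k V T.
    elim: k => [|k IH].
      by move=> y /dT [dTy _]; apply: differentiable_continuous.
    have Cd v : Ck k V (fun y => v *m invmx (J (T y)) : 'rV[R]_n).
      apply: (@Ck_coordP R n n k V (fun y => v *m invmx (J (T y))) oV) => j.
      have Cs : Ck k V (fun y => \sum_i v 0 i *: (invmx (J (T y)) i j : R)).
        apply: Ck_sum => // i _; apply: Ck_scale => //; first exact: Ck_cst.
        apply: Ck_invmx => // i' j'.
        apply: (Ck_comp oV oU _ IH (CJ k i' j')) => y /Vd [] /Bd [] //.
      by apply: (Ck_ext oV _ Cs) => y _; rewrite mxE.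
    split=> [y /dT []//|v].
    apply: (Ck_ext oV _ (Cd v)) => y /dT [_ E].
    exact: (esym (congr1 (fun h => h v) E)).
  exact: CT.
- by move=> y /Vd [] /Bd [].
Qed.

End InverseFunction.

(** * Germs of smooth maps between coordinate spaces *)

Section SmoothNear.
Variable R : realType.
Implicit Types n m p : nat.

Lemma open_preimage_in (S T : topologicalType) (U : set S) (V : set T) (f : S -> T) :
  open U -> open V -> (forall x, U x -> {for x, continuous f}) ->
  open (U `&` f @^-1` V).
Proof.
move=> oU oV cf; rewrite openE => x [Ux Vfx].
have nU : nbhs x U by apply: open_nbhs_nbhs.
have nV : nbhs x (f @^-1` V) by apply: (cf x Ux); apply: open_nbhs_nbhs.
exact: (nbhsI nU nV).
Qed.

Lemma diff_compE (V1 V2 V3 : normedModType R) (f : V1 -> V2) (g : V2 -> V3) x v :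
  differentiable f x -> differentiable g (f x) ->
  'd (g \o f) x v = 'd g (f x) ('d f x v).
Proof. by move=> df dg; exact: (congr1 (fun h => h v) (diff_comp df dg)). Qed.

Lemma diff_addE (V W : normedModType R) (f g : V -> W) x v :
  differentiable f x -> differentiable g x ->
  'd (fun z => f z + g z) x v = 'd f x v + 'd g x v.
Proof. by move=> df dg; exact: (congr1 (fun h => h v) (diffD df dg)). Qed.

Lemma diff_cstE (V W : normedModType R) (a : W) (x v : V) :
  'd (fun=> a) x v = 0.
Proof. exact: (congr1 (fun h => h v) (diff_cst a x)). Qed.

Lemma diff_linE n (W : normedModType R) (L : {linear 'rV[R]_n -> W}) x v :
  'd L x v = L v.
Proof.
exact: (congr1 (fun h => h v) (diff_lin x (@continuous_linear_rV _ _ _ L))).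
Qed.

Lemma smooth_nearP n m (a : 'rV[R]_n) (f : 'rV[R]_n -> 'rV[R]_m) :
  smooth_near a f <-> exists U, [/\ open U, U a & forall k, Ck k U f].
Proof.
by split=> -[U [oU Ua H]]; exists U; split => // k; move: (H k); rewrite class_CE.
Qed.

Lemma smooth_near_differentiable n m (a : 'rV[R]_n) (f : 'rV[R]_n -> 'rV[R]_m) :
  smooth_near a f -> differentiable f a.
Proof. by move=> /smooth_nearP [U [oU Ua /(_ 1%N) [+ _]]]; apply. Qed.

Lemma smooth_near_continuous n m (a : 'rV[R]_n) (f : 'rV[R]_n -> 'rV[R]_m) :
  smooth_near a f -> {for a, continuous f}.
Proof. by move=> /smooth_nearP [U [oU Ua /(_ 0%N)]]; apply. Qed.

Lemma smooth_near_near n m (a : 'rV[R]_n) (f : 'rV[R]_n -> 'rV[R]_m) :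
  smooth_near a f -> \forall z \near a, smooth_near z f.
Proof.
move=> [U [oU Ua H]]; have : nbhs a U by apply: open_nbhs_nbhs.
by apply: nbhsS => z Uz; exists U.
Qed.

Lemma smooth_near_comp n m p (a : 'rV[R]_n) (f : 'rV[R]_n -> 'rV[R]_m)
    (g : 'rV[R]_m -> 'rV[R]_p) :
  smooth_near a f -> smooth_near (f a) g -> smooth_near a (g \o f).
Proof.
move=> /smooth_nearP [U [oU Ua Hf]] /smooth_nearP [V [oV Va Hg]].
apply/smooth_nearP; exists (U `&` f @^-1` V); split => //.
  by apply: open_preimage_in => //; exact: (Hf 0%N).
move=> k; apply: (Ck_comp _ oV _ _ (Hg k)).
- by apply: open_preimage_in => //; exact: (Hf 0%N).
- by move=> x [].
- by apply: Ck_sub (Hf k); apply: subIsetl.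
Qed.

Lemma near_open (T : topologicalType) (x : T) (P : set T) :
  nbhs x P -> exists U, [/\ open U, U x & forall y, U y -> P y].
Proof. by rewrite nbhsE => -[U [oU Ux] UP]; exists U. Qed.

Lemma smooth_near_ext n m (a : 'rV[R]_n) (f g : 'rV[R]_n -> 'rV[R]_m) :
  (\forall z \near a, f z = g z) -> smooth_near a f -> smooth_near a g.
Proof.
move=> /near_open [V [oV Va fg]] /smooth_nearP [U [oU Ua Hf]].
apply/smooth_nearP; exists (U `&` V); split => //; first exact: openI.
move=> k; apply: (@Ck_ext _ _ _ _ _ f); first exact: openI.
  by move=> x [_ /fg].
by apply: Ck_sub (Hf k); apply: subIsetl.
Qed.

Lemma smooth_near_cst n m (a : 'rV[R]_n) (c : 'rV[R]_m) :
  smooth_near a (fun=> c).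
Proof.
apply/smooth_nearP; exists setT; split => //; first exact: openT.
by move=> k; apply: Ck_cst.
Qed.

Lemma Ck_linear n (W : normedModType R) k (L : {linear 'rV[R]_n -> W}) : Ck k setT L.
Proof.
case: k => [|k]; first by move=> x _; apply: continuous_linear_rV.
split=> [x _|v]; first exact/linear_differentiable/continuous_linear_rV.
rewrite (_ : (fun x => _) = fun=> L v); first exact: Ck_cst.
apply/funext => x.
exact: (congr1 (fun h => h v) (diff_lin x (@continuous_linear_rV _ _ _ L))).
Qed.

Lemma smooth_near_linear n m (a : 'rV[R]_n) (L : {linear 'rV[R]_n -> 'rV[R]_m}) :
  smooth_near a L.
Proof.
apply/smooth_nearP; exists setT; split => //; first exact: openT.
by move=> k; apply: Ck_linear.
Qed.

Lemma smooth_near_id n (a : 'rV[R]_n) : smooth_near a id.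
Proof. exact: (@smooth_near_linear _ _ a idfun). Qed.

Lemma smooth_near_add n m (a : 'rV[R]_n) (f g : 'rV[R]_n -> 'rV[R]_m) :
  smooth_near a f -> smooth_near a g -> smooth_near a (fun x => f x + g x).
Proof.
move=> /smooth_nearP [U [oU Ua Hf]] /smooth_nearP [V [oV Va Hg]].
apply/smooth_nearP; exists (U `&` V); split => //; first exact: openI.
move=> k; apply: Ck_add; first exact: openI.
  by apply: Ck_sub (Hf k); apply: subIsetl.
by apply: Ck_sub (Hg k); apply: subIsetr.
Qed.

Lemma smooth_near_row n m p (a : 'rV[R]_n) (f : 'rV[R]_n -> 'rV[R]_m)
    (g : 'rV[R]_n -> 'rV[R]_p) :
  smooth_near a f -> smooth_near a g ->
  smooth_near a (fun x => row_mx (f x) (g x)).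
Proof.
move=> sf sg.
have sl := smooth_near_comp sf
  (smooth_near_linear (f a) (mulmxr (row_mx 1%:M (0 : 'M[R]_(m, p))))).
have sr := smooth_near_comp sg
  (smooth_near_linear (g a) (mulmxr (row_mx (0 : 'M[R]_(p, m)) 1%:M))).
apply: smooth_near_ext (smooth_near_add sl sr).
apply: filterE => x /=.
by rewrite !mul_mx_row !mulmx1 !mulmx0 add_row_mx add0r addr0.
Qed.

Lemma smooth_near_lsubmx m p (a : 'rV[R]_(m + p)) : smooth_near a lsubmx.
Proof. exact: (@smooth_near_linear _ _ a lsubmx). Qed.

Lemma smooth_near_rsubmx m p (a : 'rV[R]_(m + p)) : smooth_near a rsubmx.
Proof. exact: (@smooth_near_linear _ _ a rsubmx). Qed.

(** By the chain rule the identity matrix of size [n] factors through size [m]. This is the source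
    of the invariance of dimension. *)
Lemma left_inverse_dim n m (a : 'rV[R]_n) (f : 'rV[R]_n -> 'rV[R]_m)
    (g : 'rV[R]_m -> 'rV[R]_n) :
  smooth_near a f -> smooth_near (f a) g -> (\forall x \near a, g (f x) = x) ->
  (n <= m)%N.
Proof.
move=> /smooth_near_differentiable df /smooth_near_differentiable dg gf.
have idE : \forall z \near a, id z = (g \o f) z by apply: nbhsS gf => z /= ->.
have dF (v : 'rV[R]_n) : 'd g (f a) ('d f a v) = v.
  rewrite -diff_compE //; have [did didE] := is_diff_id a.
  have [_ E] := near_eq_differentiable idE did.
  exact: (etrans (congr1 (fun h => h v) E) (congr1 (fun h => h v) didE)).
have E : lin1_mx ('d f a) *m lin1_mx ('d g (f a)) = 1%:M.
  apply/row_matrixP => i; rewrite rowE mulmxA !mul_rV_lin1.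
  by rewrite [LHS]dF rowE mulmx1.
exact: mulmx1_min E.
Qed.

(** Preimages under ['d F a] of the basis vectors form the rows of [B]. On the affine space
    [a + w *m B], recentred at the origin, [F] has the identity as differential, so it has a local
    inverse there, and this inverse is the section. *)
Lemma submersion_section n m (F : 'rV[R]_m -> 'rV[R]_n) (a : 'rV[R]_m) :
  smooth_near a F -> (forall w : 'rV[R]_n, exists v, 'd F a v = w) ->
  exists s : 'rV[R]_n -> 'rV[R]_m,
    [/\ smooth_near (F a) s, s (F a) = a & \forall y \near F a, F (s y) = y].
Proof.
move=> sF surj; have /choice [v vE] : forall i : 'I_n, exists v, 'd F a v = delta_mx 0 i.
  by move=> i; apply: surj.
pose B : 'M[R]_(n, m) := \matrix_i v i.
pose A w := a + w *m B.
have sA w : smooth_near w A.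
  apply: smooth_near_add; first exact: smooth_near_cst.
  exact: (@smooth_near_linear _ _ w (mulmxr B)).
have A0 : A 0 = a by rewrite /A mul0mx addr0.
pose S w := F (A w) + - F a.
have sS : smooth_near 0 S.
  apply: smooth_near_add; last exact: smooth_near_cst.
  by apply: (@smooth_near_comp _ _ _ _ A F) => //; rewrite A0.
have /smooth_nearP [U [oU U0 CS]] := sS.
have S0 : S 0 = 0 by rewrite /S A0 subrr.
have dFB w : 'd F a (w *m B) = w.
  rewrite mulmx_sum_row linear_sum [RHS]row_sum_delta; apply: eq_bigr => i _.
  by rewrite linearZ rowK vE.
have dS0 w : 'd S 0 w = w.
  have dF : differentiable F (A 0) by rewrite A0; apply: smooth_near_differentiable.
  have dA : differentiable A 0 by apply: smooth_near_differentiable.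
  have dAE u : 'd A 0 u = u *m B.
    have dB : differentiable (mulmxr B) (0 : 'rV[R]_n).
      exact/linear_differentiable/continuous_linear_rV.
    have E1 := diff_addE u (differentiable_cst a (0 : 'rV[R]_n)) dB.
    have E2 := diff_cstE a (0 : 'rV[R]_n) u.
    have E3 := diff_linE (mulmxr B) 0 u.
    exact: (etrans E1 (etrans (congr2 +%R E2 E3) (add0r _))).
  have dFA := differentiable_comp dA dF.
  have E1 := diff_addE w dFA (differentiable_cst (- F a) (0 : 'rV[R]_n)).
  have E2 := diff_cstE (- F a) (0 : 'rV[R]_n) w.
  have E3 := diff_compE w dA dF.
  have E4 : 'd F (A 0) (w *m B) = w by rewrite A0; apply: dFB.
  apply: (etrans E1 (etrans (congr2 +%R E3 E2) (etrans (addr0 _) _))).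
  exact: (etrans (congr1 (fun z => 'd F (A 0) z) (dAE w)) E4).
have [V [T [oV V0 CT T0 HT]]] := local_inverse oU U0 CS S0 dS0.
pose C y := y + - F a.
have sC y : smooth_near y C.
  by apply: smooth_near_add; [exact: smooth_near_id|exact: smooth_near_cst].
have C0 : C (F a) = 0 by rewrite /C subrr.
exists (A \o T \o C); split.
- apply: smooth_near_comp => //; apply: smooth_near_comp => //.
  by apply/smooth_nearP; exists V; rewrite C0.
- by rewrite /= C0 T0 A0.
- have : nbhs (F a) (C @^-1` V).
    apply: (smooth_near_continuous (sC (F a))).
    by rewrite C0; apply: open_nbhs_nbhs.
  apply: nbhsS => y /= /HT [_]; rewrite /S /C => /eqP.
  by rewrite subr_eq subrK => /eqP.
Qed.

End SmoothNear.

(** * Smooth maps and diffeomorphisms *)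

Section Spaces.
Variable R : realType.
Implicit Types M N P : smooth_space R.

Definition smooth_transitions M : Prop :=
  forall (c d : chart R M) (x : M),
    atlas c -> atlas d -> cdom c x -> cdom d x ->
    exists g : 'rV[R]_(cdim c) -> 'rV[R]_(cdim d),
      represents (M := M) (N := M) id x g.

(** The local part of [manifold], closed under disjoint unions and open subsets. *)
Definition premanifold M : Prop :=
  [/\ forall c : chart R M, atlas c -> homeomorphic_chart c,
      forall x : M, exists2 c : chart R M, atlas c & cdom c x
    & smooth_transitions M].

Lemma manifold_premanifold M : manifold M -> premanifold M.
Proof. by case. Qed.

Lemma homeomorphic_chart_continuous (T : topologicalType) (c : chart R T) x :
  homeomorphic_chart c -> cdom c x -> {for x, continuous c}.
Proof.
move=> [oc ic hc] cx A /near_open [V [oV Vcx VA]].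
have sub : cdom c `&` c @^-1` V `<=` cdom c by move=> y [].
have oi : open (c @` (cdom c `&` c @^-1` V)).
  have -> : c @` (cdom c `&` c @^-1` V) = V `&` c @` cdom c.
    apply/seteqP; split=> [u [y [cy Vy] yu]|u [Vu [y cy yu]]].
      by rewrite -yu; split => //; exists y.
    by move: Vu; rewrite -yu => Vy; exists y.
  by apply: openI => //; apply/hc.
have : nbhs x (cdom c `&` c @^-1` V).
  by apply: open_nbhs_nbhs; split => //; apply/(hc _ sub).
by apply: nbhsS => y [_ /VA].
Qed.

Lemma homeomorphic_chart_nbhs (T : topologicalType) (c : chart R T) x (A : set T) :
  homeomorphic_chart c -> cdom c x -> nbhs x A ->
  nbhs (c x) (c @` (A `&` cdom c)).
Proof.
move=> [oc ic hc] cx /near_open [U [oU Ux UA]].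
have sub : U `&` cdom c `<=` cdom c by move=> y [].
have : nbhs (c x) (c @` (U `&` cdom c)).
  apply: open_nbhs_nbhs; split; last by exists x.
  by apply/(hc _ sub); apply: openI.
by apply: nbhsS => _ [y [/UA Ay cy] <-]; exists y.
Qed.

Lemma homeomorphic_chartI (T : topologicalType) (c : chart R T) :
  open (cdom c) -> set_inj (cdom c) c ->
  (forall x, cdom c x -> {for x, continuous c}) ->
  (forall x A, cdom c x -> nbhs x A -> nbhs (c x) (c @` (A `&` cdom c))) ->
  homeomorphic_chart c.
Proof.
move=> oc ic cc hc; split => // O Oc; split=> oO.
  rewrite openE => _ [x Ox <-].
  have : nbhs x O by apply: open_nbhs_nbhs.
  by move=> /(hc _ _ (Oc _ Ox)); apply: nbhsS => _ [y [Oy _] <-]; exists y.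
have -> : O = cdom c `&` c @^-1` (c @` O).
  apply/seteqP; split=> [x Ox|x [cx [y Oy yx]]].
    by split; [exact: Oc|exists x].
  by rewrite -(ic y x) ?inE //; apply: Oc.
exact: open_preimage_in.
Qed.

Lemma set_val_continuous (T : topologicalType) (A : set T) :
  continuous (\val : A -> T).
Proof. exact: (@initial_continuous A T \val). Qed.

Lemma nbhs_set_val (T : topologicalType) (A : set T) (x : A) (B : set A) :
  nbhs x B -> exists2 C, nbhs (\val x) C & forall y : A, C (\val y) -> B y.
Proof.
move=> [_ /= [[W oW <-] /= Wx] sWB]; exists W; last by move=> y /sWB.
exact: open_nbhs_nbhs.
Qed.

Definition chart_inv (T : topologicalType) (c : chart R T) (x0 : T)
    (u : 'rV[R]_(cdim c)) : T :=
  xget x0 [set y | cdom c y /\ c y = u].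

Lemma chart_invP (T : topologicalType) (c : chart R T) x0 y :
  cdom c y -> cdom c (chart_inv x0 (c y)) /\ c (chart_inv x0 (c y)) = c y.
Proof.
move=> cy; exact: (@xgetPex _ x0 [set z | cdom c z /\ c z = c y]
  (ex_intro _ y (conj cy erefl))).
Qed.

Lemma chart_invK (T : topologicalType) (c : chart R T) x0 y :
  homeomorphic_chart c -> cdom c y -> chart_inv x0 (c y) = y.
Proof.
by move=> [_ ic _] cy; have [? ?] := chart_invP x0 cy; apply: ic; rewrite ?inE.
Qed.

Lemma chart_inv_near (T : topologicalType) (c : chart R T) x0 x :
  homeomorphic_chart c -> cdom c x ->
  {for c x, continuous (@chart_inv T c x0)} /\
  \forall u \near c x, cdom c (chart_inv x0 u) /\ c (chart_inv x0 u) = u.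
Proof.
move=> hc cx; split.
  move=> A; rewrite /= chart_invK // => nA.
  have := homeomorphic_chart_nbhs hc cx nA.
  by apply: nbhsS => _ [y [Ay cy] <-] /=; rewrite chart_invK.
have nT : nbhs x setT by apply: filterT.
have := homeomorphic_chart_nbhs hc cx nT.
by apply: nbhsS => _ [y [_ cy] <-]; apply: chart_invP.
Qed.

Lemma chart_dom_nbhs M (c : chart R M) x :
  premanifold M -> atlas c -> cdom c x -> nbhs x (cdom c).
Proof. by move=> [hM _ _] /hM [oc _ _] cx; apply: open_nbhs_nbhs. Qed.

Lemma represents_comp M N P (f : M -> N) (h : N -> P) x
    (c : chart R M) (d : chart R N) (e : chart R P)
    (g : 'rV[R]_(cdim c) -> 'rV[R]_(cdim d))
    (k : 'rV[R]_(cdim d) -> 'rV[R]_(cdim e)) :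
  {for x, continuous f} ->
  represents f x g -> represents h (f x) k ->
  represents (h \o f) x (k \o g).
Proof.
move=> cf [cx dx sg fg] [_ ex sk hk]; split => //.
  by apply: smooth_near_comp => //; rewrite -(nbhs_singleton fg).
have hkf := cf _ hk.
by move: (nbhsI fg hkf); apply: nbhsS => z /= [<- ->].
Qed.

(** [smooth_at] provides one pair of charts; transition maps on both sides lead to any other
    pair. *)
Lemma smooth_at_represents M N (f : M -> N) x (c : chart R M) (d : chart R N) :
  premanifold M -> premanifold N -> smooth_at f x ->
  atlas c -> atlas d -> cdom c x -> cdom d (f x) ->
  exists g : 'rV[R]_(cdim c) -> 'rV[R]_(cdim d), represents f x g.
Proof.
move=> [_ _ tM] [_ _ tN] [cf [c' [d' [g [ac' ad' rg]]]]] ac ad cx dx.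
have [c'x d'x _ _] := rg.
have [t rt] := tM c c' x ac ac' cx c'x.
have [t' rt'] := tN d' d (f x) ad' ad d'x dx.
exists (t' \o (g \o t)).
apply: (@represents_comp M N N f id) => //.
by apply: (@represents_comp M M N id f) => //; apply: cvg_id.
Qed.

Lemma smooth_at_comp M N P (f : M -> N) (h : N -> P) x :
  premanifold N -> smooth_at f x -> smooth_at h (f x) -> smooth_at (h \o f) x.
Proof.
move=> [_ _ tN] [cf [c [d [g [ac ad rg]]]]] [ch [d' [e [k [ad' ae rk]]]]].
split; first exact: continuous_comp cf ch.
have [cx dx _ _] := rg; have [d'x _ _ _] := rk.
have [t rt] := tN d d' (f x) ad ad' dx d'x.
exists c, e, (k \o (t \o g)); split => //.
apply: (@represents_comp M N P f h) => //.
by apply: (@represents_comp M N N f id).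
Qed.

Lemma smooth_at_ext M N (f h : M -> N) x :
  (\forall z \near x, f z = h z) -> smooth_at f x -> smooth_at h x.
Proof.
move=> fh [cf [c [d [g [ac ad [cx dx sg fg]]]]]]; split.
  exact: near_eq_continuous cf.
exists c, d, g; split => //; split => //; first by rewrite -(nbhs_singleton fh).
by move: (nbhsI fh fg); apply: nbhsS => z [<-].
Qed.

Lemma smooth_at_id M x : premanifold M -> smooth_at (M := M) (N := M) id x.
Proof.
move=> [_ cov tM]; split; first exact: cvg_id.
have [c ac cx] := cov x; have [g rg] := tM c c x ac ac cx cx.
by exists c, c, g.
Qed.

Lemma smooth_at_cst M N (y : N) x :
  premanifold M -> premanifold N -> smooth_at (M := M) (fun=> y) x.
Proof.
move=> [_ covM _] [_ covN _]; split; first exact: cst_continuous.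
have [c ac cx] := covM x; have [d ad dy] := covN y.
exists c, d, (fun=> d y); split => //; split => //; first exact: smooth_near_cst.
exact: filterE.
Qed.

(** The coordinate representation spreads to nearby points at once, but [smooth_at] also asks for
    continuity there, which has to be recovered from the representation. *)
Lemma smooth_at_near M N (f : M -> N) x :
  premanifold M -> premanifold N -> smooth_at f x ->
  \forall z \near x, smooth_at f z.
Proof.
move=> pM pN [cf [c [d [g [ac ad [cx dx sg fg]]]]]].
have [hM _ _] := pM; have [hN _ _] := pN.
have cc := homeomorphic_chart_continuous (hM _ ac) cx.
have ncx := chart_dom_nbhs pM ac cx.
have ndx := cf _ (chart_dom_nbhs pN ad dx).
have nsg : \forall z \near x, smooth_near (c z) g.
  exact: cc _ (smooth_near_near sg).
have fgg : \forall z \near x, \forall w \near z, d (f w) = g (c w).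
  by apply/near_join.
have ndd : \forall z \near x, \forall w \near z, cdom d (f w).
  by apply/near_join.
move: (nbhsI (nbhsI ncx ndx) (nbhsI nsg (nbhsI fgg ndd))).
apply: nbhsS => z [[cz dz] [sgz [fgz ndz]]]; split; last by exists c, d, g; split.
have [cinv _] := chart_inv_near (f z) (hN _ ad) dz.
(* Near [z] the map is the inverse chart of [d] after [g] after [c], a composite of continuous
   maps. *)
have E : \forall w \near z, (chart_inv (f z) \o (g \o c)) w = f w.
  by move: (nbhsI fgz ndz); apply: nbhsS => w [E dw] /=; rewrite -E chart_invK //; apply: hN.
apply: near_eq_continuous E _.
apply: continuous_comp.
  apply: continuous_comp; first exact: homeomorphic_chart_continuous (hM _ ac) cz.
  exact: smooth_near_continuous.
by rewrite /= -(nbhs_singleton fgz).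
Qed.

Lemma smooth_at_fst M N P (f : M -> prod_space N P) x :
  smooth_at f x -> smooth_at (N := N) (fun z => (f z).1) x.
Proof.
move=> [cf [c [d [g [ac [d1 [d2 [ad1 ad2 dE]]] rg]]]]].
split; first by apply: (continuous_comp cf); apply: cvg_fst.
subst d; case: rg => cx [dx1 dx2] sg fg.
exists c, d1, (lsubmx \o g); split => //; split => //.
  by apply: smooth_near_comp => //; apply: smooth_near_lsubmx.
by apply: nbhsS fg => z /= <-; rewrite row_mxKl.
Qed.

Lemma smooth_at_snd M N P (f : M -> prod_space N P) x :
  smooth_at f x -> smooth_at (N := P) (fun z => (f z).2) x.
Proof.
move=> [cf [c [d [g [ac [d1 [d2 [ad1 ad2 dE]]] rg]]]]].
split; first by apply: (continuous_comp cf); apply: cvg_snd.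
subst d; case: rg => cx [dx1 dx2] sg fg.
exists c, d2, (rsubmx \o g); split => //; split => //.
  by apply: smooth_near_comp => //; apply: smooth_near_rsubmx.
by apply: nbhsS fg => z /= <-; rewrite row_mxKr.
Qed.

Lemma smooth_at_pair M N P (f : M -> N) (h : M -> P) x :
  smooth_transitions M -> smooth_at f x -> smooth_at h x ->
  smooth_at (N := prod_space N P) (fun z => (f z, h z)) x.
Proof.
move=> tM [cf [c [d [g [ac ad rg]]]]] [ch [c' [d' [k [ac' ad' rk]]]]].
split; first exact: cvg_pair.
have [cx dx sg fg] := rg; have [c'x d'x _ _] := rk.
have [t rt] := tM c c' x ac ac' cx c'x.
have [_ _ skt hkt] := @represents_comp M M P id h x c c' d' t k (@cvg_id _ _) rt rk.
exists c, (prod_chart d d'), (fun u => row_mx (g u) ((k \o t) u)); split => //.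
  by exists d, d'.
split => //; first exact: smooth_near_row.
by move: (nbhsI fg hkt); apply: nbhsS => z /= [-> ->].
Qed.

Definition local_diffeo_at M N (f : M -> N) (x : M) : Prop :=
  exists (D : set M) (E : set N), D x /\ diffeo_on D E f.

(** Cutting both neighbourhoods down by the preimages of each other gives open sets on which [f] and
    [h] are mutually inverse and smooth. *)
Lemma local_diffeoI M N (f : M -> N) (h : N -> M) x :
  premanifold M -> premanifold N -> smooth_at f x -> smooth_at h (f x) ->
  (\forall z \near x, h (f z) = z) -> (\forall y \near f x, f (h y) = y) ->
  local_diffeo_at f x.
Proof.
move=> pM pN sf sh hf fh.
have [A [oA Ax HA]] := near_open (nbhsI (smooth_at_near pM pN sf) hf).
have [B [oB Bx HB]] := near_open (nbhsI (smooth_at_near pN pM sh) fh).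
exists (A `&` f @^-1` B), (B `&` h @^-1` A); split => //.
have oAB : open (A `&` f @^-1` B).
  by apply: open_preimage_in => // z /HA [[]].
have oBA : open (B `&` h @^-1` A).
  by apply: open_preimage_in => // z /HB [[]].
split => //.
- split=> [z [Az Bz]|z y|y [By Ay]].
  + by split => //=; have [_ ->] := HA z Az.
  + rewrite !inE => -[Az _] [Ay _] E.
    by have [_ <-] := HA z Az; have [_ <-] := HA y Ay; rewrite E.
  + by exists (h y); rewrite /=; have [_ E] := HB y By; rewrite ?E.
- by move=> z [/HA []].
- by exists h; split=> [z [/HA []]|y [/HB []]].
Qed.

Lemma diffeo_on_inv M N D E (f : M -> N) : diffeo_on D E f ->
  exists h : N -> M, [/\ diffeo_on E D h, forall x, D x -> h (f x) = x
    & forall y, E y -> f (h y) = y].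
Proof.
move=> [oD oE [fDE fi fs] sf [h [hf sh]]].
have fh y : E y -> f (h y) = y by move=> /fs [x Dx <-]; rewrite hf.
exists h; split => //; split => //.
- split=> [y /fs [x Dx <-]|y z|x Dx]; first by rewrite /= hf.
  + by rewrite !inE => Ey Ez hyz; rewrite -(fh y) // -(fh z) // hyz.
  + by exists (f x); [exact: fDE|exact: hf].
- by exists f.
Qed.

Lemma diffeo_on_sub M N D D' E (f : M -> N) : diffeo_on D E f ->
  open D' -> D' `<=` D -> diffeo_on D' (f @` D') f.
Proof.
move=> [oD oE [fDE fi fs] sf [h [hf sh]]] oD' DD'.
have hc y : E y -> {for y, continuous h} by move=> /sh [].
have imE : f @` D' = E `&` h @^-1` D'.
  apply/seteqP; split=> [y [x D'x <-]|y [Ey D'y]].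
    by split; [apply/fDE/DD'|rewrite /= hf //; apply: DD'].
  by exists (h y) => //; have [x Dx <-] := fs y Ey; rewrite hf.
split => //.
- by rewrite imE; apply: open_preimage_in.
- split=> [x D'x|x y|y //]; first by exists x.
  by rewrite !inE => /DD' Dx /DD' Dy; apply: fi; rewrite inE.
- by move=> x /DD'; apply: sf.
- exists h; split=> [x /DD'|y [x /DD' Dx <-]]; first exact: hf.
  exact/sh/fDE.
Qed.

Lemma diffeo_on_comp M N P D E E' F (f : M -> N) (h : N -> P) :
  premanifold N -> premanifold M ->
  diffeo_on D E f -> diffeo_on E' F h -> E `<=` E' ->
  diffeo_on D (h @` E) (h \o f).
Proof.
move=> pN pM dfo dho EE'; have [oD oE [fDE fi fs] sf [f' [ff' sf']]] := dfo.
have [_ ohE [hE hi hs] sh [h' [hh' sh']]] := diffeo_on_sub dho oE EE'.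
split => //.
- split=> [x Dx|x y|_ [y Ey <-]].
  + by exists (f x) => //; apply: fDE.
  + rewrite !inE => Dx Dy E0; apply: fi; rewrite ?inE //.
    by apply: hi; rewrite ?inE //; apply: fDE.
  + by have [x Dx <-] := fs y Ey; exists x.
- by move=> x Dx; apply: smooth_at_comp => //; [exact: sf|apply/sh/fDE].
- exists (f' \o h'); split=> [x Dx|_ [y Ey <-]] /=.
    by rewrite hh' ?ff' //; apply: fDE.
  apply: smooth_at_comp => //; first by apply: sh'; exists y.
  by rewrite hh' //; apply: sf'.
Qed.

Lemma diffeo_on_ext M N D E (f h : M -> N) :
  (forall x, D x -> f x = h x) -> diffeo_on D E f -> diffeo_on D E h.
Proof.
move=> fh [oD oE [fDE fi fs] sf [f' [ff' sf']]]; split => //.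
- split=> [x Dx|x y|y /fs [x Dx <-]]; first by rewrite /= -fh //; apply: fDE.
  + by rewrite !inE => Dx Dy; rewrite -!fh //; apply: fi; rewrite inE.
  + by exists x; rewrite ?fh.
- move=> x Dx; apply: smooth_at_ext (sf x Dx).
  have : nbhs x D by apply: open_nbhs_nbhs.
  by apply: nbhsS => z /fh.
- by exists f'; split=> // x Dx; rewrite -fh // ff'.
Qed.

Lemma diffeo_on_id M D : premanifold M -> open D ->
  diffeo_on D D (id : M -> M).
Proof.
move=> pM oD; split => //.
- by split=> [x|x y|x] //; exists x.
- by move=> x _; apply: smooth_at_id.
- by exists id; split=> // x _; apply: smooth_at_id.
Qed.

Lemma diffeo_on_dim M N D E (f : M -> N) x (c : chart R M) (d : chart R N) :
  premanifold M -> premanifold N -> diffeo_on D E f -> D x ->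
  atlas c -> atlas d -> cdom c x -> cdom d (f x) -> cdim c = cdim d.
Proof.
move=> pM pN [oD oE [fDE fi fs] sf [h [hf sh]]] Dx ac ad cx dx.
have Ey := fDE x Dx.
have [g rg] := smooth_at_represents pM pN (sf x Dx) ac ad cx dx.
have cx' : cdom c (h (f x)) by rewrite hf.
have [k rk] := smooth_at_represents pN pM (sh _ Ey) ad ac dx cx'.
have [_ _ sg fg] := rg; have [_ _ sk hk] := rk.
have gx := nbhs_singleton fg; have kx := nbhs_singleton hk.
have [hM _ _] := pM; have [hN _ _] := pN.
have nD : nbhs x D by apply: open_nbhs_nbhs.
have nE : nbhs (f x) E by apply: open_nbhs_nbhs.
have cf : {for x, continuous f} by case: (sf x Dx).
have ch : {for f x, continuous h} by case: (sh _ Ey).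
have fh y : E y -> f (h y) = y by move=> /fs [z Dz <-]; rewrite hf.
apply/eqP; rewrite eqn_leq; apply/andP; split.
  apply: (left_inverse_dim sg (g := k)); first by rewrite -gx.
  have A : \forall z \near x, k (g (c z)) = c z.
    have hk' := cf _ hk; move: (nbhsI nD (nbhsI fg hk')).
    by apply: nbhsS => z /= [Dz [<- <-]]; rewrite hf.
  have := homeomorphic_chart_nbhs (hM _ ac) cx A.
  by apply: nbhsS => _ [z [E0 _] <-].
apply: (left_inverse_dim sk (g := g)); first by rewrite -kx hf.
have A : \forall y \near f x, g (k (d y)) = d y.
  have fg' : \forall y \near f x, d (f (h y)) = g (c (h y)).
    by have := ch; rewrite /prop_for /continuous_at hf // => /(_ _ fg).
  move: (nbhsI nE (nbhsI hk fg')).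
  by apply: nbhsS => y /= [Ey' [<- <-]]; rewrite fh.
have := homeomorphic_chart_nbhs (hN _ ad) dx A.
by apply: nbhsS => _ [z [E0 _] <-].
Qed.

End Spaces.

(** * The groupoid of germs *)

Section GermTopology.
Variables (R : realType) (M : smooth_space R) (Q : Type) (pi : M -> Q).
Hypothesis pM : premanifold M.
Local Notation GA := (germ_arrow pi).

Lemma Psi_sub D D' f : Psi pi D f -> open D' -> D' `<=` D -> Psi pi D' f.
Proof.
move=> [df pf] oD' DD'; split; last by move=> x /DD' /pf.
exact: diffeo_on_sub df oD' DD'.
Qed.

Lemma Psi_id D : open D -> Psi pi D id.
Proof. by move=> oD; split=> //; rewrite image_id; apply: diffeo_on_id. Qed.

Lemma Psi_comp D D' f f' : Psi pi D f -> Psi pi D' f' -> f @` D `<=` D' ->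
  Psi pi D (f' \o f).
Proof.
move=> [df pf] [df' pf'] DD'; split; last first.
  by move=> x Dx /=; rewrite pf' ?pf //; apply: DD'; exists x.
by rewrite -image_comp; apply: diffeo_on_comp DD' => //; exact: df'.
Qed.

Lemma Psi_open D f : Psi pi D f -> open D.
Proof. by case=> -[]. Qed.

Lemma Psi_smooth D f x : Psi pi D f -> D x -> smooth_at f x.
Proof. by case=> -[_ _ _ sf _] _; apply: sf. Qed.

Lemma Psi_continuous D f x : Psi pi D f -> D x -> {for x, continuous f}.
Proof. by move=> pf Dx; case: (Psi_smooth pf Dx). Qed.

Lemma germ_inj (x x' : M) (f f' : M -> M) : germ x f = germ x' f' ->
  x = x' /\ \forall z \near x, f z = f' z.
Proof.
move=> [<- _ /seteqP [/(_ f) H _]]; split => //; apply: H => /=.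
exact: filterE.
Qed.

Lemma eq_germ (x : M) (f f' : M -> M) :
  (\forall z \near x, f z = f' z) -> germ x f = germ x f'.
Proof.
move=> ff'; rewrite /germ (nbhs_singleton ff'); congr (_, _, _).
apply/seteqP; split=> k /= H; move: (nbhsI H ff'); apply: nbhsS => z [-> ->] //.
Qed.

Lemma germ_arrow_inj (a b : GA) : sval a = sval b -> a = b.
Proof. by case: a b => [a ha] [b hb]; apply: eq_exist. Qed.

Lemma arrow_germ (a : GA) : exists D f,
  [/\ Psi pi D f, D (germ_src a), f (germ_src a) = germ_tgt a &
      sval a = germ (germ_src a) f].
Proof.
move: a => [a [D [f [x [pf Dx aE]]]]]; exists D, f.
by rewrite /germ_src /germ_tgt /= aE.
Qed.

Lemma ex_germ D f x : Psi pi D f -> D x ->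
  exists a : GA, [/\ sval a = germ x f, germ_src a = x & germ_tgt a = f x].
Proof.
move=> pf Dx; have h : is_germ pi (germ x f) by exists D, f, x.
by exists (exist _ _ h).
Qed.

Lemma germs_ofP D f (a : GA) : germs_of D f a <->
  D (germ_src a) /\ sval a = germ (germ_src a) f.
Proof.
split=> [[x Dx aE]|[Dx aE]]; last by exists (germ_src a).
by rewrite /germ_src aE.
Qed.

Lemma germs_of_tgt D f (a : GA) : germs_of D f a -> germ_tgt a = f (germ_src a).
Proof. by case=> x Dx aE; rewrite /germ_tgt /germ_src aE. Qed.

(** Both maps represent [a], so they agree near its source; restricting [f] to such a neighbourhood
    inside [D] and [D'] gives a basic set contained in both. This makes the generating sets a
    base. *)
Lemma germs_of_inter D f D' f' (a : GA) : Psi pi D f ->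
  germs_of D f a -> germs_of D' f' a ->
  open D' -> exists D2, [/\ Psi pi D2 f, germs_of D2 f a,
    (germs_of D2 f : set GA) `<=` germs_of D f,
    (germs_of D2 f : set GA) `<=` germs_of D' f' & D2 `<=` D].
Proof.
move=> pf /germs_ofP [Da aE] /germs_ofP [D'a aE'] oD'.
have [_ /near_open [U [oU Ua HU]]] := germ_inj (etrans (esym aE) aE').
have oD := Psi_open pf.
exists (D `&` (D' `&` U)); split.
- by apply: Psi_sub pf _ _; [apply: openI => //; apply: openI|move=> z []].
- by apply/germs_ofP.
- by move=> b /germs_ofP [[Db _] bE]; apply/germs_ofP.
- move=> b /germs_ofP [[Db [D'b Ub]] bE]; apply/germs_ofP; split => //.
  rewrite bE; apply: eq_germ; have : nbhs (germ_src b) U by apply: open_nbhs_nbhs.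
  exact: nbhsS.
- by move=> z [].
Qed.

Lemma germs_of_open D f : Psi pi D f -> open (germs_of D f : set GA).
Proof.
move=> pf; exists [set germs_of D f : set GA]; last by rewrite bigcup_set1.
by move=> _ ->; apply: finI_from1; exists D, f.
Qed.

(** The topology is given by a subbase; [germs_of_inter] reduces a finite intersection to one basic
    set, and for the empty intersection any representative of [a] will do. *)
Lemma germ_nbhs (a : GA) A : nbhs a A ->
  exists D f, [/\ Psi pi D f, germs_of D f a & (germs_of D f : set GA) `<=` A].
Proof.
rewrite nbhsE => -[W [oO Oa] OA].
move: oO Oa OA => [F sF <-] [B FB Ba] OA.
have {}OA : B `<=` A by move=> b Bb; apply: OA; exists B.
have [X sX BE] := sF _ FB.
pose s0 : seq (set GA) := finmap.enum_fset X.
have HX : forall W, W \in s0 -> @germ_opens R M Q pi W /\ W a.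
  move=> Y WX; split; first by have := sX Y WX; rewrite inE.
  by move: Ba; rewrite -BE; apply; exact: WX.
have [D [f [pf Da sD]]] : exists D f, [/\ Psi pi D f, germs_of D f a &
    forall W, W \in s0 -> (germs_of D f : set GA) `<=` W].
  elim: s0 HX => [|Y s IH] HX.
    have [D [f [pf Da _ aE]]] := arrow_germ a; exists D, f; split => //.
    exact/germs_ofP.
  have [|D [f [pf Da sD]]] := IH; first by move=> P Ps; apply: HX; rewrite inE Ps orbT.
  have [[D' [f' [pf' OE]]] Oa] := HX Y (mem_head _ _).
  rewrite OE in Oa *.
  have [D2 [pf2 D2a s1 s2 _]] := germs_of_inter pf Da Oa (Psi_open pf').
  exists D2, f; split => // P; rewrite inE => /orP [/eqP ->|Ps] //.
  by apply: subset_trans s1 _; apply: sD.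
exists D, f; split => //; apply: subset_trans OA; rewrite -BE => b Db P PX.
exact: (sD P PX).
Qed.

Lemma germs_of_nbhs D f (a : GA) : Psi pi D f -> germs_of D f a ->
  nbhs a (germs_of D f : set GA).
Proof. by move=> pf Da; apply: open_nbhs_nbhs; split => //; apply: germs_of_open. Qed.

Lemma germ_src_continuous : continuous (@germ_src R M Q pi).
Proof.
move=> a A nA; have [D [f [pf Da _ aE]]] := arrow_germ a.
have [U [oU Ua UA]] := near_open nA; have oD := Psi_open pf.
have pU : Psi pi (D `&` U) f by apply: Psi_sub pf _ _ => [|z []//]; exact: openI.
have : nbhs a (germs_of (D `&` U) f : set GA).
  by apply: germs_of_nbhs => //; apply/germs_ofP.
by apply: nbhsS => b /germs_ofP [[_ /UA]].
Qed.

Lemma near_germs_of_tgt (a : GA) D f : Psi pi D f -> germs_of D f a ->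
  \forall b \near a, germ_tgt b = f (germ_src b).
Proof.
by move=> pf Da; apply: nbhsS (germs_of_nbhs pf Da) => b; apply: germs_of_tgt.
Qed.

Lemma germ_tgt_continuous : continuous (@germ_tgt R M Q pi).
Proof.
move=> a; have [D [f [pf Da _ aE]]] := arrow_germ a.
have Ga : germs_of D f a by apply/germs_ofP.
have E := near_germs_of_tgt pf Ga.
apply: (@near_eq_continuous _ _ (f \o @germ_src R M Q pi)).
  by apply: nbhsS E => b ->.
apply: continuous_comp; first exact: germ_src_continuous.
exact: Psi_continuous pf Da.
Qed.

Local Notation GS := (germ_space pi).

Lemma germ_atlas D f (c : chart R M) : Psi pi D f -> atlas c ->
  atlas (s := GS) (germ_chart pi D f c).
Proof. by move=> pf ac; exists D, f, c. Qed.

(** Charts of the germ space are charts of [M] read at the source, so beyond continuity only the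
    source has to be examined. *)
Lemma smooth_at_germ (N : smooth_space R) (F : N -> GS) x :
  {for x, continuous F} -> smooth_at (N := M) (fun z => germ_src (F z)) x ->
  smooth_at F x.
Proof.
move=> cF sF; split => //.
have [_ [c [d [g [ac ad [cx dx sg fg]]]]]] := sF.
have [D [f [pf Da _ aE]]] := arrow_germ (F x).
exists c, (germ_chart pi D f d), g; split => //; first exact: germ_atlas.
by split => //; apply/germs_ofP.
Qed.

Lemma germ_space_transitions : smooth_transitions GS.
Proof.
move=> e1 e2 a [D [f [c [pf ac ->]]]] [D' [f' [c' [pf' ac' ->]]]] Da D'a.
have [[Dx cx] aE] := (germs_ofP _ _ _).1 Da.
have [[D'x c'x] aE'] := (germs_ofP _ _ _).1 D'a.
have [_ _ tM] := pM; have [g [_ _ sg gE]] := tM c c' (germ_src a) ac ac' cx c'x.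
exists g; split => //.
by apply: nbhsS (germ_src_continuous gE) => b.
Qed.

Lemma smooth_germ_src (a : GS) : smooth_at (M := GS) (N := M) (@germ_src R M Q pi) a.
Proof.
split; first exact: germ_src_continuous.
have [D [f [pf Da _ aE]]] := arrow_germ a.
have [_ cov _] := pM; have [c ac cx] := cov (germ_src a).
exists (germ_chart pi D f c), c, id; split => //; first exact: germ_atlas.
split => //=; first by apply/germs_ofP.
  exact: smooth_near_id.
exact: filterE.
Qed.

Lemma smooth_germ_tgt (a : GS) : smooth_at (M := GS) (N := M) (@germ_tgt R M Q pi) a.
Proof.
have [D [f [pf Da _ aE]]] := arrow_germ a.
have Ga : germs_of D f a by apply/germs_ofP.
apply: (@smooth_at_ext _ GS M (f \o @germ_src R M Q pi)).
  by apply: nbhsS (near_germs_of_tgt pf Ga) => b ->.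
apply: smooth_at_comp => //; first exact: smooth_germ_src.
exact: Psi_smooth pf Da.
Qed.

Lemma Psi_comp_sub D f D' f' : Psi pi D f -> Psi pi D' f' ->
  Psi pi (D `&` f @^-1` D') (f' \o f).
Proof.
move=> pf pf'; have oDD : open (D `&` f @^-1` D').
  apply: open_preimage_in; [exact: Psi_open pf|exact: Psi_open pf'|].
  by move=> z Dz; apply: Psi_continuous pf Dz.
apply: Psi_comp pf' _; first by apply: Psi_sub pf oDD _ => z [].
by move=> _ [z [_ ?] <-].
Qed.

(** Continuity of [f] pulls agreement near the target back to the source, so every member of the
    composite agrees with [f' \o f] near the source. This map also witnesses [is_germ], which
    selects the meaningful case of [germ_comp]. *)
Lemma germ_compE D f D' f' (a b : GA) : Psi pi D f -> germs_of D f a ->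
  Psi pi D' f' -> germs_of D' f' b -> germ_src b = germ_tgt a ->
  sval (germ_comp b a) = germ (germ_src a) (f' \o f).
Proof.
move=> pf Da pf' Db ba; have [Dx aE] := (germs_ofP _ _ _).1 Da.
have [Dy bE] := (germs_ofP _ _ _).1 Db.
have aT := germs_of_tgt Da; have bT := germs_of_tgt Db.
have cf := Psi_continuous pf Dx.
have E : pregerm_comp (sval b) (sval a) = germ (germ_src a) (f' \o f).
  rewrite /pregerm_comp /germ; congr (_, _, _).
    by rewrite /= -aT -ba -bT.
  rewrite bE aE /=; apply/seteqP; split=> k /=.
    move=> [k1 [k2 [h1 h2 h]]].
    have h2' : \forall z \near germ_src a, k2 (f z) = f' (f z).
      have : nbhs (f (germ_src a)) [set y | k2 y = f' y] by rewrite -aT -ba.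
      by move=> /cf.
    by move: (nbhsI h1 (nbhsI h2' h)); apply: nbhsS => z [h1z [<- ->]]; rewrite h1z.
  by move=> hk; exists f, f'; split => //; exact: filterE.
rewrite /germ_comp; case: pselect => //= -[].
rewrite E; exists (D `&` f @^-1` D'), (f' \o f), (germ_src a).
split => //; last by split => //=; rewrite -aT -ba.
exact: Psi_comp_sub.
Qed.

Lemma germ_comp_src D f D' f' (a b : GA) : Psi pi D f -> germs_of D f a ->
  Psi pi D' f' -> germs_of D' f' b -> germ_src b = germ_tgt a ->
  germ_src (germ_comp b a) = germ_src a /\
  germs_of (D `&` f @^-1` D') (f' \o f) (germ_comp b a).
Proof.
move=> pf Da pf' Db ba; have E := germ_compE pf Da pf' Db ba.
have S : germ_src (germ_comp b a) = germ_src a by rewrite /germ_src E.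
split => //; apply/germs_ofP; rewrite S; split => //.
have [Dx _] := (germs_ofP _ _ _).1 Da; have [Dy _] := (germs_ofP _ _ _).1 Db.
by split => //=; rewrite -(germs_of_tgt Da) -ba.
Qed.

Lemma ex_unit x : exists e : GA,
  [/\ sval e = germ x id, germs_of setT id e & germ_src e = x].
Proof.
have [e [eE es et]] := ex_germ (x := x) (Psi_id openT) I.
by exists e; split => //; apply/germs_ofP; rewrite es.
Qed.

Lemma unit_identity (e : GA) : sval e = germ (germ_src e) id ->
  is_identity (G := germ_groupoid pi) e.
Proof.
move=> eE; have Te : germs_of setT id e by apply/germs_ofP.
have et := germs_of_tgt Te; split => //= a ae; apply: germ_arrow_inj.
  have [D [f [pf Da _ aE]]] := arrow_germ a.
  by rewrite (germ_compE pf _ (Psi_id openT) Te) //; apply/germs_ofP.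
have [D [f [pf Da _ aE]]] := arrow_germ a.
rewrite (germ_compE (Psi_id openT) Te pf) //; last exact/germs_ofP.
by rewrite [RHS]aE ae et.
Qed.

(** The composite of [e] with the germ [u] of the identity map at its source equals [u] because [e]
    is an identity, and [e] because [u] is one. *)
Lemma identity_unit (e : GA) : is_identity (G := germ_groupoid pi) e ->
  sval e = germ (germ_src e) id /\ germ_tgt e = germ_src e.
Proof.
move=> [/= est e1 _]; have [u [uE Tu us]] := ex_unit (germ_src e).
have ut := germs_of_tgt Tu; rewrite us in ut.
have [_ _ u2] := unit_identity (etrans uE (congr1 (fun x => germ x id) (esym us))).
have E : germ_comp e u = u by apply: e1; rewrite /= ut.
have E' : germ_comp e u = e by apply: u2; rewrite /= ut.
by split; rewrite -?est // -[in LHS]E' E uE.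
Qed.

End GermTopology.

(** * Etale maps induce weak equivalences *)

Section LocalDiffeo.
Variable R : realType.
Implicit Types M N P : smooth_space R.

Lemma diffeo_on_rep M N D E (f : M -> N) x (c : chart R M) (d : chart R N)
    (g : 'rV[R]_(cdim c) -> 'rV[R]_(cdim d)) :
  premanifold M -> premanifold N -> diffeo_on D E f -> D x ->
  atlas c -> atlas d -> represents f x g ->
  exists k, [/\ smooth_near (d (f x)) k, k (d (f x)) = c x &
                \forall u \near d (f x), g (k u) = u].
Proof.
move=> pM pN [oD oE [fDE fi fs] sf [h [hf sh]]] Dx ac ad rg.
have Ey := fDE x Dx; have [cx dx sg fg] := rg.
have cx' : cdom c (h (f x)) by rewrite hf.
have [k rk] := smooth_at_represents pN pM (sh _ Ey) ad ac dx cx'.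
have [_ _ sk hk] := rk; have kx := nbhs_singleton hk.
exists k; split => //; first by rewrite -kx hf.
have nE : nbhs (f x) E by apply: open_nbhs_nbhs.
have ch : {for f x, continuous h} by case: (sh _ Ey).
have [_ hN _] := pN; have [hN' _ _] := pN.
have A : \forall y \near f x, g (k (d y)) = d y.
  have fg' : \forall y \near f x, d (f (h y)) = g (c (h y)).
    by have := ch; rewrite /prop_for /continuous_at hf // => /(_ _ fg).
  move: (nbhsI nE (nbhsI hk fg')); apply: nbhsS => y /= [Ey' [<- <-]].
  by have [z Dz <-] := fs y Ey'; rewrite hf.
have := homeomorphic_chart_nbhs (hN' _ ad) dx A.
by apply: nbhsS => _ [z [E0 _] <-].
Qed.

Lemma right_inverse_surjective n m (a : 'rV[R]_m) (g : 'rV[R]_n -> 'rV[R]_m) k :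
  smooth_near a k -> smooth_near (k a) g -> (\forall u \near a, g (k u) = u) ->
  forall w, exists v, 'd g (k a) v = w.
Proof.
move=> /smooth_near_differentiable dk /smooth_near_differentiable dg gk w.
exists ('d k a w); rewrite -[LHS](diff_compE w dk dg).
have idE : \forall z \near a, id z = (g \o k) z by apply: nbhsS gk => z /= ->.
have [did didE] := is_diff_id a.
have [_ E] := near_eq_differentiable idE did.
exact: (etrans (congr1 (fun h => h w) E) (congr1 (fun h => h w) didE)).
Qed.

Lemma diffeo_on_im M N D E (f : M -> N) : diffeo_on D E f -> E = f @` D.
Proof.
move=> [_ _ [fDE _ fi] _ _]; apply/seteqP; split=> [y /fi //|_ [x Dx <-]].
exact: fDE.
Qed.

Lemma diffeo_on_comp_im M N P D E E' F (f : M -> N) (h : N -> P) :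
  premanifold M -> premanifold N ->
  diffeo_on D E f -> diffeo_on E' F h -> f @` D `<=` E' ->
  diffeo_on D ((h \o f) @` D) (h \o f).
Proof.
move=> pM pN df dh fDE; have EE := diffeo_on_im df; rewrite EE in df.
by rewrite -image_comp; apply: diffeo_on_comp dh fDE.
Qed.

Lemma diffeo_on_comp_sub M N P D E D' E' (f : M -> N) (h : N -> P) :
  premanifold M -> premanifold N -> diffeo_on D E f -> diffeo_on D' E' h ->
  diffeo_on (D `&` f @^-1` D') ((h \o f) @` (D `&` f @^-1` D')) (h \o f).
Proof.
move=> pM pN df dh; have [oD _ _ sf _] := df; have [oD' _ _ _ _] := dh.
have oDD : open (D `&` f @^-1` D').
  by apply: open_preimage_in => // z Dz; case: (sf z Dz).
have d1 := diffeo_on_sub df oDD (@subIsetl _ _ _).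
by apply: (diffeo_on_comp_im pM pN d1 dh) => _ [z [_ D'z] <-].
Qed.

Lemma local_diffeo_nbhs M N (f : M -> N) x A :
  local_diffeo_at f x -> nbhs x A -> nbhs (f x) (f @` A).
Proof.
move=> [D [E [Dx df]]] /near_open [U [oU Ux UA]].
have [oD _ _ _ _] := df.
have [_ oE [h _ _] _ _] := diffeo_on_sub df (openI oD oU) (@subIsetl _ D U).
have : nbhs (f x) (f @` (D `&` U)).
  by apply: open_nbhs_nbhs; split => //; apply: h.
by apply: nbhsS => _ [z [_ /UA Az] <-]; exists z.
Qed.

Lemma local_diffeo_smooth M N (f : M -> N) x : local_diffeo_at f x -> smooth_at f x.
Proof. by move=> [D [E [Dx [_ _ _ sf _]]]]; apply: sf. Qed.

Lemma local_diffeo_continuous M N (f : M -> N) x :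
  local_diffeo_at f x -> {for x, continuous f}.
Proof. by move=> /local_diffeo_smooth []. Qed.

Lemma local_diffeo_inv M N (f : M -> N) x : local_diffeo_at f x ->
  exists D E (h : N -> M), [/\ diffeo_on D E f, diffeo_on E D h, D x,
    forall z, D z -> h (f z) = z & forall y, E y -> f (h y) = y].
Proof.
move=> [D [E [Dx df]]]; have [h [dh hf fh]] := diffeo_on_inv df.
by exists D, E, h.
Qed.

End LocalDiffeo.

(** * The functor induced by a local diffeomorphism over the base *)

Section EtaleFunctor.
Variables (R : realType) (L M : smooth_space R) (Q : Type).
Variables (rho : L -> Q) (pi : M -> Q) (lam : L -> M).
Hypotheses (pL : premanifold L) (pM : premanifold M).
Hypotheses (lamP : forall x, pi (lam x) = rho x) (lamD : forall x, local_diffeo_at lam x).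
Hypothesis lamS : forall y : M, exists (x : L) (a : germ_arrow pi),
  germ_src a = lam x /\ germ_tgt a = y.

Local Notation G := (germ_groupoid rho).
Local Notation H := (germ_groupoid pi).

Definition conj_germs (f : L -> L) (k : M -> M) (D : set L) :=
  forall z, D z -> k (lam z) = lam (f z).

(** The conjugate is [lam \o f \o mu], with [mu] a local inverse of [lam] at [x]; it preserves [pi]
    because [lam] lies over the base. *)
Lemma local_push D f x : Psi rho D f -> D x ->
  exists D' E k, [/\ D' x, D' `<=` D, open D', Psi pi E k &
     lam @` D' `<=` E /\ conj_germs f k D'].
Proof.
move=> pf Dx; have oD := Psi_open pf.
have [D1 [E1 [mu [dl dmu D1x mul lmu]]]] := local_diffeo_inv (lamD x).
have [D2 [E2 [D2x dl2]]] := lamD (f x).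
have oD1 : open D1 by case: dl.
have oD2 : open D2 by case: dl2.
have oD' : open (D1 `&` (D `&` f @^-1` D2)).
  apply: openI => //; apply: open_preimage_in => // z Dz.
  exact: Psi_continuous pf Dz.
have D'D : D1 `&` (D `&` f @^-1` D2) `<=` D by move=> z [_ []].
exists (D1 `&` (D `&` f @^-1` D2)), (lam @` (D1 `&` (D `&` f @^-1` D2))), (lam \o f \o mu).
set D' := _ `&` _ in oD' D'D *; split => //; last first.
  by split=> [//|z [D1z _]] /=; rewrite mul.
have D'D1 : D' `<=` D1 by move=> z [].
have dl' := diffeo_on_sub dl oD' D'D1.
have [_ oE' [ h1 _ h2] _ _] := dl'.
have E'E : lam @` D' `<=` E1.
  by move=> _ [z /D'D1 D1z <-]; case: dl => _ _ [h _ _] _ _; apply: h.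
have dmu' := diffeo_on_sub dmu oE' E'E.
have muD : mu @` (lam @` D') `<=` D'.
  by move=> _ [_ [z D'z <-] <-]; rewrite mul //; apply: D'D1.
split.
  have [df _] := pf.
  have d1 := diffeo_on_comp_im pM pL dmu' df (subset_trans muD D'D).
  apply: (diffeo_on_comp_im pM pL d1 dl2).
  by move=> _ [_ [z D'z <-] <-] /=; rewrite mul; [case: D'z => _ []|apply: D'D1].
move=> _ [z D'z <-] /=; rewrite mul; last exact: D'D1.
by rewrite !lamP; case: pf => _; apply; apply: D'D.
Qed.

(** Here [f] is [mu \o k \o lam], with [mu] the local inverse of [lam] at [y]; the choice of [y] in
    its fiber selects the branch. *)
Lemma local_pull E k x y : Psi pi E k -> E (lam x) -> k (lam x) = lam y ->
  exists D f, [/\ Psi rho D f, D x, f x = y, lam @` D `<=` E & conj_germs f k D].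
Proof.
move=> pk Ex kxy; have oE := Psi_open pk.
have [D1 [E1 [D1x dl]]] := lamD x.
have [D2 [E2 [mu [dl2 dmu D2y mul lmu]]]] := local_diffeo_inv (lamD y).
have [oD1 oE1 [h1 _ _] _ _] := dl; have [oD2 oE2 [h2 _ _] _ _] := dl2.
have cl z : {for z, continuous lam} by apply: local_diffeo_continuous.
pose E' := E `&` k @^-1` E2.
have oE' : open E'.
  by apply: open_preimage_in => // z Ez; apply: Psi_continuous pk Ez.
pose D := D1 `&` lam @^-1` E'.
have oD : open D by apply: open_preimage_in => // z _; apply: cl.
have dl' := diffeo_on_sub dl oD (@subIsetl _ _ _).
have lDE : lam @` D `<=` E by move=> _ [z [_ []] Ez _ <-].
have dk : diffeo_on E (k @` E) k by case: pk.
have d1 := diffeo_on_comp_im pL pM dl' dk lDE.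
have s2 : (k \o lam) @` D `<=` E2 by move=> _ [z [_ [_ Ez]] <-].
have d2 := diffeo_on_comp_im pL pM d1 dmu s2.
exists D, (mu \o (k \o lam)); split => //.
- split=> [//|].
  move=> z [D1z [Ez Ekz]] /=; rewrite -lamP lmu //.
  by case: pk => _ ->.
- by split => //; split => //=; rewrite kxy; apply: h2.
- by rewrite /= kxy mul.
- by move=> z [_ [_ Ekz]] /=; rewrite lmu.
Qed.

(* [b] is the germ of [lam \o f \o lam^-1] for a representative [f] of [a]. *)
Definition pushes (a : germ_arrow rho) (b : germ_arrow pi) : Prop :=
  exists D f E k, [/\ Psi rho D f, germs_of D f a, Psi pi E k, germs_of E k b &
    [/\ germ_src b = lam (germ_src a), lam @` D `<=` E & conj_germs f k D]].

Lemma pushes_tgt a b : pushes a b -> germ_tgt b = lam (germ_tgt a).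
Proof.
move=> [D [f [E [k [pf Da pk Eb [sb _ c]]]]]].
rewrite (germs_of_tgt Da) (germs_of_tgt Eb) sb; apply: c.
by case/germs_ofP : Da.
Qed.

Lemma pushes_src a b : pushes a b -> germ_src b = lam (germ_src a).
Proof. by case=> D [f [E [k [? ? ? ? []]]]]. Qed.

(** Two maps conjugate to [f] agree after composition with [lam], hence near the source of [b],
    since [lam] is open. *)
Lemma pushes_germ a b D f E k : Psi rho D f -> germs_of D f a -> Psi pi E k ->
  E (lam (germ_src a)) -> (\forall z \near germ_src a, k (lam z) = lam (f z)) ->
  pushes a b -> germs_of E k b.
Proof.
move=> pf Da pk Ea ck [D' [f' [E' [k' [pf' D'a pk' E'b [sb _ c]]]]]].
have [D'x aE'] := (germs_ofP _ _ _).1 D'a; have [Dx aE] := (germs_ofP _ _ _).1 Da.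
have [_ ff'] := germ_inj (etrans (esym aE) aE').
have [E'x bE] := (germs_ofP _ _ _).1 E'b.
apply/germs_ofP; rewrite sb; split => //; rewrite bE sb.
apply: eq_germ.
have nD' : nbhs (germ_src a) D' by apply: open_nbhs_nbhs; split => //; apply: Psi_open pf'.
have : \forall z \near germ_src a, k' (lam z) = k (lam z).
  move: (nbhsI nD' (nbhsI ff' ck)); apply: nbhsS => z [D'z [fz ->]].
  by rewrite fz; apply: c.
move=> /(local_diffeo_nbhs (lamD (germ_src a))).
by apply: nbhsS => _ [z + <-].
Qed.

Lemma pushes_unique a b b' : pushes a b -> pushes a b' -> b = b'.
Proof.
move=> ab ab'; have [D [f [E [k [pf Da pk Eb [sb DE c]]]]]] := ab.
have [Dx _] := (germs_ofP _ _ _).1 Da.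
have nD : nbhs (germ_src a) D by apply: open_nbhs_nbhs; split => //; apply: Psi_open pf.
have Ea : E (lam (germ_src a)) by apply: DE; exists (germ_src a).
have ck : \forall z \near germ_src a, k (lam z) = lam (f z) by apply: nbhsS nD => z /c.
have E'b := pushes_germ pf Da pk Ea ck ab'.
have [_ bE] := (germs_ofP _ _ _).1 Eb; have [_ bE'] := (germs_ofP _ _ _).1 E'b.
by apply: germ_arrow_inj; rewrite bE bE' sb (pushes_src ab').
Qed.

Lemma pushes_ex a : exists b, pushes a b.
Proof.
have [D [f [pf Da _ aE]]] := arrow_germ a.
have [D' [E [k [D'x D'D oD' pk [D'E c]]]]] := local_push pf Da.
have Ex : E (lam (germ_src a)) by apply: D'E; exists (germ_src a).
have [b [bE bs bt]] := ex_germ pk Ex.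
exists b, D', f, E, k; split => //.
- exact: Psi_sub pf _ _.
- exact/germs_ofP.
- by apply/germs_ofP; rewrite bs.
Qed.

(** Representatives of both arrows have the same composite with [lam] near the common source, and
    take values near the common target, where [lam] is injective. *)
Lemma pulls_unique a a' b : pushes a b -> pushes a' b ->
  germ_src a = germ_src a' -> germ_tgt a = germ_tgt a' -> a = a'.
Proof.
move=> [D [f [E [k [pf Da pk Eb [sb DE c]]]]]].
move=> [D' [f' [E' [k' [pf' D'a' pk' E'b [sb' DE' c']]]]]] ss tt.
have [Dx aE] := (germs_ofP _ _ _).1 Da; have [D'x aE'] := (germs_ofP _ _ _).1 D'a'.
have [_ bE] := (germs_ofP _ _ _).1 Eb; have [_ bE'] := (germs_ofP _ _ _).1 E'b.
have [_ kk'] := germ_inj (etrans (esym bE) bE').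
apply: germ_arrow_inj; rewrite aE aE' -ss; apply: eq_germ.
rewrite -ss in D'x.
have nD : nbhs (germ_src a) D by apply: open_nbhs_nbhs; split => //; apply: Psi_open pf.
have nD' : nbhs (germ_src a) D' by apply: open_nbhs_nbhs; split => //; apply: Psi_open pf'.
have [Dt [Et [Dtt [oDt _ [_ linj _] _ _]]]] := lamD (germ_tgt a).
have fa : f (germ_src a) = germ_tgt a by rewrite (germs_of_tgt Da).
have fa' : f' (germ_src a) = germ_tgt a by rewrite tt (germs_of_tgt D'a') ss.
have nt : nbhs (germ_tgt a) Dt by apply: open_nbhs_nbhs.
have n1 : nbhs (germ_src a) (f @^-1` Dt).
  by apply: (Psi_continuous pf Dx); rewrite fa.
have n2 : nbhs (germ_src a) (f' @^-1` Dt).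
  by apply: (Psi_continuous pf' D'x); rewrite fa'.
have n3 : nbhs (germ_src a) (lam @^-1` (fun y => k y = k' y)).
  by apply: (local_diffeo_continuous (lamD _)); rewrite -sb.
move: (nbhsI nD (nbhsI nD' (nbhsI n1 (nbhsI n2 n3)))).
apply: nbhsS => z /= [Dz [D'z [h1 [h2 h3]]]].
by apply: linj; rewrite ?inE // -c // -c'.
Qed.

Lemma pulls_ex x y b : germ_src b = lam x -> germ_tgt b = lam y ->
  exists a, [/\ germ_src a = x, germ_tgt a = y & pushes a b].
Proof.
move=> sb tb; have [E [k [pk Eb kb bE]]] := arrow_germ b.
have Ex : E (lam x) by rewrite -sb.
have kx : k (lam x) = lam y by rewrite -sb kb.
have [D [f [pf Dx fx DE c]]] := local_pull pk Ex kx.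
have [a [aE sa ta]] := ex_germ pf Dx.
exists a; split => //; first by rewrite ta.
exists D, f, E, k; split => //; [by apply/germs_ofP; rewrite sa|exact/germs_ofP|].
by split => //; rewrite sa.
Qed.

Definition push (a : germ_arrow rho) : germ_arrow pi := projT1 (cid (pushes_ex a)).

Lemma pushP a : pushes a (push a).
Proof. by rewrite /push; case: cid. Qed.

Definition etale_map : groupoid_map G H := @GroupoidMap R G H lam push.

(** A single [k] conjugate to [f] near the source of [a] represents the pushes of all germs of [f]
    at nearby points. *)
Lemma push_continuous : continuous push.
Proof.
move=> a A /germ_nbhs [E [k [pk Eb EA]]].
have [D [f [pf Da _ aE]]] := arrow_germ a.
have Ga : germs_of D f a by apply/germs_ofP.
have ba := pushP a.
have [E'x bE] := (germs_ofP _ _ _).1 Eb.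
rewrite (pushes_src ba) in E'x.
have ck : \forall z \near germ_src a, k (lam z) = lam (f z).
  have [D' [f' [E' [k' [pf' D'a pk' E'b [sb _ c]]]]]] := ba.
  have [D'x aE'] := (germs_ofP _ _ _).1 D'a.
  have [_ ff'] := germ_inj (etrans (esym aE) aE').
  have [_ bE'] := (germs_ofP _ _ _).1 E'b.
  have [_ kk'] := germ_inj (etrans (esym bE) bE').
  have nD' : nbhs (germ_src a) D' by apply: open_nbhs_nbhs; split => //; apply: Psi_open pf'.
  have n3 : nbhs (germ_src a) (lam @^-1` (fun y => k y = k' y)).
    by apply: (local_diffeo_continuous (lamD _)); rewrite -sb.
  move: (nbhsI nD' (nbhsI ff' n3)); apply: nbhsS => z [D'z [-> ->]].
  exact: c.
have nE : nbhs (germ_src a) (lam @^-1` E).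
  apply: (local_diffeo_continuous (lamD _)); apply: open_nbhs_nbhs.
  by split => //; apply: Psi_open pk.
have nD : nbhs (germ_src a) D by apply: open_nbhs_nbhs; split => //; apply: Psi_open pf.
have [U [oU Ua HU]] := near_open (nbhsI nD (nbhsI nE ck)).
have pU : Psi rho U f by apply: Psi_sub pf _ _ => // z /HU [].
have : nbhs a (germs_of U f : set (germ_arrow rho)).
  by apply: germs_of_nbhs => //; apply/germs_ofP.
apply: nbhsS => a' Ua'; apply: EA.
have [Ux' _] := (germs_ofP _ _ _).1 Ua'.
have [_ [Ex' _]] := HU _ Ux'.
apply: pushes_germ pU Ua' pk Ex' _ (pushP a').
have : nbhs (germ_src a') U by apply: open_nbhs_nbhs.
by apply: nbhsS => z /HU [_ []].
Qed.

Lemma etale_homomorphism : homomorphism etale_map.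
Proof.
have pLam x : smooth_at lam x by apply: local_diffeo_smooth.
split.
- split; first exact: pLam.
  move=> a; apply: smooth_at_germ; first exact: push_continuous.
  apply: (@smooth_at_ext _ (germ_space rho) M (lam \o @germ_src R L Q rho)).
    by apply: filterE => b /=; rewrite (pushes_src (pushP b)).
  by apply: smooth_at_comp => //; apply: smooth_germ_src.
- by move=> a; rewrite /= (pushes_src (pushP a)).
- by move=> a; rewrite /= (pushes_tgt (pushP a)).
- move=> a b /= sbta; apply: pushes_unique (pushP _) _.
  have pa := pushP a; have pb := pushP b.
  have [D [f [E [k [pf Da pk Eb [sb DE c]]]]]] := pa.
  have [D' [f' [E' [k' [pf' D'a pk' E'b [sb' DE' c']]]]]] := pb.
  have comp' : germ_src (push b) = germ_tgt (push a).
    by rewrite (pushes_src pb) (pushes_tgt pa) sbta.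
  have [s1 g1] := germ_comp_src pL pf Da pf' D'a sbta.
  have [s2 g2] := germ_comp_src pM pk Eb pk' E'b comp'.
  exists (D `&` f @^-1` D'), (f' \o f), (E `&` k @^-1` E'), (k' \o k); split => //.
  + exact: Psi_comp_sub.
  + exact: Psi_comp_sub.
  + split; first by rewrite s1 s2.
      move=> _ [z [Dz D'z] <-]; split; first by apply: DE; exists z.
      by rewrite /= c //; apply: DE'; exists (f z).
    by move=> z [Dz D'z]; rewrite /= c // c'.
- move=> e ie; have [eE et] := identity_unit pL ie.
  have [u [uE Tu us]] := ex_unit pi pM (lam (germ_src e)).
  have -> : map1 etale_map e = u.
    apply: pushes_unique (pushP _) _; exists setT, id, setT, id; split => //.
    + exact: Psi_id openT.
    + exact/germs_ofP.
    + exact: Psi_id openT.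
  by apply: unit_identity => //; rewrite us.
Qed.

Lemma etale_surjective y : exists p, @essential_map R G H etale_map p = y.
Proof.
have [x [a [sa ta]]] := lamS y.
have h : (a, x) \in [set p : arr H * obj G | src p.1 = map0 etale_map p.2].
  by rewrite inE.
by exists (exist (fun q => q \in _) (a, x) h).
Qed.

(** Lifts exist and are unique point by point. Smoothness of the lift reduces to continuity, since
    its source is the first component of [b]; continuity says that nearby lifts are germs of one and
    the same map. *)
Lemma etale_fibered : @fibered_product R (arr G) (arr H) (prod_space (obj G) (obj G))
        (prod_space (obj H) (obj H))
        (map1 etale_map) (fun a => (src a, tgt a))
        (fun b => (src b, tgt b))
        (fun p => (map0 etale_map p.1, map0 etale_map p.2)).
Proof.
have [[_ s1] _ _ _ _] := etale_homomorphism.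
have tgerm := @germ_space_transitions R L Q rho pL.
split => //.
- move=> a; apply: smooth_at_pair tgerm _ _; first exact: smooth_germ_src.
  exact: smooth_germ_tgt.
- apply/funext => a /=.
  by rewrite (pushes_src (pushP a)) (pushes_tgt (pushP a)).
move=> Z a b mZ sa sb ab.
have pZ := manifold_premanifold mZ.
have abs z : germ_src (a z) = lam (b z).1 by have := congr1 (fun h => (h z).1) ab.
have abt z : germ_tgt (a z) = lam (b z).2 by have := congr1 (fun h => (h z).2) ab.
have /choice [c Hc] : forall z, exists g : germ_arrow rho,
    [/\ germ_src g = (b z).1, germ_tgt g = (b z).2 & pushes g (a z)].
  by move=> z; apply: pulls_ex.
have cs z : germ_src (c z) = (b z).1 by case: (Hc z).
have ct z : germ_tgt (c z) = (b z).2 by case: (Hc z).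
have cp z : pushes (c z) (a z) by case: (Hc z).
have cb1 z : {for z, continuous (fun z => (b z).1)} by case: (smooth_at_fst (sb z)).
have cb2 z : {for z, continuous (fun z => (b z).2)} by case: (smooth_at_snd (sb z)).
exists c; split; last first.
  move=> c' [_ c'a c'b]; apply/funext => z.
  have := congr1 (fun h => h z) c'b; rewrite /= => bz.
  apply: (pulls_unique (cp z)); rewrite ?cs ?ct -?bz //.
  by have := congr1 (fun h => h z) c'a; rewrite /= => <-; apply: pushP.
split; last 2 first.
- by apply/funext => z; apply: pushes_unique (pushP _) (cp z).
- by apply/funext => z /=; rewrite cs ct -surjective_pairing.
move=> z; apply: smooth_at_germ; last first.
  apply: (@smooth_at_ext _ Z L (fun z => (b z).1)); last exact: smooth_at_fst.
  by apply: filterE => w; rewrite cs.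
move=> A /germ_nbhs [D0 [f0 [pf0 D0c D0A]]].
have [D [f [E [k [pf Dc pk Ea [sE DE cfk]]]]]] := cp z.
have [D1 [p1 D1c _ s2 D1D]] := germs_of_inter pf Dc D0c (Psi_open pf0).
have [D1x cE] := (germs_ofP _ _ _).1 D1c.
have n1 : nbhs z (a @^-1` (germs_of E k : set (germ_arrow pi))).
  by case: (sa z) => ca _; apply: ca; apply: germs_of_nbhs.
have n2 : nbhs z ((fun z => (b z).1) @^-1` D1).
  by apply: cb1; apply: open_nbhs_nbhs; rewrite -cs; split => //; apply: Psi_open p1.
have [Dt [Et [Dtt [oDt _ [_ linj _] _ _]]]] := lamD ((b z).2).
have ntD : nbhs (b z).2 Dt by apply: open_nbhs_nbhs.
have n3 : nbhs z ((fun z => (b z).2) @^-1` Dt) by apply: cb2.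
have n4 : nbhs z ((fun z => (b z).1) @^-1` (f @^-1` Dt)).
  apply: cb1; rewrite -cs; apply: (Psi_continuous p1 D1x).
  by rewrite -(germs_of_tgt D1c) ct.
have : nbhs z (c @^-1` A); last by [].
move: (nbhsI n1 (nbhsI n2 (nbhsI n3 n4))).
apply: nbhsS => w /= [Eaw [D1w [Dtw fDt]]].
(* Both sides lie in [Dt], where [lam] is injective, and have the target of [a w] as image. *)
have fb : f (b w).1 = (b w).2.
  apply: linj; rewrite ?inE //; rewrite -cfk; last exact: D1D.
  by rewrite -abs -abt (germs_of_tgt Eaw).
have [g [gE gs gt]] := ex_germ p1 D1w.
have D1g : germs_of D1 f g by apply/germs_ofP; rewrite gs.
have -> : c w = g.
  apply: (pulls_unique (cp w)); rewrite ?cs ?ct ?gs ?gt ?fb //.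
  exists D1, f, E, k; split => //; split; rewrite ?gs //.
    by apply: subset_trans DE; apply: image_subset.
  by move=> y /D1D; apply: cfk.
exact/D0A/s2.
Qed.

Let ED := essential_domain etale_map.

Lemma essential_domainP (q : ED) : germ_src (\val q).1 = lam (\val q).2.
Proof. exact: (set_mem (valP q)). Qed.

Lemma essential_fst_continuous : continuous (fun q : ED => (\val q).1).
Proof.
by move=> q; apply: (continuous_comp (@set_val_continuous _ _ q)); apply: cvg_fst.
Qed.

Lemma essential_snd_continuous : continuous (fun q : ED => (\val q).2).
Proof.
by move=> q; apply: (continuous_comp (@set_val_continuous _ _ q)); apply: cvg_snd.
Qed.

(** Among pairs whose arrow is a germ of [k], a pair is determined by its point of [L], so the
    coordinates of that point suffice. The chart [c1] around the source of the arrow serves to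
    compare with the product charts. *)
Definition essential_chart E k (c1 : chart R M) (c2 : chart R L) : chart R ED :=
  @Chart R ED (cdim c2)
    [set q | germs_of E k (\val q).1 /\
             (cdom c2 (\val q).2 /\ cdom c1 (lam (\val q).2))]
    (fun q => c2 (\val q).2).

Lemma essential_chart_homeo E k c1 c2 : Psi pi E k -> atlas c1 -> atlas c2 ->
  homeomorphic_chart (essential_chart E k c1 c2).
Proof.
move=> pk a1 a2; have [hL _ _] := pL; have [hM _ _] := pM.
have cl x : {for x, continuous lam} by apply: local_diffeo_continuous.
have [opn2 i2 _] := hL _ a2; have [opn1 _ _] := hM _ a1.
have co := @essential_fst_continuous; have cs := @essential_snd_continuous.
apply: homeomorphic_chartI.
- apply: openI.
    apply: (@open_comp _ _ (fun q : ED => (\val q).1)); first by move=> q _; apply: co.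
    exact: germs_of_open.
  apply: openI.
    by apply: (@open_comp _ _ (fun q : ED => (\val q).2)) => // q _; apply: cs.
  apply: (@open_comp _ _ (fun q : ED => lam (\val q).2)) => // q _.
  by apply: (continuous_comp (cs q)); apply: cl.
- move=> q q'; rewrite !inE => -[g1 [h1 _]] [g2 [h2 _]] /= E0.
  have zz : (\val q).2 = (\val q').2 by apply: i2; rewrite ?inE.
  apply: val_inj; have bb : (\val q).1 = (\val q').1.
    apply: germ_arrow_inj; have [_ ->] := (germs_ofP _ _ _).1 g1.
    by have [_ ->] := (germs_ofP _ _ _).1 g2; rewrite !essential_domainP zz.
  by move: zz bb; case: (\val q) (\val q') => [? ?] [? ?] /= -> ->.
- move=> q [_ [h2 _]]; apply: (continuous_comp (cs q)).
  exact: homeomorphic_chart_continuous (hL _ a2) h2.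
- move=> q A [g1 [h2 h1]] /nbhs_set_val [B nB BA].
  move: nB => [[B1 B2] /= [n1 n2] sB].
  have [E' [k' [pk' g1' sB1]]] := germ_nbhs n1.
  have [E2 [p2 g2 s1 s2 E2E]] := germs_of_inter pk g1 g1' (Psi_open pk').
  have [E2x _] := (germs_ofP _ _ _).1 g2; rewrite essential_domainP in E2x.
  have nE : nbhs (\val q).2 (lam @^-1` (E2 `&` cdom c1)).
    apply: cl; apply: open_nbhs_nbhs; split => //.
    by apply: openI => //; apply: Psi_open p2.
  have := homeomorphic_chart_nbhs (hL _ a2) h2 (nbhsI n2 nE).
  apply: nbhsS => _ [z [[B2z [E2z c1z]] c2z] <-].
  have [b [bE bs bt]] := ex_germ p2 E2z.
  have gb : germs_of E2 k b by apply/germs_ofP; rewrite bs.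
  have h : (b, z) \in [set p : arr H * obj G | src p.1 = map0 etale_map p.2].
    by rewrite inE.
  pose q' : ED := exist (fun q => q \in _) (b, z) h.
  exists q' => //; split; last by split => //=; apply: s1.
  by apply: BA; apply: sB; split => //=; apply/sB1/s2.
Qed.

Lemma essential_chart_atlas E k c1 c2 : Psi pi E k -> atlas c1 -> atlas c2 ->
  atlas (s := ED) (essential_chart E k c1 c2).
Proof.
move=> pk a1 a2; split; first exact: essential_chart_homeo.
move=> q [g1 [h2 h1]].
have sl := local_diffeo_smooth (lamD (\val q).2).
have [g [_ _ sg gE]] := smooth_at_represents pL pM sl a2 a1 h2 h1.
exists (prod_chart (germ_chart pi E k c1) c2), (fun u => row_mx (g u) u), rsubmx.
split.
- by exists (germ_chart pi E k c1), c2; split => //; apply: germ_atlas.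
- split => //=; apply/germs_ofP; rewrite essential_domainP.
  have [Ex bE] := (germs_ofP _ _ _).1 g1; rewrite essential_domainP in Ex bE.
  by split.
- by apply: smooth_near_row => //; apply: smooth_near_id.
- exact: smooth_near_rsubmx.
- have gE' := essential_snd_continuous gE.
  apply: nbhsS gE' => q' /= E0.
  by rewrite essential_domainP row_mxKr E0.
Qed.

(** In an essential chart the map reads [k \o lam], a local diffeomorphism, whose coordinate
    representation has a smooth right inverse. *)
Lemma etale_submersion : submersion (@essential_map R G H etale_map).
Proof.
move=> p.
have ct : {for p, continuous (@essential_map R G H etale_map)}.
  apply: (continuous_comp (@essential_fst_continuous p)).
  exact: germ_tgt_continuous.
split => //.
have [E [k [pk Ex kx bE]]] := arrow_germ (\val p).1.
rewrite essential_domainP in Ex kx bE.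
have gE : germs_of E k (\val p).1 by apply/germs_ofP; rewrite essential_domainP.
have [_ covL _] := pL; have [_ covM _] := pM.
have [c2 a2 h2] := covL (\val p).2; have [c1 a1 h1] := covM (lam (\val p).2).
have [d ad hd] := covM (k (lam (\val p).2)).
have [D1 [E1 [D1x dl]]] := lamD (\val p).2.
have cl : {for (\val p).2, continuous lam} by apply: local_diffeo_continuous.
have oD : open (D1 `&` lam @^-1` E).
  apply: open_preimage_in; [by case: dl|exact: Psi_open pk|].
  by move=> z _; apply: local_diffeo_continuous.
have dl' := diffeo_on_sub dl oD (@subIsetl _ _ _).
have [dk _] := pk.
have dkl : diffeo_on (D1 `&` lam @^-1` E) ((k \o lam) @` (D1 `&` lam @^-1` E)) (k \o lam).
  by apply: (diffeo_on_comp_im pL pM dl' dk) => _ [z [_ Ez] <-].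
have Dx : (D1 `&` lam @^-1` E) (\val p).2 by [].
have sk : smooth_at (k \o lam) (\val p).2 by case: dkl => _ _ _ s _; apply: s.
have [g rg] := smooth_at_represents pL pM sk a2 ad h2 hd.
have [k' [sk' kk' gk']] := diffeo_on_rep pL pM dkl Dx a2 ad rg.
have [_ _ sg gEq] := rg.
exists (essential_chart E k c1 c2), d, g; split => //.
- exact: essential_chart_atlas.
- split => //; first by rewrite /essential_map /= -kx.
  have n1 : nbhs p ((fun q : ED => (\val q).1) @^-1` (germs_of E k : set (germ_arrow pi))).
    by apply: essential_fst_continuous; apply: germs_of_nbhs.
  have n2 := essential_snd_continuous gEq.
  move: (nbhsI n1 n2); apply: nbhsS => q /= [gq <-].
  by rewrite /essential_map /= (germs_of_tgt gq) essential_domainP.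
- have /= := right_inverse_surjective sk' _ gk'.
  by rewrite kk'; apply.
Qed.

Lemma etale_weak_equivalence : weak_equivalence etale_map.
Proof.
split; [exact: etale_homomorphism|exact: etale_submersion|..].
- exact: etale_surjective.
- exact: etale_fibered.
Qed.

End EtaleFunctor.

(** * Open submanifolds *)

Section OpenSubspace.
Variable R : realType.

Lemma rational_rV_dense n (x : 'rV[R]_n) (d : R) : 0 < d ->
  exists q : 'rV[rat]_n, `|map_mx ratr q - x| < d.
Proof.
move=> d0; have d20 : 0 < d / 2 by rewrite divr_gt0.
have /choice [q Hq] : forall j : 'I_n, exists q : rat, `|ratr q - x 0 j| <= d / 2.
  move=> j; have h : x 0 j - d / 2 < x 0 j + d / 2 by rewrite ltrD2l; lra.
  have [q] := rat_in_itvoo h; rewrite in_itv /= => /andP[h1 h2]; exists q.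
  by rewrite ler_norml; apply/andP; split; lra.
exists (\row_j q j); apply: (@le_lt_trans _ _ (d / 2)); last by lra.
by apply/rV_norm_le; [exact: ltW|move=> j; rewrite !mxE].
Qed.

(* A countable family of open sets [E j] whose closed enlargements [F j] each lie
   in a member [A j] of the cover suffices: the sets
   [A j `\` \bigcup_(i < j) F i] are a locally finite refinement. *)
Lemma embedded_paracompact (T : topologicalType) n (e : T -> 'rV[R]_n) :
  continuous e ->
  (forall x A, nbhs x A -> exists2 d, 0 < d & forall y, `|e y - e x| < d -> A y) ->
  paracompact T.
Proof.
move=> ce he C Cop Ccov.
pose idx := ('rV[rat]_n * nat)%type.
pose cen (j : idx) : 'rV[R]_n := map_mx ratr j.1.
pose rad (j : idx) : R := (j.2.+1%:R)^-1.
pose En (j : idx) := [set y | `|e y - cen j| < rad j].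
pose Fn (j : idx) := [set y | `|e y - cen j| <= rad j].
have cn j : continuous (fun y => `|e y - cen j|).
  move=> y; apply: continuous_comp; last exact: norm_continuous.
  apply: (@continuousB _ _ _ e (fun=> cen j)); [exact: ce|exact: cst_continuous].
have oE j : open (En j).
  apply: (@open_comp _ _ (fun y => `|e y - cen j|) [set x | x < rad j]).
    by move=> y _; apply: cn.
  exact: open_lt.
have cF j : closed (Fn j).
  apply: (@closed_comp _ _ (fun y => `|e y - cen j|) [set x | x <= rad j]).
    by move=> y _; apply: cn.
  exact: closed_le.
(* Balls with rational centres and radii [1 / (k + 1)] are numbered by [unpickle]; [good] retains
   those whose closed ball fits into a member of the cover. *)
pose good (m : nat) (j : idx) (A : set T) := [/\ unpickle m = Some j, C A & Fn j `<=` A].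
pose J (m : nat) := exists j A, good m j A.
have cov x : exists m j A, good m j A /\ En j x.
  have [A CA Ax] : exists2 A, C A & A x.
    by have : setT x by []; rewrite -Ccov => -[A]; exists A.
  have nA : nbhs x A by apply: open_nbhs_nbhs; split => //; apply: Cop.
  have [d d0 Hd] := he x A nA.
  (* Both [x] and a point of the closed ball are within [1 / (k + 1)] of its centre, hence within
     [d] of each other. *)
  have [k kd] : exists k : nat, (k.+1%:R)^-1 < d / 2.
    exists (Num.trunc (d / 2)^-1).
    rewrite invf_plt ?posrE ?divr_gt0 //.
    exact: truncnS_gt.
  have k0 : 0 < (k.+1%:R : R)^-1 by rewrite invr_gt0.
  have [q Hq] := rational_rV_dense (e x) k0.
  exists (pickle (q, k)), (q, k), A; split; last by rewrite /En /= distrC.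
  split; [exact: pickleK|by []|].
  move=> y; rewrite /Fn /= /cen /rad /= => Fy; apply: Hd.
  rewrite -(subrKA (map_mx ratr q)); apply: le_lt_trans (ler_normD _ _) _.
  by move: kd Hq Fy; set a := _^-1; set b := `|_|; set c := `|_|; lra.
have /choice [sel Hsel] : forall m, exists jA : idx * set T, J m -> good m jA.1 jA.2.
  move=> m; have [[j [A h]]|nJ] := pselect (J m); first by exists (j, A).
  by exists ((0, 0%N), set0) => /nJ.
pose Em m := En (sel m).1; pose Fm m := Fn (sel m).1; pose Am m := (sel m).2.
have goodE m j A : good m j A -> (sel m).1 = j.
  move=> g; have [p1 _ _] : good m (sel m).1 (sel m).2 by apply: Hsel; exists j, A.
  by case: g => p2 _ _; move: p1; rewrite p2 => -[].
have EF m : Em m `<=` Fm m by move=> y; rewrite /Em /Fm /En /Fn /= => /ltW.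
have covE x : exists2 m, J m & Em m x.
  have [m [j [A [g Ex]]]] := cov x; exists m; first by exists j, A.
  by rewrite /Em (goodE _ _ _ g).
have FA m : J m -> Fm m `<=` Am m by move=> /Hsel [].
have CA m : J m -> C (Am m) by move=> /Hsel [].
pose bad m := \bigcup_(i in [set i | (i < m)%N /\ J i]) Fm i.
have clbad m : closed (bad m).
  apply: closed_bigcup => [|i _]; last exact: cF.
  by apply: (sub_finite_set _ (finite_II m)) => i [].
pose Dm m := Am m `&` ~` bad m.
exists [set B | exists2 m, J m & B = Dm m]; split.
- move=> _ [m Jm ->]; apply: openI; first exact/Cop/CA.
  by apply: closed_openC.
- apply/seteqP; split=> // x _.
  have exm : exists m, `[< J m /\ Am m x >].
    by have [m Jm /EF /(FA _ Jm) h] := covE x; exists m; apply/asboolP.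
  have [m /asboolP [Jm Ax] min] := ex_minnP exm.
  exists (Dm m); first by exists m.
  split => // -[i [im Ji] Fx].
  have /min : `[< J i /\ Am i x >] by apply/asboolP; split => //; apply: FA.
  by rewrite leqNgt im.
- by move=> _ [m Jm ->]; exists (Am m); [exact: CA|move=> x []].
(* [Em m] lies in [Fm m], which is removed from every later set, so only the sets with index at most
   [m] meet it. *)
- move=> x; have [m Jm Ex] := covE x; exists (Em m).
    by apply: open_nbhs_nbhs; split => //; apply: oE.
  apply: (@sub_finite_set _ _ (Dm @` `I_m.+1)); last first.
    by apply: finite_image; apply: finite_II.
  move=> _ [[i Ji ->] [y [[Ay nby] Ey]]]; exists i => //=.
  rewrite ltnS leqNgt; apply/negP => mi; apply: nby; exists m => //.
  exact: EF.
Qed.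

Variable (M : smooth_space R).
Hypothesis pM : premanifold M.

Definition restrict_chart (S : set M) (c : chart R M) : chart R S :=
  @Chart R S (cdim c) (\val @^-1` cdom c) (fun p => c (\val p)).

(** In contrast to [sub_space], whose atlas contains every compatible chart, only restrictions of
    charts of [M] are kept; dimensions and transition maps are then those of [M]. *)
Definition open_space (S : set M) : smooth_space R :=
  @Defs.Space R S [set e | exists c, atlas c /\ e = restrict_chart S c].

Lemma restrict_chart_homeo S c : open S -> atlas c ->
  homeomorphic_chart (restrict_chart S c).
Proof.
move=> oS ac; have [hM _ _] := pM; have [oc ic _] := hM _ ac.
have vc := @set_val_continuous _ S.
apply: homeomorphic_chartI => /=.
- by apply: open_comp oc => x _; apply: vc.
- by move=> x y; rewrite !inE /= => cx cy E; apply: val_inj; apply: ic; rewrite ?inE.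
- move=> x cx; apply: (continuous_comp (vc x)).
  exact: homeomorphic_chart_continuous (hM _ ac) cx.
- move=> x A cx /nbhs_set_val [B nB BA].
  have nS : nbhs (\val x) S.
    by apply: open_nbhs_nbhs; split => //; apply: set_mem; exact: (valP x).
  have := homeomorphic_chart_nbhs (hM _ ac) cx (nbhsI nB nS).
  apply: nbhsS => _ [y [[By /mem_set Sy] cy] <-].
  by exists (exist _ y Sy) => //; split => //; apply: BA.
Qed.

Lemma open_space_premanifold S : open S -> premanifold (open_space S).
Proof.
move=> oS; have [hM cov tM] := pM; split.
- by move=> _ [c [ac ->]]; apply: restrict_chart_homeo.
- by move=> x; have [c ac cx] := cov (\val x); exists (restrict_chart S c) => //; exists c.
- move=> _ _ x [c [ac ->]] [d [ad ->]] /= cx dx.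
  have [g [_ _ sg gE]] := tM c d (\val x) ac ad cx dx.
  by exists g; split => //; apply: set_val_continuous gE.
Qed.

Lemma smooth_at_val S x : open S ->
  smooth_at (M := open_space S) (N := M) \val x.
Proof.
move=> oS; split; first exact: set_val_continuous.
have [_ cov _] := pM; have [c ac cx] := cov (\val x).
exists (restrict_chart S c), c, id; split => //; first by exists c.
by split => //; [exact: smooth_near_id|exact: filterE].
Qed.

Lemma smooth_at_sub S (N : smooth_space R) (F : N -> open_space S) x :
  smooth_at (N := M) (fun z => \val (F z)) x -> smooth_at F x.
Proof.
move=> [cF [c [d [g [ac ad [cx dx sg gE]]]]]]; split.
  move=> A /nbhs_set_val [B nB BA].
  by apply: nbhsS (cF _ nB) => z; apply: BA.
by exists c, (restrict_chart S d), g; split => //; exists d.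
Qed.

Lemma local_diffeo_val S x : open S ->
  local_diffeo_at (M := open_space S) (N := M) \val x.
Proof.
move=> oS; have Sx : S (\val x) by apply: set_mem; exact: (valP x).
pose h (y : M) : open_space S := insubd x y.
have hE y : S y -> \val (h y) = y by move=> /mem_set Sy; rewrite /h insubdK.
have nS : nbhs (\val x) S by apply: open_nbhs_nbhs.
apply: (local_diffeoI (h := h)) => //.
- exact: open_space_premanifold.
- exact: smooth_at_val.
- apply: smooth_at_sub; apply: (@smooth_at_ext _ M M id).
    by apply: nbhsS nS => y /hE ->.
  exact: smooth_at_id.
- apply: filterE => z; rewrite /h; apply: val_inj; rewrite insubdK //; exact: valP.
- by apply: nbhsS nS => y /hE.
Qed.

(** Paracompactness does not pass to arbitrary open subsets; inside one chart domain the coordinates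
    embed [S] in a Euclidean space, which supplies it together with Hausdorffness. *)
Lemma open_space_manifold S c : open S -> atlas c -> S `<=` cdom c ->
  manifold (open_space S).
Proof.
move=> oS ac Sc; have [h1 h2 h3] := open_space_premanifold oS.
have hc := restrict_chart_homeo oS ac.
have Sval (x : S) : cdom (restrict_chart S c) x.
  by apply: Sc; apply: set_mem; exact: (valP x).
have cc x := homeomorphic_chart_continuous hc (Sval x).
have [_ ic _] := hc.
split => //.
- move=> x y cl; apply: ic; rewrite ?inE //; apply: (@norm_hausdorff _ 'rV[R]_(cdim c)).
  move=> A B nA nB; have [z [Az Bz]] := cl _ _ (cc x _ nA) (cc y _ nB).
  by exists (restrict_chart S c z).
- apply: (@embedded_paracompact _ _ (restrict_chart S c)) => [x|x A nA]; first exact: cc.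
  have := homeomorphic_chart_nbhs hc (Sval x) nA.
  move=> /nbhs_ballP [d /= d0 Hd]; exists d => // y yd.
  have [|z [Az _] E] := Hd (restrict_chart S c y).
    by rewrite -ball_normE /= distrC.
  by rewrite -(ic z y) ?inE.
Qed.

End OpenSubspace.

(** * Weak equivalences are etale on objects *)

Section WeakEquivalence.
Variables (R : realType) (L M : smooth_space R) (Q : Type).
Variables (rho : L -> Q) (pi : M -> Q).
Hypotheses (pL : premanifold L) (pM : premanifold M).

Lemma ex_unit_map : exists u : M -> germ_arrow pi,
  [/\ forall y, sval (u y) = germ y id, forall y, germs_of setT id (u y),
      forall y, germ_src (u y) = y, forall y, germ_tgt (u y) = y & continuous u].
Proof.
have /choice [u Hu] := ex_unit pi pM.
have uE y : sval (u y) = germ y id by case: (Hu y).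
have uT y : germs_of setT id (u y) by case: (Hu y).
have us y : germ_src (u y) = y by case: (Hu y).
exists u; split => //; first by move=> y; rewrite (germs_of_tgt (uT y)) us.
move=> y A /germ_nbhs [E [k [pk Eu EA]]].
have [Ey uE'] := (germs_ofP _ _ _).1 Eu; rewrite us in Ey uE'.
have [_ ik] := germ_inj (etrans (esym (uE y)) uE').
have nE : nbhs y E by apply: open_nbhs_nbhs; split => //; apply: Psi_open pk.
have [U [oU Uy HU]] := near_open (nbhsI nE ik).
have : nbhs y U by apply: open_nbhs_nbhs.
apply: nbhsS => z Uz; apply: EA; apply/germs_ofP; rewrite us.
split; first by have [] := HU z Uz.
rewrite uE; apply: eq_germ; have : nbhs z U by apply: open_nbhs_nbhs.
by apply: nbhsS => w /HU [].
Qed.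

Local Notation G := (germ_groupoid rho).
Local Notation H := (germ_groupoid pi).

Variable phi : groupoid_map G H.
Hypothesis wphi : weak_equivalence phi.
Local Notation f := (map0 phi : L -> M).
Let ED := essential_domain phi.

Let f_smooth x : smooth_at f x.
Proof. by case: wphi => -[[sf _] _ _ _ _] _ _ _; apply: sf. Qed.

Let f_continuous x : {for x, continuous f}.
Proof. by case: (f_smooth x). Qed.

(** The map [s] sends [z] to the identity arrow at [f z] paired with [z], so [f] is the essential
    map after [s]. In coordinates [s] becomes [K], whose differential is onto, and the essential map
    becomes [g], a submersion. *)
Lemma weak_equivalence_submersion x : exists (c : chart R L) (d : chart R M)
    (F : 'rV[R]_(cdim c) -> 'rV[R]_(cdim d)),
  [/\ atlas c, atlas d, represents f x F & forall w, exists v, 'd F (c x) v = w].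
Proof.
have [u [uE uT us ut cu]] := ex_unit_map.
have inED z : (u (f z), z) \in [set p : arr H * obj G | src p.1 = map0 phi p.2].
  by rewrite inE /= us.
pose s z : ED := exist (fun q => q \in _) (u (f z), z) (inED z).
have cs : {for x, continuous s}.
  move=> A /nbhs_set_val [B nB BA].
  case: nB => -[B1 B2] /= [n1 n2] sB.
  have n3 : nbhs x (fun z => B1 (u (f z))) := f_continuous (cu _ _ n1).
  by move: (nbhsI n3 n2); apply: nbhsS => z [h1 h2]; apply: BA; apply: sB.
have [_ sub _ _] := wphi; have [_ [e [d [g [[he he'] ad rg sg]]]]] := sub (s x).
have [ex dx sg' gE] := rg.
have [c' [h [k [ac' cx' sh sk hk]]]] := he' _ ex.
have [c1 [c2 [ac1 ac2 c'E]]] := ac'; subst c'.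
have [D0 [k0 [cN [pk0 acN c1E]]]] := ac1; subst c1.
case: cx' => /= c1x c2x.
have cNx : cdom cN (f x) by have [[_ +] _] := (germs_ofP _ _ _).1 c1x; rewrite us.
have [P [_ _ sP PE]] := smooth_at_represents pL pM (f_smooth x) ac2 acN c2x cNx.
pose K v := k (row_mx (P v) v).
have Px : cN (f x) = P (c2 x) := nbhs_singleton PE.
have eK : e (s x) = K (c2 x).
  by have [_ ->] := nbhs_singleton hk; rewrite /= us Px.
have sK : smooth_near (c2 x) K.
  apply: (@smooth_near_comp _ _ _ _ _ (fun v => row_mx (P v) v)).
    by apply: smooth_near_row => //; apply: smooth_near_id.
  by move: sk; rewrite /= us Px.
have gE' := cs _ gE; have hk' := cs _ hk.
exists c2, d, (g \o K); split => //.
- split => //.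
  + by move: dx; rewrite /essential_map /= ut.
  + by apply: smooth_near_comp => //; rewrite -eK.
  + move: (nbhsI PE (nbhsI gE' hk')); apply: nbhsS => z /= [Pz [E0 [_ E]]].
    by move: E0; rewrite /essential_map /= ut => ->; rewrite E us Pz.
- move=> w; rewrite eK in sg sg'.
  have [v1 v1w] := sg w.
  (* The source of an arrow in the essential domain is [f] of the accompanying point, so its
     coordinates are determined by those of the point: [rsubmx \o h] is a right inverse of [K]. *)
  have Ke : \forall v \near e (s x), K (rsubmx (h v)) = v.
    have nq : \forall q \near s x, K (c2 (\val q).2) = e q /\ c2 (\val q).2 = rsubmx (h (e q)).
      have c2v : {for s x, continuous (fun q : ED => (\val q).2)}.
        by apply: (continuous_comp (@set_val_continuous _ _ (s x))); apply: cvg_snd.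
      have c1v : {for s x, continuous (fun q : ED => (\val q).1)}.
        by apply: (continuous_comp (@set_val_continuous _ _ (s x))); apply: cvg_fst.
      have n1 : nbhs (s x) ((fun q : ED => (\val q).1) @^-1` (germs_of setT id : set (germ_arrow pi))).
        by apply: c1v; exact: (germs_of_nbhs (Psi_id _ pM openT) (uT _)).
      move: (nbhsI n1 (nbhsI (c2v _ PE) hk)); apply: nbhsS => q /= [Tq [Pq [hq ek]]].
      have qs : germ_src (\val q).1 = f (\val q).2 by exact: (set_mem (valP q)).
      by rewrite -hq row_mxKr ek qs Pq.
    have := homeomorphic_chart_nbhs he ex nq.
    by apply: nbhsS => _ [q [[E1 E2] _] <-]; rewrite -E2.
  have c2E : rsubmx (h (e (s x))) = c2 x.
    by have [<- _] := nbhs_singleton hk; rewrite /= row_mxKr.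
  have sr : smooth_near (e (s x)) (rsubmx \o h).
    by apply: smooth_near_comp => //; apply: smooth_near_rsubmx.
  have sK' : smooth_near ((rsubmx \o h) (e (s x))) K by rewrite /= c2E.
  have [v2 v2v1] := right_inverse_surjective sr sK' Ke v1.
  rewrite /= c2E in v2v1.
  exists v2; rewrite -v1w -v2v1; apply: diff_compE.
    exact: smooth_near_differentiable.
  exact: smooth_near_differentiable.
Qed.

(* A local section [s] of [f] gives the retraction [s \o f] onto its image along
   the fibers of [f]; lifting the identity arrows of [f x] to arrows from [x] to
   [s (f x)] shows that this retraction is the identity near the base point. *)
Lemma weak_equivalence_local_diffeo x : local_diffeo_at f x.
Proof.
have [u [uE uT us ut cu]] := ex_unit_map.
have [c [d [F [ac ad [cx dx sF FE] surj]]]] := weak_equivalence_submersion x.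
have [s [ss sFa Fs]] := submersion_section sF surj.
have [hL _ _] := pL; have [hM _ _] := pM.
have Fx : d (f x) = F (c x) := nbhs_singleton FE.
rewrite -Fx in ss sFa Fs.
(* The local section [s] read in the manifolds, normalized so that [psi (f x) = x]. *)
pose psi y := chart_inv (c := c) x (s (d y)).
have [cinv cinvK] := chart_inv_near x (hL _ ac) cx.
have cd := homeomorphic_chart_continuous (hM _ ad) dx.
have psix : psi (f x) = x by rewrite /psi sFa chart_invK //; apply: hL.
have csd : {for f x, continuous (fun y => s (d y))}.
  by apply: (continuous_comp cd); apply: smooth_near_continuous.
have cpsi : {for f x, continuous psi}.
  by apply: (continuous_comp csd); rewrite sFa.
have n1 : \forall y \near f x, cdom c (psi y) /\ c (psi y) = s (d y).
  have : nbhs (s (d (f x))) (fun u => cdom c (chart_inv (c := c) x u) /\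
      c (chart_inv (c := c) x u) = u) by rewrite sFa.
  exact: csd.
have spsi : smooth_at psi (f x).
  split => //; exists d, c, s; split => //; split; rewrite ?psix //.
  by apply: nbhsS n1 => y [].
have ndx : nbhs (f x) (cdom d) by apply: chart_dom_nbhs.
have fpsi : \forall y \near f x, f (psi y) = y.
  have n2 : \forall y \near f x, d (f (psi y)) = F (c (psi y)).
    have : nbhs (psi (f x)) (fun z => d (f z) = F (c z)) by rewrite psix.
    exact: cpsi.
  have n3 : \forall y \near f x, cdom d (f (psi y)).
    have : nbhs (psi (f x)) (fun z => cdom d (f z)).
      by rewrite psix; apply: f_continuous ndx.
    exact: cpsi.
  have n4 := cd _ Fs.
  move: (nbhsI ndx (nbhsI n1 (nbhsI n2 (nbhsI n3 n4)))).
  apply: nbhsS => y [dy [[_ cy] [fy [dfy E]]]].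
  have [_ id _] := hM _ ad; apply: id; rewrite ?inE //.
  by rewrite fy cy.
apply: (local_diffeoI pL pM (f_smooth x) spsi _ fpsi).
have nr : \forall z \near x, f (psi (f z)) = f z := f_continuous fpsi.
have nsr : \forall z \near x, smooth_at (psi \o f) z.
  by apply: smooth_at_near => //; apply: smooth_at_comp.
have ncx := chart_dom_nbhs pL ac cx.
(* The test manifold: it lies inside one chart domain, [psi \o f] is smooth on it, and [z] and
   [psi (f z)] have the same image under [f]. *)
have [W [oW Wx HW]] := near_open (nbhsI ncx (nbhsI nr nsr)).
have mZ : manifold (open_space W).
  by apply: (open_space_manifold pL oW ac) => z /HW [].
have pZ := manifold_premanifold mZ; have [_ _ tZ] := pZ.
have Wv (w : W) : W (\val w) := set_mem (valP w).
pose Z := open_space W.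
pose x' : Z := exist (fun z => z \in W) x (mem_set Wx).
have sv w : smooth_at (M := Z) (N := L) \val w by apply: smooth_at_val.
have [_ _ _ [_ sst _ fib]] := wphi.
pose a (w : Z) : arr H := u (f (\val w)).
pose b (w : Z) : prod_space (obj G) (obj G) := (\val w, psi (f (\val w))).
have sa : smooth a.
  move=> w; apply: smooth_at_germ.
    have cfw : {for w, continuous (fun w : W => f (\val w))}.
      exact: (continuous_comp (@set_val_continuous _ _ w) (@f_continuous _)).
    exact: (continuous_comp cfw (cu _)).
  apply: (@smooth_at_ext _ Z M (f \o \val)); first by apply: filterE => z /=; rewrite us.
  exact: smooth_at_comp.
have sb : smooth b.
  move=> w; apply: smooth_at_pair => //.
  apply: (@smooth_at_comp _ Z L L \val (psi \o f)) => //.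
  by have [_ []] := HW _ (Wv w).
have ab : (fun c => (src c, tgt c)) \o a =
    (fun p : prod_space (obj G) (obj G) => (f p.1, f p.2)) \o b.
  apply/funext => w /=; rewrite us ut.
  by have [_ [-> _]] := HW _ (Wv w).
have [l [[sl la lb] _]] := fib Z a b mZ sa sb ab.
have ls w : germ_src (l w) = \val w by have := congr1 (fun h => (h w).1) lb.
have lt w : germ_tgt (l w) = psi (f (\val w)) by have := congr1 (fun h => (h w).2) lb.
have [e [eE eT es]] := ex_unit rho pL x.
(* Test the fibered product on the constant maps at [x]: the constants [l x'] and [e] are both
   lifts, hence equal. *)
have lx : l x' = e.
  pose a0 (w : Z) : arr H := u (f x).
  pose b0 (w : Z) : prod_space (obj G) (obj G) := (x, x).
  have sa0 : smooth a0.
    move=> w; apply: smooth_at_germ; first exact: cst_continuous.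
    exact: smooth_at_cst.
  have sb0 : smooth b0 by move=> w; apply: smooth_at_pair => //; apply: smooth_at_cst.
  have ab0 : (fun c => (src c, tgt c)) \o a0 =
      (fun p : prod_space (obj G) (obj G) => (f p.1, f p.2)) \o b0.
    by apply/funext => w /=; rewrite us ut.
  have [l0 [_ uniq]] := fib Z a0 b0 mZ sa0 sb0 ab0.
  have sg (g : arr G) : smooth (M := Z) (N := arr G) (fun=> g).
    move=> w; apply: smooth_at_germ; first exact: cst_continuous.
    exact: smooth_at_cst.
  have E1 : l0 = fun=> l x'.
    apply: uniq; split; first exact: sg.
      by apply/funext => w /=; have := congr1 (fun h => h x') la.
    by apply/funext => w /=; rewrite ls lt /= psix.
  have E2 : l0 = fun=> e.
    apply: uniq; split; first exact: sg.
      apply/funext => w /=; apply: germ_arrow_inj; rewrite uE.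
      have [[_ msrc _ _ mid] _ _ _] := wphi.
      have ie : is_identity (G := G) e by apply: unit_identity => //; rewrite es.
      have [-> _] := identity_unit pM (mid _ ie).
      by have /= := msrc e; rewrite es => ->.
    by apply/funext => w /=; rewrite es (germs_of_tgt eT) es.
  by rewrite -[RHS]/((fun=> e) x') -E2 E1.
(* Germs of the identity form an open set, so near [x] the lift is such a germ, and its target
   [psi (f z)] equals its source [z]. *)
have nT : nbhs x' (l @^-1` (germs_of setT id : set (germ_arrow rho))).
  have [cl _] := sl x'; apply: cl; rewrite lx.
  exact: (germs_of_nbhs (Psi_id _ pL openT) eT).
have [B nB HB] := nbhs_set_val nT.
have nW : nbhs x W by apply: open_nbhs_nbhs.
move: (nbhsI nB nW); apply: nbhsS => z [Bz /mem_set Wz].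
pose w : Z := exist (fun z => z \in W) z Wz.
have := HB w Bz; move=> /germs_of_tgt; rewrite ls lt.
by [].
Qed.

End WeakEquivalence.

(** * Coproducts and transitions *)

Section Connectedness.
Variable R : realType.

Lemma connected_image (S T : topologicalType) (A : set S) (f : S -> T) :
  connected A -> (forall x, A x -> {for x, continuous f}) -> connected (f @` A).
Proof.
move=> cA cf; apply: connected_continuous_connected => //.
by apply: continuous_in_subspaceT => x; rewrite inE; apply: cf.
Qed.

Lemma ball_connected n (c : 'rV[R]_n) (r : R) : connected [set u | `|u - c| < r].
Proof.
have [r0|r0] := ltP 0 r; last first.
  rewrite (_ : [set u | _] = set0); first exact: connected0.
  by apply/seteqP; split=> u //=; rewrite ltNge (le_trans r0).
pose seg u := (fun t : R => c + t *: (u - c)) @` `[0, 1].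
have -> : [set u | `|u - c| < r] = \bigcup_(u in [set u | `|u - c| < r]) seg u.
  apply/seteqP; split=> [u ur|v [u ur [t t01 <-]]].
    exists u => //; exists 1; first by rewrite /= in_itv /= ler01 lexx.
    by rewrite scale1r addrC subrK.
  move: t01; rewrite /= in_itv /= => /andP[t0 t1].
  rewrite addrC addKr normrZ ger0_norm //; apply: le_lt_trans ur.
  by rewrite ler_piMl.
apply: bigcup_connected.
  exists c => u _; exists 0; first by rewrite /= in_itv /= ler01 lexx.
  by rewrite scale0r addr0.
move=> u _; apply: connected_image; first exact: segment_connected.
move=> t _; apply: (@continuousD _ _ _ (fun=> c) (fun t : R => t *: (u - c))).
  exact: cst_continuous.
exact: scalel_continuous.
Qed.

Lemma connected_set_type (T : topologicalType) (A : set T) :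
  connected A -> connected [set: A].
Proof.
move=> cA B [b Bb] [C oC BC] [D cD BD].
have {}BC : B = C by rewrite BC setTI.
have {}BD : B = D by rewrite BD setTI.
move: oC cD; rewrite -BC -BD => -[W oW WB] /closed_openC [V oV VB].
have imB : \val @` B = A.
  apply: cA.
  - by exists (\val b); exists b.
  - exists W => //; apply/seteqP; split=> [_ [x Bx <-]|y [Ay Wy]].
      by split; [exact: (set_mem (valP x))|move: Bx; rewrite -WB].
    by exists (exist (fun y => y \in A) y (mem_set Ay)) => //; rewrite -WB.
  - exists (~` V); first exact: open_closedC.
    apply/seteqP; split=> [_ [x Bx <-]|y [Ay nVy]].
      split; first exact: (set_mem (valP x)).
      move=> Vx; have : (~` B) x by rewrite -VB.
      exact.
    exists (exist (fun y => y \in A) y (mem_set Ay)) => //.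
    apply: contrapT => nB; apply: nVy.
    by have : (~` B) (exist (fun y => y \in A) y (mem_set Ay)) by []; rewrite -VB.
apply/seteqP; split=> // x _.
have : (\val @` B) (\val x) by rewrite imB; exact: (set_mem (valP x)).
by move=> [y By /val_inj <-].
Qed.

Lemma connected_nbhd (M : smooth_space R) (U : set M) x :
  premanifold M -> open U -> U x ->
  exists C, [/\ open C, connected C, C x & C `<=` U].
Proof.
move=> [hM cov tM] oU Ux; have [c ac cx] := cov x.
have hc := hM _ ac; have nU : nbhs x U by apply: open_nbhs_nbhs.
have [d /= d0 Hd] := (nbhs_ballP _ _).1 (homeomorphic_chart_nbhs hc cx nU).
have [oc ic hO] := hc.
pose B := [set u | `|u - c x| < d].
have BI u : B u -> exists y, [/\ U y, cdom c y & c y = u].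
  move=> Bu; have [|y [Uy cy] yu] := Hd u; last by exists y.
  by rewrite -ball_normE /= distrC.
have im : (cdom c `&` c @^-1` B) = (chart_inv (c := c) x) @` B.
  apply/seteqP; split=> [y [cy By]|_ [u /[dup] /BI [y [Uy cy <-]] By <-]].
    by exists (c y) => //; rewrite chart_invK.
  by rewrite chart_invK.
exists (cdom c `&` c @^-1` B); split.
- apply: open_preimage_in => //; last by move=> y; apply: homeomorphic_chart_continuous.
  apply: (@open_comp _ _ (fun u : 'rV[R]_(cdim c) => `|u - c x|)
    [set x | x < d]); last exact: open_lt.
  move=> u _; apply: continuous_comp; last exact: norm_continuous.
  by apply: (@continuousB _ _ _ id (fun=> c x)); [exact: cvg_id|exact: cst_continuous].
- rewrite im; apply: connected_image; first exact: ball_connected.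
  by move=> u /BI [y [Uy cy <-]]; case: (chart_inv_near x hc cy).
- by split => //; rewrite /B /= subrr normr0.
- move=> y [cy /BI [z [Uz cz zy]]]; suff <- : z = y by [].
  by apply: ic; rewrite ?inE.
Qed.

Lemma connected_component_open (M : smooth_space R) (U : set M) x :
  premanifold M -> open U -> open (connected_component U x).
Proof.
move=> pM oU; rewrite openE => y Cy.
have Uy : U y := connected_component_sub Cy.
have [C [oC cC Cy' CU]] := connected_nbhd pM oU Uy.
have : nbhs y C by apply: open_nbhs_nbhs.
apply: nbhsS => z Cz; rewrite (same_connected_component Cy).
exact: connected_component_max Cy' CU cC _ Cz.
Qed.

End Connectedness.

(** * Disjoint unions *)

Section Coproduct.
Variables (R : realType) (I : choiceType) (M : I -> smooth_space R).
Hypothesis pM : forall i, premanifold (M i).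
Local Notation T := (fun i => carrier (M i)).
Local Notation inj i := (existT T i).

Lemma coprod_chartE i (c : chart R (M i)) x :
  @coprod_chart R I T i c (inj i x) = c x.
Proof.
exact: (@untagE I T _ 0 i c (inj i x) erefl).
Qed.

Lemma existT_eq i (x y : M i) : inj i x = inj i y -> x = y.
Proof. exact: eq_from_Tagged. Qed.

Lemma coprod_chart_homeo i (c : chart R (M i)) : atlas c ->
  homeomorphic_chart (@coprod_chart R I T i c).
Proof.
move=> ac; have [hM _ _] := pM i; have hc := hM _ ac; have [oc ic _] := hc.
apply: homeomorphic_chartI.
- exact: existT_open_map.
- move=> p q; rewrite !inE => -[x cx <-] [y cy <-]; rewrite !coprod_chartE => E.
  by congr existT; apply: ic; rewrite ?inE.
- move=> _ [x cx <-] A nA.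
  have := homeomorphic_chart_continuous hc cx; rewrite /prop_for /continuous_at.
  rewrite -(coprod_chartE c x) => /(_ _ nA) H.
  change (nbhs x (fun y => A (@coprod_chart R I T i c (inj i y)))).
  by apply: nbhsS H => y; rewrite /preimage /= -(coprod_chartE c y).
- move=> _ A [x cx <-] nA; rewrite coprod_chartE.
  have nx : nbhs x (inj i @^-1` A) by [].
  have := homeomorphic_chart_nbhs hc cx nx.
  apply: nbhsS => _ [y [Ay cy] <-]; exists (inj i y); last exact: coprod_chartE.
  by split => //; exists y.
Qed.

Lemma coprod_premanifold : premanifold (coprod_space M).
Proof.
split.
- by move=> _ [i [c [ac ->]]]; apply: coprod_chart_homeo.
- move=> [i x]; have [_ cov _] := pM i; have [c ac cx] := cov x.
  by exists (@coprod_chart R I T i c); [exists i, c|exists x].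
- move=> _ _ p [i [c [ac ->]]] [j [d [ad ->]]] [x cx <-] [y dy E].
  have ji : j = i := congr1 tag E.
  subst j; have yx := existT_eq E; subst y.
  have [_ _ tM] := pM i; have [g [_ _ sg gE]] := tM c d x ac ad cx dy.
  exists g; split; [by exists x|by exists x|by rewrite coprod_chartE|].
  change (nbhs x (fun z => @coprod_chart R I T i d (inj i z) =
    g (@coprod_chart R I T i c (inj i z)))).
  by apply: nbhsS gE => z; rewrite !coprod_chartE.
Qed.

Lemma local_diffeo_existT i (x : M i) :
  local_diffeo_at (M := M i) (N := coprod_space M) (existT T i) x.
Proof.
have pC := coprod_premanifold; have [_ cov _] := pM i; have [c ac cx] := cov x.
pose h (p : coprod_space M) : M i := untag x id p.
have hE y : h (inj i y) = y by exact: (@untagE I T _ x i id (inj i y) erefl).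
have ci : atlas (s := coprod_space M) (@coprod_chart R I T i c) by exists i, c.
have n1 : \forall p \near inj i x, inj i (h p) = p.
  change (nbhs x (fun y => inj i (h (inj i y)) = inj i y)).
  by apply: filterE => y; rewrite hE.
apply: (local_diffeoI (h := h)) => //.
- split; first exact: existT_continuous.
  exists c, (@coprod_chart R I T i c), id; split => //; split => //.
  + by exists x.
  + exact: smooth_near_id.
  + by apply: filterE => y; rewrite coprod_chartE.
- split.
    move=> A; rewrite hE => nA.
    change (nbhs x (fun y => A (h (inj i y)))).
    by apply: nbhsS nA => y; rewrite hE.
  exists (@coprod_chart R I T i c), c, id; split => //; split => //.
  + by exists x.
  + by rewrite hE.
  + exact: smooth_near_id.
  + change (nbhs x (fun y => c (h (inj i y)) = @coprod_chart R I T i c (inj i y))).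
    by apply: filterE => y; rewrite hE coprod_chartE.
- by apply: filterE => y; rewrite hE.
Qed.

End Coproduct.

(** * Local diffeomorphisms over [Q] between given points *)

Section Transitions.
Variables (R : realType) (Q : Type).
Implicit Types M N P : smooth_space R.

(** In contrast to [compatible], the map sends [x] to [y] and its domain may be disconnected, so
    these relations can be inverted and composed; connected domains are recovered by shrinking. *)
Definition transition_at M (rho : M -> Q) (x : M) N (pi : N -> Q) (y : N) : Prop :=
  exists (D : set M) (E : set N) (f : M -> N),
    [/\ D x, f x = y, diffeo_on D E f & forall z, D z -> pi (f z) = rho z].

Lemma transition_sym M (rho : M -> Q) x N (pi : N -> Q) y :
  transition_at rho x pi y -> transition_at pi y rho x.
Proof.
move=> [D [E [f [Dx fx df pf]]]].
have [h [dh hf fh]] := diffeo_on_inv df.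
have [_ _ [fDE _ _] _ _] := df; have [_ _ [hED _ _] _ _] := dh.
exists E, D, h; split => //; rewrite -?fx ?hf //; first exact: fDE.
by move=> z Ez; rewrite -pf ?fh //; apply: hED.
Qed.

Lemma transition_trans M (rho : M -> Q) x N (pi : N -> Q) y P (ta : P -> Q) w :
  premanifold M -> premanifold N ->
  transition_at rho x pi y -> transition_at pi y ta w -> transition_at rho x ta w.
Proof.
move=> pM pN [D [E [f [Dx fx df pf]]]] [D' [E' [f' [D'y fy df' pf']]]].
exists (D `&` f @^-1` D'), ((f' \o f) @` (D `&` f @^-1` D')), (f' \o f); split.
- by split => //=; rewrite fx.
- by rewrite /= fx.
- exact: diffeo_on_comp_sub df df'.
- by move=> z [Dz D'z] /=; rewrite pf' // pf.
Qed.

Lemma local_diffeo_transition M (rho : M -> Q) N (pi : N -> Q) (f : M -> N) x :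
  (forall z, pi (f z) = rho z) -> local_diffeo_at f x ->
  transition_at rho x pi (f x).
Proof. by move=> pf [D [E [Dx df]]]; exists D, E, f. Qed.

Lemma transition_arrow M (pi : M -> Q) x y : transition_at pi x pi y ->
  exists a : germ_arrow pi, germ_src a = x /\ germ_tgt a = y.
Proof.
move=> [D [E [f [Dx fx df pf]]]].
have p : Psi pi D f by split; [rewrite -(diffeo_on_im df)|].
by have [a [_ sa ta]] := ex_germ p Dx; exists a; rewrite ta.
Qed.

Lemma transition_dim M (rho : M -> Q) x N (pi : N -> Q) y n m :
  premanifold M -> premanifold N -> has_dim n M -> has_dim m N ->
  transition_at rho x pi y -> n = m.
Proof.
move=> pM pN hn hm [D [E [f [Dx fx df _]]]].
have [_ cM _] := pM; have [_ cN _] := pN.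
have [c ac cx] := cM x; have [d ad dy] := cN (f x).
rewrite -(hn c x ac cx) -(hm d (f x) ad dy).
exact: diffeo_on_dim df Dx ac ad cx dy.
Qed.

Lemma transition_connected M (rho : M -> Q) x N (pi : N -> Q) y :
  premanifold M -> transition_at rho x pi y ->
  exists (D : set M) (E : set N) (f : M -> N),
    [/\ open D /\ open E, connected D /\ connected E, D x /\ E y,
        diffeo_on D E f & forall z, D z -> pi (f z) = rho z].
Proof.
move=> pM [D [E [f [Dx fx df pf]]]]; have [oD _ _ sf _] := df.
have [C [oC cC Cx CD]] := connected_nbhd pM oD Dx.
have dC := diffeo_on_sub df oC CD; have [_ oE _ _ _] := dC.
exists C, (f @` C), f; split => //; last by move=> z /CD /pf.
- split => //; apply: connected_image => // z /CD Dz; by case: (sf z Dz).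
- by split => //; exists x.
Qed.

End Transitions.

Section Compatible.
Variables (R : realType) (Q : topologicalType).
Implicit Types c d e : triple R Q.

Lemma orbifold_chart_premanifold n c : orbifold_chart n c -> premanifold (och_space c).
Proof. by case: c => V G p [[/manifold_premanifold]]. Qed.

Lemma orbifold_chart_fiber n c x y : orbifold_chart n c ->
  och_map x = och_map y -> transition_at (@och_map _ _ c) x (@och_map _ _ c) y.
Proof.
case: c x y => [V G p] x y /= [_ [_ dG _ _ _] _ fib _] /fib [g Gg gx].
exists setT, setT, g; split => //; first exact: dG.
by move=> z _; apply/esym/fib; exists g.
Qed.

(** The map in [compatible] may send [x] to a point other than [y]; both lie over the same point of
    [Q], so an element of the group of [d] carries one to the other. *)
Lemma compatibleP n c d : premanifold (och_space c) -> orbifold_chart n d ->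
  compatible c d <-> forall x y, och_map x = och_map y ->
    transition_at (@och_map _ _ c) x (@och_map _ _ d) y.
Proof.
move=> pV od; split=> C.
  move=> x y E; have [x' [tx E']] : exists x',
      transition_at (@och_map _ _ c) x (@och_map _ _ d) x' /\
      och_map x' = och_map y.
    clear od; case: c d pV x y C E => [V G p] [W H q] /= pV x y C /[dup] E /C.
    move=> [D [D' [f [_ _ [Dx Ey] df pf]]]]; exists (f x).
    by split; [exists D, D', f|rewrite pf].
  apply: transition_trans tx _ => //; first exact: orbifold_chart_premanifold od.
  exact: orbifold_chart_fiber od E'.
case: c d pV od C => [V G p] [W H q] /= pV od C x y E.
exact: (transition_connected pV (C x y E)).
Qed.

End Compatible.

(** * Equivalence of atlases *)

Section AtlasEquivalence.
Variables (R : realType) (Q : topologicalType).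
Implicit Types (c d : triple R Q) (S : collection R Q) (U : collection R Q -> Prop).

Definition related c d : Prop := forall x y, och_map x = och_map y ->
  transition_at (@och_map R Q c) x (@och_map R Q d) y.

Lemma related_sym c d : related c d -> related d c.
Proof. by move=> cd x y E; apply: transition_sym; apply: cd. Qed.

Lemma orbifold_chart_dim n c : orbifold_chart n c -> has_dim n (och_space c).
Proof. by case: c => V G p [[]]. Qed.

Lemma atlas_premanifold S c : orbifold_atlas S -> S c -> premanifold (och_space c).
Proof. by move=> [[n hn] _ _] /hn; apply: orbifold_chart_premanifold. Qed.

Lemma atlas_related S c d : orbifold_atlas S -> S c -> S d -> related c d.
Proof.
move=> aS Sc Sd; have [[n hn] comp _] := aS.
exact: (compatibleP (atlas_premanifold aS Sc) (hn _ Sd)).1 (comp _ _ Sc Sd).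
Qed.

Lemma related_trans S c e : orbifold_atlas S ->
  premanifold (och_space c) ->
  (forall d, S d -> related c d) -> (forall d, S d -> related d e) -> related c e.
Proof.
move=> aS pc cS Se x y E; have [_ _ cov] := aS.
have [d' Sd [w _ wE]] := cov (och_map x).
apply: (@transition_trans _ _ _ _ x _ (@och_map R Q d') w) => //.
- exact: atlas_premanifold aS Sd.
- exact: cS.
- by apply: Se => //; rewrite wE.
Qed.

Lemma equivalent_atlasI S S' : orbifold_atlas S -> orbifold_atlas S' ->
  (forall c d, S c -> S' d -> related c d) -> equivalent_atlas S S'.
Proof.
move=> aS aS' rel; split => //.
have [[n hn] comp cov] := aS; have [[m hm] comp' cov'] := aS'.
(* The dimensions are compared at a point. If [Q] is empty they may differ, but then the chart
   spaces are empty too and [has_dim] holds for any number. *)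
have nm (q : Q) : n = m.
  have [c Sc [x _ xq]] := cov q; have [d Sd [y _ yq]] := cov' q.
  have t : transition_at (@och_map R Q c) x (@och_map R Q d) y.
    by apply: rel => //; rewrite xq yq.
  apply: transition_dim t; [exact: atlas_premanifold aS Sc|exact: atlas_premanifold aS' Sd| |].
    exact: orbifold_chart_dim (hn _ Sc).
  exact: orbifold_chart_dim (hm _ Sd).
have hm' c : S' c -> orbifold_chart n c.
  move=> /hm; case: c => V G p [[mV dV cV] h2 h3 h4 h5]; split => //; split => //.
  by move=> c x ac cx; rewrite (nm (p x)); apply: dV ac cx.
split.
- by exists n => c [/hn|/hm'].
- move=> c d [Sc|Sc] [Sd|Sd]; first exact: comp; last exact: comp'.
    apply/(compatibleP (atlas_premanifold aS Sc) (hm _ Sd)); exact: rel.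
  apply/(compatibleP (atlas_premanifold aS' Sc) (hn _ Sd)).
  by apply: related_sym; apply: rel.
- by move=> q; have [c Sc cq] := cov q; exists c => //; left.
Qed.

Lemma equivalent_related S S' c d : equivalent_atlas S S' -> S c -> S' d -> related c d.
Proof. by move=> [_ _ aU] Sc Sd; apply: atlas_related aU _ _; [left|right]. Qed.

Lemma equivalent_sym S S' : equivalent_atlas S S' -> equivalent_atlas S' S.
Proof.
move=> e; have [aS aS' _] := e; apply: equivalent_atlasI => // c d Sc Sd.
by apply: related_sym; apply: equivalent_related e _ _.
Qed.

Lemma equivalent_trans S S' S'' :
  equivalent_atlas S S' -> equivalent_atlas S' S'' -> equivalent_atlas S S''.
Proof.
move=> e e'; have [aS aS' _] := e; have [_ aS'' _] := e'.
apply: equivalent_atlasI => // c d Sc Sd.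
apply: (related_trans aS'); first exact: atlas_premanifold aS Sc.
  by move=> d' Sd'; apply: equivalent_related e _ _.
by move=> d' Sd'; apply: equivalent_related e' _ _.
Qed.

Lemma structure_equivalent U S S' : orbifold_structure U -> U S -> U S' ->
  equivalent_atlas S S'.
Proof.
move=> [S0 _ US] /US e /US e'; apply: equivalent_trans e'; exact: equivalent_sym.
Qed.

Lemma structure_atlas U S : orbifold_structure U -> U S -> orbifold_atlas S.
Proof. by move=> [S0 _ US] /US []. Qed.

Lemma structure_closed U S S' : orbifold_structure U -> U S ->
  equivalent_atlas S S' -> U S'.
Proof. by move=> [S0 _ US] /US e e'; apply/US; apply: equivalent_trans e'. Qed.

Lemma structure_unique U U' S S' : orbifold_structure U -> orbifold_structure U' ->
  U S -> U' S' -> equivalent_atlas S S' -> U = U'.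
Proof.
move=> oU oU' US US' e; apply/funext => T; apply/propext; split=> UT.
  apply: structure_closed oU' US' _; apply: equivalent_trans (equivalent_sym e) _.
  exact: structure_equivalent oU US UT.
apply: structure_closed oU US _; apply: equivalent_trans e _.
exact: structure_equivalent oU' US' UT.
Qed.

Definition members (V : indexed_charts R Q) : collection R Q := fun c => exists i, V i = c.

Variable V : indexed_charts R Q.
Hypothesis aV : orbifold_atlas (members V).

Lemma member_premanifold i : premanifold (och_space (V i)).
Proof. by apply: atlas_premanifold aV _; exists i. Qed.

Lemma charts_premanifold : premanifold (charts_space V).
Proof. by apply: coprod_premanifold => i; apply: member_premanifold. Qed.

Lemma charts_inclusion i (x : och_space (V i)) :
  transition_at (@och_map R Q (V i)) x (@charts_map R Q V) (existT _ i x).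
Proof.
apply: (@local_diffeo_transition _ _ _ _ (charts_space V) _ (fun x => existT _ i x)) => //.
exact: (local_diffeo_existT member_premanifold).
Qed.

Lemma charts_transition (p q : charts_space V) : charts_map p = charts_map q ->
  transition_at (@charts_map R Q V) p (@charts_map R Q V) q.
Proof.
case: p q => [i x] [j y] E; have pm := member_premanifold; have pc := charts_premanifold.
apply: (transition_trans pc (pm i) (transition_sym (charts_inclusion x))).
apply: (transition_trans (pm i) (pm j) _ (charts_inclusion y)).
by apply: (atlas_related aV); [exists i|exists j|].
Qed.

Lemma charts_map_surj q : exists p : charts_space V, charts_map p = q.
Proof.
have [_ _ cov] := aV; have [_ [i <-] [x _ xq]] := cov q.
by exists (existT _ i x).
Qed.

End AtlasEquivalence.

(** * Unit weak equivalences between atlas groupoids *)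

Section UnitWeakEquivalence.
Variables (R : realType) (Q : topologicalType) (Z V : indexed_charts R Q).
Hypotheses (aZ : orbifold_atlas (members Z)) (aV : orbifold_atlas (members V)).
Local Notation GZ := (MarkedGroupoid (@alpha R Q Z)).
Local Notation GV := (MarkedGroupoid (@alpha R Q V)).

Lemma arrow_over (W : indexed_charts R Q) (a : germ_arrow (@charts_map R Q W)) :
  charts_map (germ_tgt a) = charts_map (germ_src a).
Proof.
have [D [f [[_ pf] Da <- _]]] := arrow_germ a; exact: pf.
Qed.

(** The chosen representative is joined to [x] by an arrow, and arrows preserve the projection to
    [Q]. *)
Lemma orbit_repr_over (W : indexed_charts R Q) (O : orbit_space (Gamma W)) x :
  orbifold_atlas (members W) -> O = orbit_class x ->
  charts_map (orbit_repr O) = charts_map x.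
Proof.
move=> aW ->; rewrite /orbit_repr; case: cid => /= y E.
have [e [eE eT es]] := ex_unit (@charts_map R Q W) (charts_premanifold aW) x.
have : Defs.orbit (G := Gamma W) x x.
  by exists e; rewrite /= (germs_of_tgt eT) es.
rewrite E => -[a [/= sa ta]].
by rewrite -sa -ta arrow_over.
Qed.

(** The marking controls only the image of the chosen representative [y] of the orbit of [z]; [phi]
    maps an arrow from [y] to [z] to an arrow between their images, which therefore lie over the
    same point. *)
Lemma unit_weak_equivalence_over (phi : groupoid_map (Gamma Z) (Gamma V)) :
  unit_weak_equivalence (G := GZ) (H := GV) phi ->
  forall z, charts_map (map0 phi z) = charts_map z.
Proof.
move=> [[[_ msrc mtgt _ _] _ _ _] mk] z.
have aO := orbit_repr_over aZ (erefl (orbit_class (G := Gamma Z) z)).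
have := mk (orbit_class (G := Gamma Z) z) _ erefl; rewrite /= /alpha aO /orbit_map.
rewrite (orbit_repr_over aV erefl) => <-.
rewrite /orbit_repr; case: cid => /= y E.
have [e [eE eT es]] := ex_unit (@charts_map R Q Z) (charts_premanifold aZ) z.
have : Defs.orbit (G := Gamma Z) z z.
  by exists e; rewrite /= (germs_of_tgt eT) es.
rewrite E => -[a [/= sa ta]].
by rewrite -[in RHS]sa -[in LHS]ta -msrc -mtgt /= arrow_over.
Qed.

Lemma unit_weak_equivalence_atlas (phi : groupoid_map (Gamma Z) (Gamma V)) :
  unit_weak_equivalence (G := GZ) (H := GV) phi ->
  equivalent_atlas (members Z) (members V).
Proof.
move=> u; have over := unit_weak_equivalence_over u; have [w _] := u.
have pZ := charts_premanifold aZ; have pV := charts_premanifold aV.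
apply: equivalent_atlasI => // _ _ [i <-] [j <-] x y E.
have t1 := charts_inclusion aZ x; have t2 := charts_inclusion aV y.
have t3 := local_diffeo_transition over (weak_equivalence_local_diffeo pZ pV w (existT _ i x)).
have t4 : transition_at (@charts_map R Q V) (map0 phi (existT _ i x))
    (@charts_map R Q V) (existT _ j y).
  by apply: charts_transition => //; rewrite over.
have mi := member_premanifold aZ i.
apply: (transition_trans mi pZ t1).
apply: (transition_trans pZ pV t3).
exact: (transition_trans pV pV t4 (transition_sym t2)).
Qed.

Lemma etale_unit_weak_equivalence (lam : charts_space Z -> charts_space V) :
  (forall z, charts_map (lam z) = charts_map z) ->
  (forall z, local_diffeo_at lam z) ->
  exists phi : groupoid_map (Gamma Z) (Gamma V),
    unit_weak_equivalence (G := GZ) (H := GV) phi.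
Proof.
move=> over ld; have pZ := charts_premanifold aZ; have pV := charts_premanifold aV.
have surj (y : charts_space V) : exists (x : charts_space Z)
    (a : germ_arrow (@charts_map R Q V)), germ_src a = lam x /\ germ_tgt a = y.
  have [x xE] := charts_map_surj aZ (charts_map y); exists x.
  by apply: transition_arrow; apply: charts_transition => //; rewrite over.
exists (etale_map pZ pV over ld); split.
  exact: etale_weak_equivalence.
move=> O q <- /=; rewrite /alpha.
by rewrite (orbit_repr_over aV erefl) /= over.
Qed.

End UnitWeakEquivalence.

(** * Orbifold charts on small neighbourhoods *)

Section Subcharts.
Variables (R : realType) (Q : topologicalType).

Lemma finite_bigcap_open (T : topologicalType) (I : choiceType) (G : set I)
    (N : I -> set T) :
  finite_set G -> (forall g, G g -> open (N g)) -> open (\bigcap_(g in G) N g).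
Proof.
move=> fG oN; rewrite -[X in open X]setCK setC_bigcap; apply: closed_openC.
by apply: closed_bigcup => // g Gg; apply: open_closedC; apply: oN.
Qed.

Variables (n : nat) (V : smooth_space R) (G : set (V -> V)) (phi : V -> Q).
Hypothesis oc : orbifold_chart n (Triple G phi).

Let mV : manifold V. Proof. by case: oc => -[]. Qed.
Let pV : premanifold V. Proof. exact: manifold_premanifold. Qed.
Let dV : has_dim n V. Proof. by case: oc => -[]. Qed.
Let fG : finite_set G. Proof. by case: oc => _ []. Qed.
Let dG g : G g -> diffeo_on setT setT g. Proof. by case: oc => _ [_ + _ _ _] _ _ _; apply. Qed.
Let fib x y : phi x = phi y <-> exists2 g, G g & g x = y.
Proof. by case: oc. Qed.
Let quot B : B `<=` range phi -> (open B <-> open (phi @^-1` B)).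
Proof. by case: oc => _ _ _ _; apply. Qed.
Let Gid : G id. Proof. by case: oc => _ []. Qed.
Let Gcomp g h : G g -> G h -> G (g \o h).
Proof. by case: oc => _ [_ _ _ + _] _ _ _; apply. Qed.
Let Ginv g : G g -> exists2 h, G h & cancel g h /\ cancel h g.
Proof. by case: oc => _ [_ _ _ _ +] _ _ _; apply. Qed.
Let cG g x : G g -> {for x, continuous g}.
Proof. by move=> /dG [_ _ _ sg _]; case: (sg x I). Qed.

Lemma orbifold_chart_continuous x : {for x, continuous phi}.
Proof.
move=> A /near_open [B [oB Bx BA]].
have oR : open (range phi) by case: oc.
have o : open (B `&` range phi) by apply: openI.
have : nbhs x (phi @^-1` (B `&` range phi)).
  by apply: open_nbhs_nbhs; split; [apply/quot => // y []|split => //; exists x].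
by apply: nbhsS => z [/BA].
Qed.

(** The saturation of [U] is the union of its translates under the group, hence open. *)
Lemma orbifold_chart_open (U : set V) : open U -> open (phi @` U).
Proof.
move=> oU; apply/quot; first by move=> _ [x _ <-]; exists x.
have -> : phi @^-1` (phi @` U) = \bigcup_(g in G) g @^-1` U.
  apply/seteqP; split=> [y [z Uz zy]|y [g Gg Ugy]].
    by have [g Gg gy] := (fib y z).1 (esym zy); exists g => //=; rewrite gy.
  by exists (g y) => //; apply/esym/fib; exists g.
apply: bigcup_open => g Gg; apply: open_comp oU => x _; exact: cG.
Qed.

Definition stabilizer x : set (V -> V) := [set g | G g /\ g x = x].

Lemma stabilizer_nbhd x D : open D -> D x -> exists S : set V,
  [/\ open S, connected S, S x, S `<=` D &
    (forall g z, stabilizer x g -> S z -> S (g z)) /\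
    (forall g z, G g -> S z -> S (g z) -> g x = x)].
Proof.
move=> oD Dx; have [_ _ _ hV _] := mV.
have /choice [N HN] : forall g, exists N : set V, G g -> [/\ open N, N x,
    g x = x -> forall z, N z -> D (g z) &
    g x <> x -> forall z, N z -> ~ N (g z)].
  move=> g; have [Gg|nGg] := pselect (G g); last by exists setT.
  have [gx|gx] := pselect (g x = x).
    exists (g @^-1` D) => _; split=> //=; last by rewrite gx.
    by apply: open_comp oD => z _; apply: cG.
  have h2 := hV; rewrite open_hausdorff in h2.
  have /eqP/h2 [[A B] /= [xA gxB] [oA oB /eqP AB0]] : x <> g x by move=> E; apply: gx.
  rewrite !inE in xA gxB.
  exists (A `&` g @^-1` B) => _; split=> //.
  - by apply: open_preimage_in => // z _; apply: cG.
  - move=> _ z [Az Bgz] [Agz _].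
    by have : (A `&` B) (g z) by []; rewrite AB0.
pose U := \bigcap_(g in G) N g.
have oU : open U by apply: finite_bigcap_open => // g /HN [].
have Ux : U x by move=> g /HN [].
have UD : U `<=` D by move=> z /(_ id Gid) Nz; have [_ _ /(_ erefl z Nz)] := HN _ Gid.
have fS : finite_set (stabilizer x) by apply: sub_finite_set fG => g [].
pose U1 := \bigcap_(g in stabilizer x) g @^-1` U.
have oU1 : open U1.
  by apply: finite_bigcap_open => // g [Gg _]; apply: open_comp oU => z _; apply: cG.
have U1x : U1 x by move=> g [_ gx] /=; rewrite gx.
have Sid : stabilizer x id by [].
have U1U : U1 `<=` U by move=> z /(_ id Sid).
have U1g g z : stabilizer x g -> U1 z -> U1 (g z).
  move=> [Gg gx] U1z h [Gh hx]; apply: (U1z (h \o g)).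
  by split; [exact: Gcomp|rewrite /= gx].
exists (connected_component U1 x); split.
- exact: connected_component_open.
- exact: component_connected.
- exact: connected_component_refl.
- by move=> z /connected_component_sub /U1U /UD.
- split=> [g z Sg Sz|g z Gg Sz Sgz].
    have [Gg gx] := Sg.
    have : (g @` connected_component U1 x) (g z) by exists z.
    apply: connected_component_max.
    - by exists x => //; apply: connected_component_refl.
    - by move=> _ [y /connected_component_sub U1y <-]; apply: U1g.
    - apply: connected_image; first exact: component_connected.
      by move=> y _; apply: cG.
  apply: contrapT => gx; have [_ _ _ /(_ gx z)] := HN _ Gg; apply.
    exact: (U1U _ (connected_component_sub Sz)).
  exact: (U1U _ (connected_component_sub Sgz)).
Qed.

(** The new group consists of the restrictions of the stabilizer of [x]. Two points of [S] in one
    fiber of [phi] differ by an element of [G] under which [S] meets its image, that is, by an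
    element of the stabilizer. [S] is also taken inside a chart domain, to be a manifold. *)
Lemma orbifold_subchart x D : open D -> D x -> exists (S : set V)
    (G' : set (open_space S -> open_space S)),
  [/\ open S, S x, S `<=` D &
    orbifold_chart n (Triple G' (fun z : open_space S => phi (\val z)))].
Proof.
move=> oD Dx; have [_ cov _] := pV; have [c0 ac0 c0x] := cov x.
have oDc : open (D `&` cdom c0).
  by apply: openI => //; have [hM _ _] := pV; case: (hM _ ac0).
have [S [oS cS Sx SDc [Sstab Sfree]]] := stabilizer_nbhd oDc (conj Dx c0x).
have SD : S `<=` D by move=> z /SDc [].
have Sc : S `<=` cdom c0 by move=> z /SDc [].
have Sv (z : S) : S (\val z) := set_mem (valP z).
pose G' : set (open_space S -> open_space S) := [set g' | exists2 g,
  stabilizer x g & forall z : S, \val (g' z) = g (\val z)].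
pose restr (g : V -> V) (z : S) : S := insubd z (g (\val z)).
have restrE g z : stabilizer x g -> \val (restr g z) = g (\val z).
  by move=> Sg; rewrite /restr insubdK //; apply: mem_set; apply: Sstab.
have restrG g : stabilizer x g -> G' (restr g).
  by move=> Sg; exists g => // z; apply: restrE.
have sinv g : stabilizer x g -> exists2 h, stabilizer x h & cancel g h /\ cancel h g.
  move=> [Gg gx]; have [h Gh [gh hg]] := Ginv Gg; exists h => //.
  by split => //; rewrite -[in LHS]gx gh.
have mS : manifold (open_space S) := open_space_manifold pV oS ac0 Sc.
have pS := manifold_premanifold mS.
have sG' g' : G' g' -> forall z, smooth_at g' z.
  move=> [g [Gg _] g'E] z; apply: smooth_at_sub.
  apply: (@smooth_at_ext _ (open_space S) V (g \o \val)).
    by apply: filterE => w; rewrite g'E.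
  apply: smooth_at_comp => //; first exact: smooth_at_val.
  by have [_ _ _ sg _] := dG Gg; apply: sg.
have invG' g' : G' g' -> exists2 h', G' h' & cancel g' h' /\ cancel h' g'.
  move=> [g Sg g'E]; have [h Sh [gh hg]] := sinv g Sg.
  exists (restr h); first exact: restrG.
  by split=> z; apply: val_inj; rewrite ?restrE ?g'E ?restrE ?gh ?hg.
exists S, G'; split => //; split.
- split => //.
  + move=> _ z [c [ac ->]] cz; exact: dV ac cz.
  + exact: connected_set_type.
- split.
  + apply: (@sub_finite_set _ _ (restr @` stabilizer x)); last first.
      by apply: finite_image; apply: sub_finite_set fG => g [].
    move=> g' [g Sg g'E]; exists g => //; apply/funext => z; apply: val_inj.
    by rewrite restrE ?g'E.
  + move=> g' Gg'; have [h' Gh' [gh hg]] := invG' _ Gg'; split.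
    * exact: openT.
    * exact: openT.
    * split=> [//|y z _ _ /(congr1 h')|y _]; first by rewrite !gh.
      by exists (h' y).
    * by move=> z _; apply: sG'.
    * by exists h'; split=> [z _|z _]; [exact: gh|exact: sG'].
  + by exists id.
  + move=> g' h' [g [Gg gx] g'E] [h [Gh hx] h'E]; exists (g \o h).
      by split; [exact: Gcomp|rewrite /= hx].
    by move=> z; rewrite /= g'E h'E.
  + exact: invG'.
- have := orbifold_chart_open oS; congr open.
  apply/seteqP; split=> [_ [z Sz <-]|_ [z _ <-]]; last by exists (\val z).
  by exists (exist (fun z => z \in S) z (mem_set Sz)).
- move=> y z; split=> [/fib [g Gg gy]|[g' [g [Gg _] g'E] g'y]]; last first.
    by apply/fib; exists g => //; rewrite -g'E g'y.
  have Sg : stabilizer x g.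
    by split => //; apply: (Sfree g (\val y)) => //; rewrite gy.
  exists (restr g); first exact: restrG.
  by apply: val_inj; rewrite restrE.
- move=> B Br; split=> oB.
    apply: open_comp oB => z _.
    exact: (continuous_comp (@set_val_continuous _ _ z) (@orbifold_chart_continuous _)).
  (* Openness descends because both the inclusion of [S] and [phi] are open maps. *)
  have -> : B = phi @` (\val @` ((fun z : open_space S => phi (\val z)) @^-1` B)).
    apply/seteqP; split=> [q Bq|_ [_ [z Bz <-] <-] //].
    have [z _ zq] := Br q Bq; exists (\val z) => //; exists z => //=.
    by rewrite zq.
  apply: orbifold_chart_open.
  rewrite openE => _ [z Bz <-].
  have : nbhs z ((fun z : open_space S => phi (\val z)) @^-1` B) by apply: open_nbhs_nbhs.
  exact: (local_diffeo_nbhs (local_diffeo_val pV z oS)).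
Qed.

End Subcharts.

(** * Common refinements and unit Morita equivalence *)

Section InjectiveFamily.

(** [indexed_charts] forbids repetitions, while different points may select the same chart. [choose]
    picks the same element for all indices with equal value, so its fixed points form the
    subfamily. *)
Lemma ex_injective_subfamily (I : choiceType) (T : Type) (F : I -> T) (J : set I) :
  exists J' : set I, [/\ J' `<=` J, forall i, J i -> exists2 j, J' j & F j = F i &
    forall i j, J' i -> J' j -> F i = F j -> i = j].
Proof.
pose P i : pred I := fun j => `[< J j /\ F j = F i >].
pose r i := choose (P i) i.
have Pi i : J i -> P i i by move=> Ji; apply/asboolP.
have rP i : J i -> J (r i) /\ F (r i) = F i.
  by move=> Ji; apply/asboolP; exact: (chooseP (Pi i Ji)).
have rE i j : J i -> J j -> F i = F j -> r i = r j.
  move=> Ji Jj Fij; have PE : P i = P j by rewrite /P Fij.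
  by rewrite /r PE; apply: choose_id; [rewrite -PE; exact: Pi|exact: Pi].
exists [set i | J i /\ r i = i]; split.
- by move=> i [].
- move=> i Ji; have [Jr Fr] := rP i Ji; exists (r i) => //.
  by split => //; apply: rE.
- move=> i j [Ji <-] [Jj <-] Fij; apply: rE => //.
  by have [_ <-] := rP i Ji; have [_ <-] := rP j Jj.
Qed.

End InjectiveFamily.

Section Refinement.
Variables (R : realType) (Q : topologicalType).

Lemma local_diffeo_comp (M N P : smooth_space R) (f : M -> N) (g : N -> P) x :
  premanifold M -> premanifold N ->
  local_diffeo_at f x -> local_diffeo_at g (f x) -> local_diffeo_at (g \o f) x.
Proof.
move=> pM pN [D [E [Dx df]]] [D' [E' [D'x dg]]].
exists (D `&` f @^-1` D'), ((g \o f) @` (D `&` f @^-1` D')); split => //.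
exact: diffeo_on_comp_sub df dg.
Qed.

Lemma local_diffeo_ext (M N : smooth_space R) (f g : M -> N) x :
  local_diffeo_at f x -> (\forall z \near x, f z = g z) -> local_diffeo_at g x.
Proof.
move=> [D [E [Dx df]]] /near_open [B [oB Bx fg]]; have [oD _ _ _ _] := df.
have d1 := diffeo_on_sub df (openI oD oB) (@subIsetl _ _ _).
exists (D `&` B), (f @` (D `&` B)); split => //.
by apply: diffeo_on_ext d1 => z [_ /fg].
Qed.

Lemma triple_subchart n (c : triple R Q) (x : och_space c) D :
  orbifold_chart n c -> open D -> D x -> exists (S : set (och_space c))
    (G' : set (open_space S -> open_space S)),
  [/\ open S, S x, S `<=` D &
    orbifold_chart n (Triple G' (fun z : open_space S => och_map (\val z)))].
Proof. by case: c x D => V G p x D /= oc oD Dx; apply: (orbifold_subchart oc oD Dx). Qed.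

Variables (V W : indexed_charts R Q).

(** The chart and its two maps are bundled into one type so that they can be chosen simultaneously
    for every point. *)
Record common_subchart n (q : Q) := CommonSubchart {
  sub_triple : triple R Q;
  sub_chart : orbifold_chart n sub_triple;
  sub_left : och_space sub_triple -> charts_space V;
  sub_right : och_space sub_triple -> charts_space W;
  sub_left_over : forall z, charts_map (sub_left z) = och_map z;
  sub_right_over : forall z, charts_map (sub_right z) = och_map z;
  sub_left_diffeo : forall z, local_diffeo_at sub_left z;
  sub_right_diffeo : forall z, local_diffeo_at sub_right z;
  sub_range : exists z : och_space sub_triple, och_map z = q }.

Lemma ex_common_subchart : equivalent_atlas (members V) (members W) ->
  exists n, forall p : charts_space V, inhabited (common_subchart n (charts_map p)).
Proof.
move=> e; have [aV aW _] := e; have [[n hn] _ _] := aV; exists n => -[i x].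
have [[j y] wE] := charts_map_surj aW (charts_map (existT _ i x : charts_space V)).
have mi : members V (V i) by exists i.
have mj : members W (W j) by exists j.
have pi := member_premanifold aV i; have pj := member_premanifold aW j.
have pV := charts_premanifold aV.
have t : transition_at (@och_map R Q (V i)) x (@charts_map R Q W) (existT _ j y).
  apply: (transition_trans pi pj _ (charts_inclusion aW y)).
  exact: (equivalent_related e mi mj (esym wE)).
have [D [E [h [Dx hx dh ho]]]] := t; have [oD _ _ _ _] := dh.
have [S [G' [oS Sx SD oc]]] := triple_subchart (hn _ mi) oD Dx.
have pS := open_space_premanifold pi oS.
have Sv (z : S) : S (\val z) := set_mem (valP z).
constructor.
apply: (@CommonSubchart _ _ _ oc
  (fun z : open_space S => existT _ i (\val z)) (fun z : open_space S => h (\val z))) => /=.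
- by [].
- by move=> z; exact: ho (SD _ (Sv z)).
- move=> z; apply: (@local_diffeo_comp (open_space S) _ (charts_space V) \val
    (fun x : och_space (V i) => existT _ i x)) => //.
    exact: local_diffeo_val.
  exact: (local_diffeo_existT (member_premanifold aV)).
- move=> z; apply: (@local_diffeo_comp (open_space S) _ (charts_space W) \val h) => //.
    exact: local_diffeo_val.
  by exists D, E; split => //; exact: SD (Sv z).
- by exists (exist (fun z => z \in S) x (mem_set Sx)).
Qed.

Lemma orbifold_chart_range n (c : triple R Q) :
  orbifold_chart n c -> open (range (@och_map R Q c)).
Proof. by case: c => V' G p []. Qed.

(* A point of a second-countable space lies in a basic open set inside one of the
   sets [O p]; choosing one [p] for each such basic set gives the subfamily. *)
Lemma ex_countable_cover (P : choiceType) (O : P -> set Q) :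
  @second_countable Q -> (forall p, open (O p)) -> (forall q, exists p, O p q) ->
  exists J : set P, countable J /\ forall q, exists2 p, J p & O p q.
Proof.
move=> [B cB [Bo Bb]] oO cov.
have [[p0 _]|nP] := pselect (exists p : P, True); last first.
  exists set0; split; first exact: countable0.
  by move=> q; have [p _] := cov q; exfalso; apply: nP; exists p.
have /choice [g Hg] : forall b : set Q, exists p, (exists p', b `<=` O p') -> b `<=` O p.
  by move=> b; have [[p bp]|nb] := pselect (exists p', b `<=` O p'); [exists p|exists p0 => /nb].
exists (g @` B); split; first by apply: sub_countable cB; exact: card_image_le.
move=> q; have [p Opq] := cov q.
have nO : nbhs q (O p) by apply: open_nbhs_nbhs.
have [b [Bb' bq] bO] := Bb q _ nO.
exists (g b); first by exists b.
by apply: (Hg b) => //; exists p.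
Qed.

Lemma ex_common_refinement v U : orbifold v U -> representative v U V ->
  representative v U W ->
  exists (Z : indexed_charts R Q) (l : charts_space Z -> charts_space V)
         (r : charts_space Z -> charts_space W),
    [/\ representative v U Z,
        forall z, charts_map (l z) = charts_map z,
        forall z, charts_map (r z) = charts_map z,
        forall z, local_diffeo_at l z
      & forall z, local_diffeo_at r z].
Proof.
move=> [hQ cQ oU] [UV cV] [UW cW].
have e : equivalent_atlas (members V) (members W) := structure_equivalent oU UV UW.
have [aV aW _] := e.
have [n hn] := ex_common_subchart e.
pose sel p : common_subchart n (charts_map p) := inhabited_witness (hn p).
pose F (p : charts_space V) := sub_triple (sel p).
pose Rg (p : charts_space V) := range (@och_map R Q (F p)).
have oRg p : open (Rg p) by apply: orbifold_chart_range (sub_chart (sel p)).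
have covRg q : exists p, Rg p q.
  have [p <-] := charts_map_surj aV q; exists p.
  by have [z zE] := sub_range (sel p); exists z.
(* Every point contributes a chart in the paracompact version; in the second-countable version a
   countable set of points suffices to cover [Q]. *)
have [J [cJ covJ]] : exists J : set (charts_space V),
    match v with Paracompact => True | SecondCountable => countable J end /\
    forall q, exists2 p, J p & Rg p q.
  case: v cQ {hQ oU UV cV UW cW} => [_|cQ].
    by exists setT; split => // q; have [p Rp] := covRg q; exists p.
  exact: ex_countable_cover.
have [J' [J'J covJ' injJ']] := ex_injective_subfamily F J.
have injF : injective (fun j : J' => F (\val j)).
  move=> j j' E; apply: val_inj; apply: injJ' => //; exact: (set_mem (valP _)).
pose Z : indexed_charts R Q := IndexedCharts injF.
pose l0 (j : J') : och_space (Z j) -> charts_space V := @sub_left n _ (sel (\val j)).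
pose r0 (j : J') : och_space (Z j) -> charts_space W := @sub_right n _ (sel (\val j)).
have pZ (j : J') : premanifold (och_space (Z j)).
  exact: orbifold_chart_premanifold (sub_chart (sel (\val j))).
have pV := charts_premanifold aV; have pW := charts_premanifold aW.
have tl (j : J') z : transition_at (@och_map R Q (Z j)) z (@charts_map R Q V) (l0 j z).
  apply: local_diffeo_transition; first exact: sub_left_over.
  exact: sub_left_diffeo.
have aZ : orbifold_atlas (members Z).
  split.
  - by exists n => _ [j <-]; exact: (sub_chart (sel (\val j))).
  - move=> _ _ [j <-] [j' <-].
    apply/(compatibleP (pZ j) (sub_chart (sel (\val j')))) => x y E.
    apply: (transition_trans (pZ j) pV (tl j x)).
    apply: (transition_trans pV pV _ (transition_sym (tl j' y))).
    apply: charts_transition => //; rewrite /l0.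
    by rewrite (@sub_left_over n _ (sel (\val j)) x) (@sub_left_over n _ (sel (\val j')) y).
  - move=> q; have [p Jp Rp] := covJ q; have [p' J'p Fp] := covJ' p Jp.
    exists (F p'); last by rewrite /Rg in Rp; rewrite Fp.
    by exists (exist (fun p => p \in J') p' (mem_set J'p)).
have eZ : equivalent_atlas (members V) (members Z).
  apply: equivalent_atlasI => // _ _ [i <-] [j <-] x y E.
  have pi := member_premanifold aV i.
  apply: (transition_trans pi pV (charts_inclusion aV x)).
  apply: (transition_trans pV pV _ (transition_sym (tl j y))).
  by apply: charts_transition => //; rewrite (@sub_left_over n _ (sel (\val j)) y).
(* Near the summand [j], the glued map is [f j] after the local inverse [h] of the inclusion of that
   summand. *)
have glue (N : smooth_space R) (f : forall j : J', och_space (Z j) -> N) :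
    premanifold N -> (forall j z, local_diffeo_at (f j) z) ->
    forall z : charts_space Z, local_diffeo_at (fun z : charts_space Z => f (tag z) (tagged z)) z.
  move=> pN ldf [j z]; have pC : premanifold (charts_space Z) := charts_premanifold aZ.
  have lz : local_diffeo_at (M := och_space (Z j)) (N := charts_space Z) (existT _ j) z.
    exact: (local_diffeo_existT pZ).
  have [D [E [h [di dh Dz hi ih]]]] := local_diffeo_inv lz.
  have [_ _ [iDE _ _] _ _] := di.
  have Ez : E (existT _ j z) := iDE z Dz.
  have lh : local_diffeo_at h (existT _ j z) by exists E, D.
  have lf : local_diffeo_at (f j \o h) (existT _ j z).
    by apply: (local_diffeo_comp pC (pZ j) lh); rewrite (hi z Dz); apply: ldf.
  apply: local_diffeo_ext lf _; have [oE _ _ _ _] := dh.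
  have : nbhs (existT _ j z : charts_space Z) E by apply: open_nbhs_nbhs.
  by apply: nbhsS => y Ey; rewrite -[in RHS](ih y Ey).
exists Z, (fun z => l0 (tag z) (tagged z)), (fun z => r0 (tag z) (tagged z)).
split.
- split; first exact: structure_closed oU UV eZ.
  case: v cJ {cQ hQ oU UV cV UW cW} => // cJ.
  rewrite /= (eq_countable (card_setT J')).
  by apply: sub_countable cJ; apply: subset_card_le.
- by move=> z; apply: sub_left_over.
- by move=> z; apply: sub_right_over.
- apply: glue => // j z; exact: sub_left_diffeo.
- apply: glue => // j z; exact: sub_right_diffeo.
Qed.

End Refinement.

(** * Unit Morita equivalence and orbifold structures *)

Section UnitMorita.
Variables (R : realType) (v : version) (X : topologicalType).
Implicit Types (G H K : marked_atlas_groupoid R v X) (U : collection R X -> Prop).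

Definition marked_Gamma (V : indexed_charts R X) : marked_groupoid R X :=
  MarkedGroupoid (@alpha R X V).

Lemma unit_morita_representatives U (V W : indexed_charts R X) G H :
  orbifold v U -> representative v U V -> representative v U W ->
  sval G = marked_Gamma V -> sval H = marked_Gamma W -> unit_morita G H.
Proof.
case: G H => [g hg] [h hh] oU rV rW /= gE hE; subst g h.
have [Z [l [r [rZ lo ro ld rd]]]] := ex_common_refinement oU rV rW.
have [_ _ sU] := oU.
have at_ (T : indexed_charts R X) : representative v U T -> orbifold_atlas (members T).
  by move=> [UT _]; apply: structure_atlas sU UT.
have [p1 h1] := etale_unit_weak_equivalence (at_ _ rZ) (at_ _ rV) lo ld.
have [p2 h2] := etale_unit_weak_equivalence (at_ _ rZ) (at_ _ rW) ro rd.
by exists (atlas_groupoid oU rZ), p1, p2.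
Qed.

(** A priori the middle groupoid and [H] arise from other structures [U0] and [U2]. The two weak
    equivalences make the three atlases equivalent, and equivalent atlases generate the same
    structure, so [U2] is [U]. *)
Lemma unit_morita_structure U (V : indexed_charts R X) G H :
  orbifold v U -> representative v U V -> sval G = marked_Gamma V ->
  unit_morita G H -> exists2 W, representative v U W & sval H = marked_Gamma W.
Proof.
case: G H => [g hg] [h [U2 [W [oU2 rW hE]]]] oU rV /= gE; subst g h.
move=> [[k [U0 [Z [oU0 rZ kE]]]] /= [p1 [p2 [w1 w2]]]]; subst k.
have [_ _ sU] := oU; have [_ _ sU2] := oU2; have [_ _ sU0] := oU0.
have [UV _] := rV; have [UZ _] := rZ; have [UW _] := rW.
have e1 := unit_weak_equivalence_atlas (structure_atlas sU0 UZ) (structure_atlas sU UV) w1.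
have e2 := unit_weak_equivalence_atlas (structure_atlas sU0 UZ) (structure_atlas sU2 UW) w2.
exists W => //.
by rewrite (structure_unique sU sU2 UV UW (equivalent_trans (equivalent_sym e1) e2)).
Qed.

Lemma marked_atlas_groupoidP G : exists U V,
  [/\ orbifold v U, representative v U V & sval G = marked_Gamma V].
Proof. exact: svalP G. Qed.

Lemma unit_morita_equivalence : Equivalence (@unit_morita R v X).
Proof.
split.
- move=> G; have [U [V [oU rV GE]]] := marked_atlas_groupoidP G.
  exact: (unit_morita_representatives oU rV rV GE GE).
- by move=> G H [K [p1 [p2 [h1 h2]]]]; exists K, p2, p1.
- move=> G H K GH HK; have [U [V [oU rV GE]]] := marked_atlas_groupoidP G.
  have [W rW HE] := unit_morita_structure oU rV GE GH.
  have [T rT KE] := unit_morita_structure oU rW HE HK.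
  exact: unit_morita_representatives oU rV rT GE KE.
Qed.

End UnitMorita.

Theorem proposition6p3 (R : realType) (v : version) :
  (forall X : topologicalType, Equivalence (@unit_morita R v X)) /\
  (forall (Q : topologicalType) (U : collection R Q -> Prop)
          (hU : orbifold v U) (V : indexed_charts R Q) (hV : representative v U V),
     unit_morita_class (atlas_groupoid hU hV) = orbifold_groupoids hU).
Proof.
split; first exact: unit_morita_equivalence.
move=> Q U hU V hV; have GE : sval (atlas_groupoid hU hV) = marked_Gamma V by [].
apply/funext => H; apply/propext; split=> [GH|[W [hW ->]]].
  have [W hW HE] := unit_morita_structure hU hV GE GH.
  by exists W, hW; case: H {GH} HE => h hh HE; apply: eq_exist; exact: HE.
have HE : sval (atlas_groupoid hU hW) = marked_Gamma W by [].
exact: (unit_morita_representatives hU hV hW GE HE).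
Qed.
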